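(* Let $c\ge 0$, $\alpha\in(0,1)$, $\gamma_n=c(n-1)$ for $n\ge1$, and $n^*\in\mathbb{N}$. Then there exists $N_0=N_0(n^*,\alpha,c)\ge 2$ such that the following holds. Let $N\ge N_0$ and let $F_0^N$ be a symmetric Radon probability measure on $S^{N-1}(\sqrt N)$, used as the initial law of the stochastic Kac process. Denote the joint energy cumulants of order $n$ at time $t\ge 0$ by $\kappa_t^{n}[e_r]$, and the joint energy cumulants of order $n$ under the uniform probability measure on $S^{N-1}(\sqrt N)$ by $\bar\kappa^n[e_r]$, $r\in\mathscr{C}_n$; put $\kappa_t^{n,N}=(\kappa_t^n[e_r])_{r\in\mathscr{C}_n'}$ and $\bar\kappa^{n,N}=(\bar\kappa^n[e_r])_{r\in\mathscr{C}_n'}$. Let $B\ge 1$ be a constant such that $$\max_{1\le n\le n^*}\ \max_{r\in\mathscr{C}_n}\left(\frac{|\kappa_0^n[e_r]|\,N^{\alpha(\mathrm{len}(r)-1)-c(n-1)}}{(n-1)!}\right)^{1/n}\le B .$$ Then there exists a constant $C$, depending only on $B$, such that for all $n\le n^*$ and all $t\ge 0$, $$\|\kappa_t^{n,N}-\bar\kappa^{n,N}\|_{\alpha}\le n!\,C^{n^2}N^{\gamma_n}e^{-\frac{t}{4}} .$$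
   Context: Stochastic Kac model. For $N\ge 2$ the state space is the sphere $S^{N-1}(\sqrt N)=\{v\in\mathbb{R}^N: |v|^2=N\}$. For $i\ne j$ and $\theta\in(-\pi,\pi]$, let $R_{i,j}(\theta)$ be the rotation of $\mathbb{R}^N$ with $(R_{i,j}(\theta)v)_i=\cos(\theta)v_i+\sin(\theta)v_j$, $(R_{i,j}(\theta)v)_j=-\sin(\theta)v_i+\cos(\theta)v_j$, and all other components unchanged. Define $(Q_N\phi)(v)=\frac{1}{N(N-1)}\sum_{i\ne j}\int_{-\pi}^{\pi}\frac{d\theta}{2\pi}\phi(R_{i,j}(\theta)v)$. The stochastic Kac process is the Markov jump process on $S^{N-1}(\sqrt N)$ with generator $N(Q_N-I)$; if its initial law is $F_0^N$, its law $F_t^N$ at time $t\ge0$ satisfies $\frac{d}{dt}\int\phi\,dF_t^N=\int N(Q_N-I)\phi\,dF_t^N$ for all continuous $\phi$. A measure on the sphere is symmetric if it is invariant under all permutations of the coordinates $v_1,\dots,v_N$; symmetry is preserved by the evolution. The uniform probability measure on the sphere is stationary. Energies: $e_i=v_i^2$. Joint cumulants: for labels $i_1,\dots,i_n\in\{1,\dots,N\}$ (repetitions allowed) and a probability measure $F$ on the sphere, the joint cumulant of $e_{i_1},\dots,e_{i_n}$ under $F$ is $\partial_{\xi_{i_1}}\cdots\partial_{\xi_{i_n}}\log\int e^{\sum_i\xi_i v_i^2}F(dv)$ at $\xi=0$; the subscript $t$ means $F=F_t^N$. Partition classifiers: $\mathscr{C}_n$ is the set of $r=(r_1,\dots,r_n)\in\mathbb{N}_0^n$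 with $r_1\ge\dots\ge r_n\ge0$ and $\sum_k r_k=n$. $\mathrm{len}(r)$ is the number of nonzero components of $r$. $1_n=(1,\dots,1)$ and $\mathscr{C}_n'=\mathscr{C}_n\setminus\{1_n\}$. For $r\in\mathscr{C}_n$, the cumulant indexed by $e_r$ is the order-$n$ joint cumulant in which $e_k$ is repeated $r_k$ times, $k=1,\dots,\mathrm{len}(r)$ (it is understood that $N\ge n$ so that the labels make sense). Norm: for $\kappa=(\kappa_r)_{r\in\mathscr{C}_n'}$, $\|\kappa\|_\alpha=\|\kappa\|_{\alpha,n,N}=\sup_{r\in\mathscr{C}_n'}|\kappa_r|(N-1)^{\alpha(\mathrm{len}(r)-1)}$ (equal to $0$ if $\mathscr{C}_n'=\emptyset$). *)

(* Defs.v *)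
From mathcomp Require Import all_boot all_order all_algebra perm.
From mathcomp Require Import all_classical all_reals all_analysis.

Set Implicit Arguments.
Unset Strict Implicit.
Unset Printing Implicit Defensive.

Import Order.TTheory GRing.Theory Num.Theory.
Import numFieldNormedType.Exports.

Local Open Scope classical_set_scope.
Local Open Scope ring_scope.

(* R^N with its Borel sigma-algebra. *)
Notation borel_space R N := (g_sigma_algebraType (@open 'rV[R]_N)).

(* Laws on the sphere are Borel probability measures on R^N that give mass 1 to
   [kac_sphere R N]; integrals against them are taken over that set. *)
Definition kac_sphere (R : realType) (N : nat) : set 'rV[R]_N :=
  [set v | \sum_(i < N) v 0 i ^+ 2 = N%:R].
Arguments kac_sphere : clear implicits.

Definition kac_rotation (R : realType) (N : nat) (i j : 'I_N) (theta : R)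
    (v : 'rV[R]_N) : 'rV[R]_N :=
  \row_k if k == i then cos theta * v 0 i + sin theta * v 0 j
         else if k == j then - sin theta * v 0 i + cos theta * v 0 j
         else v 0 k.

Definition kac_Q (R : realType) (N : nat) (phi : 'rV[R]_N -> R)
    (v : 'rV[R]_N) : R :=
  (N%:R * (N%:R - 1))^-1 *
  \sum_(i < N) \sum_(j < N | i != j)
    \int[lebesgue_measure]_(theta in `[- pi, pi])
      ((2 * pi)^-1 * phi (kac_rotation i j theta v)).

Definition kac_generator (R : realType) (N : nat) (phi : 'rV[R]_N -> R)
    (v : 'rV[R]_N) : R :=
  N%:R * (kac_Q phi v - phi v).

(* [F t], t >= 0, is the law at time t of the Markov jump process on the sphere
   with generator [kac_generator] and initial law [F0]. The generator is bounded
   on the continuous functions, so these laws are exactly the solutions of the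
   forward equation. The derivative in t is taken relative to [0, +oo[, hence
   one-sided at t = 0. *)
Definition kac_law (R : realType) (N : nat)
    (F0 : probability (borel_space R N) R)
    (F : R -> probability (borel_space R N) R) : Prop :=
  [/\ forall A : set (borel_space R N), measurable A -> F 0 A = F0 A,
      forall t : R, 0 <= t -> F t (kac_sphere R N) = 1%E
    & forall phi : 'rV[R]_N -> R, {within kac_sphere R N, continuous phi} ->
      forall t : R, 0 <= t ->
      let m (s : R) := \int[F s]_(v in kac_sphere R N) phi v in
      h^-1 * (m (t + h) - m t) @[h --> within [set h | 0 <= t + h] 0^'] -->
      \int[F t]_(v in kac_sphere R N) kac_generator phi v].

Definition symmetric_law (R : realType) (N : nat)
    (F : probability (borel_space R N) R) : Prop :=
  forall (s : 'S_N) (A : set (borel_space R N)), measurable A ->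
    F ((fun v : 'rV[R]_N => col_perm s v) @^-1` A) = F A.

(* Inner regularity; local finiteness is automatic for a probability. *)
Definition radon_law (R : realType) (N : nat)
    (F : probability (borel_space R N) R) : Prop :=
  forall A : set (borel_space R N), measurable A ->
    F A = ereal_sup
      [set F K | K in [set K : set 'rV[R]_N | compact K /\ K `<=` A]].

(* The uniform probability measure is the unique rotation-invariant one. *)
Definition uniform_sphere_law (R : realType) (N : nat)
    (U : probability (borel_space R N) R) : Prop :=
  U (kac_sphere R N) = 1%E /\
  forall (O : 'M[R]_N) (A : set (borel_space R N)),
    O *m O^T = 1%:M -> measurable A ->
    U ((fun v : 'rV[R]_N => v *m O) @^-1` A) = U A.

Definition energy_log_mgf (R : realType) (N : nat)
    (F : probability (borel_space R N) R) (xi : 'rV[R]_N) : R :=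
  ln (\int[F]_(v in kac_sphere R N)
        expR (\sum_(i < N) xi 0 i * (v : 'rV[R]_N) 0 i ^+ 2)).

Definition joint_cumulant (R : realType) (N : nat)
    (F : probability (borel_space R N) R) (labels : seq 'I_N) : R :=
  foldr (fun (i : 'I_N) (g : 'rV[R]_N -> R) => 'D_(delta_mx 0 i) g)
    (energy_log_mgf F) labels 0.

Definition classifiers (n : nat) : set (n.-tuple nat) :=
  [set r | sorted geq r /\ sumn r = n].
Arguments classifiers : clear implicits.

Definition classifiers' (n : nat) : set (n.-tuple nat) :=
  [set r | classifiers n r /\ tval r <> nseq n 1%N].
Arguments classifiers' : clear implicits.

Definition len (n : nat) (r : n.-tuple nat) : nat := count (predC1 0%N) r.

Definition e_labels (n N : nat) (nN : (n <= N)%N) (r : n.-tuple nat) :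
    seq 'I_N :=
  flatten [seq nseq (tnth r k) (widen_ord nN k) | k <- enum 'I_n].

Definition kappa (R : realType) (n N : nat) (nN : (n <= N)%N)
    (F : probability (borel_space R N) R) (r : n.-tuple nat) : R :=
  joint_cumulant F (e_labels nN r).

(* The index set is finite, and [sup set0 = 0]. *)
Definition cumulant_norm (R : realType) (alpha : R) (n N : nat)
    (k : n.-tuple nat -> R) : R :=
  sup [set `|k r| * (N%:R - 1) `^ (alpha * ((len r)%:R - 1))
      | r in classifiers' n].

(* Main.v *)
(* The moments of the energies of all label sequences form a commutative algebra under
   convolution over splittings, in which the joint cumulants are the logarithm of the moments
   and a collision acts as a ring morphism. Hence the cumulants satisfy an evolution equation
   whose right-hand side is the linear operator [moment_rate] acting on the moments plus a term
   [interaction] that involves only cumulants of lower order, and the cumulants of the uniform law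
   are stationary. With the weight [q ^+ (distinct s).-1], [q = (N - 1)^-alpha], for a sequence
   [s] with [distinct s] different labels, a collision that involves one label of [s]
   keeps the weight or gains a factor [q]; one that involves two labels may lose a factor [q], but
   only a fraction of order [1/N] of the collisions is of this kind. So for large [N] the linear
   part is diagonally dominant with gap 3/8; for pairwise distinct labels this uses that the sum
   of all energies is constant. By induction on the order, the interaction is at most 1/32 of
   [n! C^(n^2) N^(c(n-1))] times the rate [exp (- t / 4)] of the lower orders, and Gronwall's lemma
   for the weighted supremum carries this rate over to order [n]. *)
Require Import Defs.
From mathcomp Require Import all_boot all_order all_algebra perm.
From mathcomp Require Import all_classical all_reals all_analysis.
From mathcomp Require Import measurable_realfun.
From mathcomp Require Import ring lra zify.

Set Implicit Arguments.
Unset Strict Implicit.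
Unset Printing Implicit Defensive.

Import Order.TTheory GRing.Theory Num.Theory.
Import numFieldNormedType.Exports.

Local Open Scope classical_set_scope.
Local Open Scope ring_scope.

(** * Formal cumulants *)

(** Two smallness conditions drive the linear estimates. With [A = 256 * 2 ^ n * n ^ 2] they are
    [A * q <= 1], which makes a gained factor [q] negligible, and [A <= q * (N - 1)], by which the
    rarity of collisions inside a label sequence outweighs a lost factor [q]. Both hold for large
    [N] because alpha lies strictly between 0 and 1. The quadratic exponent in [C ^ (n ^ 2)] makes
    the bound strongly supermultiplicative: a product of two bounds of positive orders adding up to
    [n] falls short of the bound of order [n] by a factor [C ^ (2 * (n - 1))]. This pays for the
    number of splittings and all geometric losses, without any smallness of [B] or [N ^ c]. The gap
    rests on the mean of [cos ^ 4] being less than 1/2: a repeated label that meets a new one loses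
    more than it gains. For a label that occurs once, the mean of [cos ^ 2] is exactly 1/2 and the
    balance is zero, hence the separate argument for distinct labels. The margin 1/8 between the gap
    3/8 and the rate 1/4 is the room for the interaction. *)

Section Convolution.
Variables (T : eqType) (R : comNzRingType).
Implicit Types (f g h : seq T -> R) (s : seq T) (a b : T).

(** If a symmetric function is read as an exponential generating function with one variable per
    label, this is the partial derivative in the variable of [a]; [conv] is the product and
    [conv_cons] the Leibniz rule. *)
Definition shift_label a f : seq T -> R := fun s => f (a :: s).

(** Splitting is by position, so equal labels are distinguishable; this produces the binomial
    coefficients of exponential generating functions. *)
Fixpoint splits s : seq (seq T * seq T) :=
  if s is a :: s' then
    [seq (a :: p.1, p.2) | p <- splits s'] ++ [seq (p.1, a :: p.2) | p <- splits s']
  else [:: ([::], [::])].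

Definition conv f g s : R := \sum_(p <- splits s) f p.1 * g p.2.

Definition conv_unit s : R := (s == [::])%:R.

Lemma conv0 f g : conv f g [::] = f [::] * g [::].
Proof. by rewrite /conv big_seq1. Qed.

Lemma conv_cons f g a s :
  conv f g (a :: s) = conv (shift_label a f) g s + conv f (shift_label a g) s.
Proof. by rewrite /conv /= big_cat /= !big_map. Qed.

Lemma size_splits s : size (splits s) = (2 ^ size s)%N.
Proof. by elim: s => //= a s IH; rewrite size_cat !size_map IH addnn -mul2n expnS. Qed.

Lemma perm_splits s p : p \in splits s -> perm_eq (p.1 ++ p.2) s.
Proof.
elim: s p => [|a s IH] p /=; first by rewrite inE => /eqP ->.
rewrite mem_cat => /orP[] /mapP[p' /IH Hp' ->] /=; first by rewrite perm_cons.
by rewrite perm_catC /= perm_cons perm_catC.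
Qed.

Lemma size_splits_mem s p : p \in splits s -> (size p.1 + size p.2)%N = size s.
Proof. by move/perm_splits/perm_size; rewrite size_cat. Qed.

Lemma convDl f f' g s : conv (fun s => f s + f' s) g s = conv f g s + conv f' g s.
Proof. by rewrite /conv -big_split; apply: eq_bigr => p _; rewrite mulrDl. Qed.

Lemma convDr f g g' s : conv f (fun s => g s + g' s) s = conv f g s + conv f g' s.
Proof. by rewrite /conv -big_split; apply: eq_bigr => p _; rewrite mulrDr. Qed.

Lemma convZl c f g s : conv (fun s => c * f s) g s = c * conv f g s.
Proof. by rewrite /conv mulr_sumr; apply: eq_bigr => p _; rewrite mulrA. Qed.

Lemma convZr c f g s : conv f (fun s => c * g s) s = c * conv f g s.
Proof. by rewrite /conv mulr_sumr; apply: eq_bigr => p _; rewrite mulrCA. Qed.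

Lemma conv_sumr I (r : seq I) (P : pred I) (F : I -> seq T -> R) f s :
  conv f (fun s => \sum_(i <- r | P i) F i s) s = \sum_(i <- r | P i) conv f (F i) s.
Proof.
by rewrite /conv exchange_big /=; apply: eq_bigr => p _; rewrite mulr_sumr.
Qed.

Lemma eq_conv f f' g g' s :
  (forall s', (size s' <= size s)%N -> f s' = f' s') ->
  (forall s', (size s' <= size s)%N -> g s' = g' s') ->
  conv f g s = conv f' g' s.
Proof.
move=> Hf Hg; rewrite /conv; apply: eq_big_seq => p /size_splits_mem Hp.
by rewrite Hf ?Hg // -Hp ?leq_addl ?leq_addr.
Qed.

Lemma convC f g : conv f g = conv g f.
Proof.
apply/funext => s; elim: s f g => [|a s IH] f g; first by rewrite !conv0 mulrC.
by rewrite !conv_cons addrC IH [X in _ + X]IH.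
Qed.

Lemma shift_conv a f g : shift_label a (conv f g) =
  fun s => conv (shift_label a f) g s + conv f (shift_label a g) s.
Proof. by apply/funext => s; rewrite /shift_label -conv_cons. Qed.

Lemma convA f g h : conv f (conv g h) = conv (conv f g) h.
Proof.
apply/funext => s; elim: s f g h => [|a s IH] f g h; first by rewrite !conv0 mulrA.
by rewrite !conv_cons !shift_conv convDl convDr !IH addrA.
Qed.

Lemma shift_unit a : shift_label a conv_unit = fun=> 0.
Proof. by []. Qed.

Lemma conv_zerol g s : conv (fun=> 0) g s = 0.
Proof. by rewrite /conv big1 // => p _; rewrite mul0r. Qed.

Lemma conv_zeror f s : conv f (fun=> 0) s = 0.
Proof. by rewrite /conv big1 // => p _; rewrite mulr0. Qed.

Lemma conv_unitl f : conv conv_unit f = f.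
Proof.
apply/funext => s; elim: s f => [|a s IH] f; first by rewrite conv0 /conv_unit eqxx mul1r.
by rewrite conv_cons shift_unit conv_zerol add0r IH.
Qed.

Lemma conv_unitr f : conv f conv_unit = f.
Proof. by rewrite convC conv_unitl. Qed.

Definition trunc n f : seq T -> R := fun s => if (size s < n)%N then f s else 0.

(** Only the splitting with empty first part evaluates [g] at full length. Equations [conv f g = h]
    with [f [::]] invertible are therefore triangular in the length and can be solved for [g]. *)
Lemma conv_trunc f g s : conv f g s = conv f (trunc (size s) g) s + f [::] * g s.
Proof.
elim: s f g => [|a s IH] f g; first by rewrite !conv0 /trunc /= mulr0 add0r.
rewrite !conv_cons -addrA; congr (_ + _).
  by apply: eq_conv => // s' Hs'; rewrite /trunc /= ltnS Hs'.
by rewrite IH.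
Qed.

Lemma sum_splits_nil (F : seq T * seq T -> R) s :
  \sum_(p <- splits s | p.1 == [::]) F p = F ([::], s).
Proof.
elim: s F => [|a s IH] F; first by rewrite big_mkcond big_seq1.
rewrite /= big_cat /= !big_map /= big_pred0_eq add0r.
exact: (IH (fun p => F (p.1, a :: p.2))).
Qed.

Lemma conv_nonempty f g s : f [::] = 1 ->
  conv f g s = g s + \sum_(p <- splits s | p.1 != [::]) f p.1 * g p.2.
Proof.
move=> f0; rewrite /conv (bigID (fun p => p.1 == [::])) /= sum_splits_nil /=.
by rewrite f0 mul1r.
Qed.

(* Recursion on the length: [Phi f s] may only consult [f] on shorter lists. *)
Definition size_fix (Phi : (seq T -> R) -> seq T -> R) s : R :=
  iter (size s).+1 Phi (fun=> 0) s.

Definition size_causal (Phi : (seq T -> R) -> seq T -> R) :=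
  forall f g s, (forall s', (size s' < size s)%N -> f s' = g s') -> Phi f s = Phi g s.

Lemma size_fixE Phi : size_causal Phi -> forall s, size_fix Phi s = Phi (size_fix Phi) s.
Proof.
move=> HPhi.
have st n m f g s : (size s < n)%N -> (size s < m)%N -> iter n Phi f s = iter m Phi g s.
  elim: n m s => // n IH [|m] // s /= Hn Hm; apply: HPhi => s' Hs'.
  by apply: IH; apply: leq_trans Hs' _.
move=> s; rewrite /size_fix /=; apply: HPhi => s' Hs'.
exact: (st (size s) (size s').+1).
Qed.

Definition sym_fun f := forall s s', perm_eq s s' -> f s = f s'.

Lemma sym_funP f : (forall s1 a b s2, f (s1 ++ [:: a, b & s2]) = f (s1 ++ [:: b, a & s2])) ->
  sym_fun f.
Proof.
move=> Hf.
have mv s1 a s2 : f (s1 ++ a :: s2) = f (a :: s1 ++ s2).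
  elim/last_ind: s1 s2 => [//|s1 b IH] s2.
  by rewrite !cat_rcons Hf IH.
move=> s s'; elim: s s' f Hf mv => [|a s IH] s' f Hf mv.
  by rewrite perm_sym => /perm_nilP ->.
move=> Hp; have as' : a \in s' by rewrite -(perm_mem Hp) mem_head.
move: Hp; case/splitPr: as' => s1 s2 Hp.
rewrite mv; apply: (IH (s1 ++ s2) (shift_label a f)).
- by move=> *; apply: (Hf (a :: _)).
- move=> s3 b s4; rewrite /shift_label.
  elim/last_ind: s3 s4 => [//|s3 c IH3] s4.
  by rewrite !cat_rcons -cat_cons Hf -[LHS]/(f _) cat_cons IH3.
by rewrite -(perm_cons a) (perm_trans Hp) // -[a :: s2]cat1s perm_catCA.
Qed.

Lemma sym_shift a f : sym_fun f -> sym_fun (shift_label a f).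
Proof. by move=> Hf s s' Hs; apply: Hf; rewrite perm_cons. Qed.

Lemma sym_conv f g : sym_fun f -> sym_fun g -> sym_fun (conv f g).
Proof.
move=> Hf Hg; apply: sym_funP => s1 a b s2.
elim: s1 f g Hf Hg => [|c s1 IH] f g Hf Hg /=; last first.
  by rewrite !conv_cons !IH //; apply: sym_shift.
have E h : sym_fun h -> shift_label b (shift_label a h) = shift_label a (shift_label b h).
  move=> Hh; apply/funext => s; apply: Hh.
  by rewrite -(cat1s a) -(cat1s b) perm_catCA.
by rewrite !conv_cons (E f) // (E g) // -!addrA; congr (_ + _); rewrite addrCA.
Qed.

End Convolution.

(** * Formal logarithm and exponential *)

Section Cumulants.
Variables (T : eqType) (R : fieldType).
Implicit Types (m k f g : seq T -> R) (s : seq T) (a b : T).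

Lemma conv_inj m f g : m [::] != 0 ->
  (forall s, conv m f s = conv m g s) -> f = g.
Proof.
move=> m0 H; apply/funext => s; have [n] := ubnP (size s).
elim: n s => // n IH s /ltnSE Hs; have := H s; rewrite (conv_trunc m f) (conv_trunc m g).
suff -> : trunc (size s) f = trunc (size s) g by move/addrI/(mulfI m0).
apply/funext => s'; rewrite /trunc; case: ifP => // Hs'.
by apply: IH; apply: leq_trans Hs' Hs.
Qed.

(** Uniqueness for a linear differential equation: the logarithmic derivatives [h a] and the value
    at the empty sequence determine the function, label by label. *)
Lemma conv_uniq f g (h : T -> seq T -> R) : f [::] = g [::] ->
  (forall a, shift_label a f = conv f (h a)) ->
  (forall a, shift_label a g = conv g (h a)) -> f = g.
Proof.
move=> H0 Hf Hg; apply/funext => s; have [n] := ubnP (size s).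
elim: n s => // n IH [|a s] // /ltnSE Hs.
rewrite -[LHS]/(shift_label a f s) -[RHS]/(shift_label a g s) Hf Hg.
by apply: eq_conv => // s' Hs'; apply: IH; apply: leq_ltn_trans Hs' Hs.
Qed.

Definition cumulant_step m k s : R :=
  if s is a :: s' then
    (m s - conv m (trunc (size s') (shift_label a k)) s') / m [::]
  else 0.

(* The formal logarithm: the solution of [shift_label a m = conv m (shift_label a k)],
   [k [::] = 0], see [shift_cumulants]. *)
Definition cumulants m : seq T -> R := size_fix (cumulant_step m).

Lemma cumulantsE m s : cumulants m s = cumulant_step m (cumulants m) s.
Proof.
apply: size_fixE => f g [|a s'] Hfg //=; congr ((_ - _) / _).
apply: eq_conv => // s2 _; rewrite /trunc /shift_label; case: ifP => // Hs2.
exact: Hfg.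
Qed.

Lemma cumulants0 m : cumulants m [::] = 0.
Proof. by rewrite cumulantsE. Qed.

Lemma shift_cumulants m a : m [::] != 0 ->
  shift_label a m = conv m (shift_label a (cumulants m)).
Proof.
move=> m0; apply/funext => s; rewrite conv_trunc.
rewrite [shift_label a (cumulants m) s in RHS]/shift_label (cumulantsE m (a :: s)) /=.
by rewrite mulrC divfK // addrC subrK.
Qed.

Definition exp_step (d : seq T -> R) f s : R :=
  if s is a :: s' then conv f (shift_label a d) s' else 1.

(** The formal exponential, defined through its differential equation. Only derivatives of [d]
    enter, so [d [::]] is treated as zero. *)
Definition conv_exp (d : seq T -> R) : seq T -> R := size_fix (exp_step d).

Lemma conv_expE d s : conv_exp d s = exp_step d (conv_exp d) s.
Proof.
apply: size_fixE => f g [|a s'] Hfg //=.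
by apply: eq_conv => // s2 Hs2; apply: Hfg.
Qed.

Lemma conv_exp0 d : conv_exp d [::] = 1.
Proof. by rewrite conv_expE. Qed.

Lemma shift_conv_exp d a : shift_label a (conv_exp d) = conv (conv_exp d) (shift_label a d).
Proof. by apply/funext => s; rewrite [LHS]conv_expE. Qed.

Lemma sym_conv_inv m f : m [::] != 0 -> sym_fun m -> sym_fun (conv m f) -> sym_fun f.
Proof.
move=> m0 Hm Hmf s s'; have [n] := ubnP (size s).
elim: n s s' => // n IH s s' /ltnSE Hs Hss'; apply: (mulfI m0).
have Hsz := perm_size Hss'.
have Ht : sym_fun (trunc (size s) f).
  move=> s1 s2 H12; rewrite /trunc (perm_size H12); case: ifP => // H2.
  by apply: IH => //; rewrite (perm_size H12) (leq_trans H2).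
have E x : m [::] * f x = conv m f x - conv m (trunc (size x) f) x.
  by rewrite conv_trunc addrAC subrr add0r.
by rewrite !E -Hsz (Hmf _ _ Hss') (sym_conv Hm Ht Hss').
Qed.

(** The recursion singles out the first label, so symmetry has to be recovered. Each first
    derivative of the logarithm solves a convolution equation with symmetric data. For the first two
    labels, [m] times the mixed second derivative is the mixed derivative of [m] minus [m] times the
    product of the two first derivatives, which is symmetric in the two labels. *)
Lemma sym_cumulants m : m [::] = 1 -> sym_fun m -> sym_fun (cumulants m).
Proof.
move=> m1 Hm; have m0 : m [::] != 0 by rewrite m1 oner_neq0.
have Hs a : sym_fun (shift_label a (cumulants m)).
  apply: (sym_conv_inv m0 Hm); rewrite -shift_cumulants //; exact: sym_shift.
have Hab a b : shift_label b (shift_label a (cumulants m)) =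
               shift_label a (shift_label b (cumulants m)).
  apply: (conv_inj m0) => s.
  have E c d : conv m (shift_label d (shift_label c (cumulants m))) s =
    m [:: c, d & s]
     - conv m (conv (shift_label d (cumulants m)) (shift_label c (cumulants m))) s.
    have := congr1 (fun f => f (d :: s)) (shift_cumulants c m0).
    rewrite /= conv_cons [X in _ = conv X _ _ + _ -> _]shift_cumulants // convA /shift_label => ->.
    by rewrite addrAC subrr add0r.
  rewrite !E (convC (shift_label a _)); congr (_ - _); apply: Hm.
  by rewrite -(cat1s a) -(cat1s b) perm_catCA.
apply: sym_funP => -[|c s1] a b s2 /=; last first.
  rewrite -[LHS]/(shift_label c _ _) -[RHS]/(shift_label c _ _); apply: Hs.
  by rewrite perm_cat2l -(cat1s a) -(cat1s b) perm_catCA.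
by have := congr1 (fun f => f s2) (Hab a b).
Qed.

End Cumulants.

Lemma cumulants_map (T S : eqType) (R : fieldType) (m : seq S -> R) (sg : T -> S) s :
  cumulants (fun s => m (map sg s)) s = cumulants m (map sg s).
Proof.
have E f g s' : conv (fun s => f (map sg s)) (fun s => g (map sg s)) s' =
    conv f g (map sg s').
  by elim: s' f g => [|a s' IH] f g; rewrite ?conv0 //= !conv_cons -!IH.
have [n] := ubnP (size s); elim: n s => // n IH [|a s] /ltnSE Hs.
  by rewrite !cumulants0.
rewrite !cumulantsE /= -E; congr ((_ - _) / _); apply: eq_conv => // s' Hs'.
rewrite /trunc !size_map /shift_label; case: ifP => // Hs2.
by rewrite IH //= (leq_trans _ Hs).
Qed.

(** * Collisions of labels *)

Section Collision.
Variables (T : eqType) (i j : T).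

Fixpoint expand (s : seq T) : seq (seq T) :=
  if s is a :: s' then
    if (a == i) || (a == j) then map (cons i) (expand s') ++ map (cons j) (expand s')
    else map (cons a) (expand s')
  else [:: [::]].

Variable R : fieldType.
Implicit Types (f g m : seq T -> R) (s : seq T) (a : T).
Variables (u w : R).

Definition collision_coef s : R := u ^+ count_mem i s * w ^+ count_mem j s.

(* A collision at angle [theta] of a pair of uniformly distributed phase maps [(e_i, e_j)] to
   [(u * (e_i + e_j), w * (e_i + e_j))] with [u = cos theta ^+ 2], [w = sin theta ^+ 2];
   [expand s] lists the monomials of the product of the [e_a], [a] in [s], in which [e_i] and
   [e_j] are replaced by [e_i + e_j]. *)
Definition collide f s : R := collision_coef s * \sum_(s' <- expand s) f s'.

Hypothesis ij : i != j.

Lemma collide0 f : collide f [::] = f [::].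
Proof. by rewrite /collide /collision_coef /= !expr0 !mul1r big_seq1. Qed.

Lemma collide_consl f s :
  collide f (i :: s) = u * (collide (shift_label i f) s + collide (shift_label j f) s).
Proof.
rewrite /collide /collision_coef /= eqxx /= (negbTE ij) big_cat !big_map /=.
by rewrite add1n add0n exprS -mulrDr !mulrA.
Qed.

Lemma collide_consr f s :
  collide f (j :: s) = w * (collide (shift_label i f) s + collide (shift_label j f) s).
Proof.
rewrite /collide /collision_coef /= eqxx orbT eq_sym (negbTE ij) big_cat !big_map /=.
by rewrite add1n add0n exprS -mulrDr !mulrA [w * _]mulrC.
Qed.

Lemma collide_cons f a s : a != i -> a != j ->
  collide f (a :: s) = collide (shift_label a f) s.
Proof.
move=> ai aj; rewrite /collide /collision_coef /= (negbTE ai) (negbTE aj) /=.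
by rewrite big_map.
Qed.

Lemma collideD f g s : collide (fun s => f s + g s) s = collide f s + collide g s.
Proof. by rewrite /collide -mulrDr -big_split. Qed.

(** In generating functions [collide] replaces the variables of [i] and [j], say [X] and [Y], both
    by [u * X + w * Y], and a substitution respects products. The two rules [collide_consl] and
    [collide_consr] are the chain rule. *)
Lemma collide_conv f g : collide (conv f g) = conv (collide f) (collide g).
Proof.
apply/funext => s; elim: s f g => [|a s IH] f g.
  by rewrite conv0 !collide0 conv0.
have Hs c h c' h' : conv (fun s => c * (collide h s + collide h' s)) (collide c') s =
    c * (collide (conv h c') s + collide (conv h' c') s).
  by rewrite convZl convDl !IH.
have [->|ai] := eqVneq a i; last have [->|aj] := eqVneq a j.
- rewrite collide_consl !shift_conv !collideD conv_cons.
  have Esh h : shift_label i (collide h) =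
    fun s => u * (collide (shift_label i h) s + collide (shift_label j h) s).
    by apply/funext => s'; rewrite -collide_consl.
  rewrite !Esh Hs (convC (collide f)) Hs !(convC _ f); ring.
- rewrite collide_consr !shift_conv !collideD conv_cons.
  have Esh h : shift_label j (collide h) =
    fun s => w * (collide (shift_label i h) s + collide (shift_label j h) s).
    by apply/funext => s'; rewrite -collide_consr.
  rewrite !Esh Hs (convC (collide f)) Hs !(convC _ f); ring.
- rewrite collide_cons // shift_conv collideD conv_cons !IH.
  have Esh h : shift_label a (collide h) = collide (shift_label a h).
    by apply/funext => s'; rewrite -collide_cons.
  by rewrite !Esh.
Qed.

(* [collide m = conv m (exp (collide k - k))] for the formal logarithm [k] of [m]:
   [collide] is a ring morphism, hence commutes with the exponential. *)
Lemma collide_cumulants m (k := cumulants m) : m [::] != 0 ->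
  collide m = conv m (conv_exp (fun s => collide k s - k s)).
Proof.
move=> m0; have shift_collide h a : shift_label a (collide h) =
    if a == i then fun s => u * (collide (shift_label i h) s + collide (shift_label j h) s)
    else if a == j then fun s => w * (collide (shift_label i h) s + collide (shift_label j h) s)
    else collide (shift_label a h).
  apply/funext => s; have [->|ai] := eqVneq a i; first exact: collide_consl.
  by have [->|aj] := eqVneq a j; [exact: collide_consr|exact: collide_cons].
have Em a : collide (shift_label a m) = conv (collide m) (collide (shift_label a k)).
  by rewrite -collide_conv -shift_cumulants.
(* Both sides have the logarithmic derivatives of [collide k]: on the right, the factor [m]
   contributes those of [k] and the exponential those of [collide k - k]. *)
apply: (@conv_uniq _ _ _ _ (fun a => shift_label a (collide k))).
- by rewrite conv0 collide0 conv_exp0 mulr1.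
- move=> a; rewrite !shift_collide.
  by case: eqP => _; [|case: eqP => _]; rewrite !Em //; apply/funext => s;
     rewrite convZr convDr.
- move=> a; rewrite shift_conv shift_conv_exp (shift_cumulants a m0) -/k.
  apply/funext => s; rewrite -!convA (convC (shift_label a k)) !convA -convDr.
  by congr conv; apply/funext => s'; rewrite /shift_label addrC subrK.
Qed.

End Collision.

(** * Difference quotients along a filter *)

Section DifferenceQuotient.
Variables (R : realType) (G : set_system R).
Context {FG : Filter G}.
Hypothesis G0 : G --> 0^'.

(** A general filter lets the same rules serve the derivative in the tilt, which is two-sided, and
    the one in time, which is one-sided at time 0. The base value [f0] is a separate argument, so
    that it need not be written as a value of [f] at 0. *)
Definition diffq (f : R -> R) (f0 l : R) := h^-1 * (f h - f0) @[h --> G] --> l.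

Lemma diffq_cvg (f : R -> R) f0 l : diffq f f0 l -> f h @[h --> G] --> f0.
Proof.
move=> Hf.
have Hh : h @[h --> G] --> (0 : R).
  apply: (@cvg_trans _ (h @[h --> (0:R)^'])); first exact: cvg_app.
  exact: (@cvg_within_filter _ _ id).
have H : f0 + h * (h^-1 * (f h - f0)) @[h --> G] --> f0 + 0 * l.
  by apply: cvgD; [exact: cvg_cst|exact: cvgM].
rewrite mul0r addr0 in H; apply: cvg_trans H; apply: near_eq_cvg.
have Hn : \forall h \near G, h != 0 by apply: G0; near=> h; near: h; exact: nbhs_dnbhs_neq.
near=> h; have h0 : h != 0 by near: h.
by rewrite mulVKf // addrC subrK.
Unshelve. all: by end_near. Qed.

Lemma diffq_cst c : diffq (fun=> c) c 0.
Proof. by rewrite /diffq; under eq_fun do rewrite subrr mulr0; exact: cvg_cst. Qed.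

Lemma diffqD (f g : R -> R) f0 g0 l l' : diffq f f0 l -> diffq g g0 l' ->
  diffq (fun h => f h + g h) (f0 + g0) (l + l').
Proof.
move=> Hf Hg; rewrite /diffq; apply: cvg_trans (cvgD Hf Hg).
by apply: near_eq_cvg; near=> h; rewrite ?fctE /=; ring.
Unshelve. all: by end_near. Qed.

Lemma diffqM (f g : R -> R) f0 g0 l l' : diffq f f0 l -> diffq g g0 l' ->
  diffq (fun h => f h * g h) (f0 * g0) (l * g0 + f0 * l').
Proof.
move=> Hf Hg; rewrite /diffq.
apply: cvg_trans (cvgD (cvgM Hf (diffq_cvg Hg)) (cvgM (cvg_cst f0) Hg)).
by apply: near_eq_cvg; near=> h; rewrite ?fctE /=; ring.
Unshelve. all: by end_near. Qed.

Lemma diffqN (f : R -> R) f0 l : diffq f f0 l -> diffq (fun h => - f h) (- f0) (- l).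
Proof.
move=> Hf; rewrite /diffq; apply: cvg_trans (cvgN Hf).
by apply: near_eq_cvg; near=> h; rewrite ?fctE /=; ring.
Unshelve. all: by end_near. Qed.

Lemma diffqV (f : R -> R) f0 l : (forall h, f h != 0) -> f0 != 0 -> diffq f f0 l ->
  diffq (fun h => (f h)^-1) f0^-1 (- l / f0 ^+ 2).
Proof.
move=> fn f0n Hf; rewrite /diffq.
have -> : - l / f0 ^+ 2 = l * (- (f0^-1 * f0^-1)) by field.
apply: cvg_trans (cvgM Hf (cvgN (cvgM (cvgV f0n (diffq_cvg Hf)) (cvg_cst f0^-1)))).
apply: near_eq_cvg; near=> h; rewrite ?fctE /=.
have := fn h; move: (f h) (h^-1) => x y x0; field; rewrite f0n x0.
Unshelve. all: by end_near. Qed.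

Lemma diffq_conv (T : eqType) (f g : R -> seq T -> R) (f0 g0 f' g' : seq T -> R) s :
  (forall s', (size s' <= size s)%N -> diffq (f^~ s') (f0 s') (f' s')) ->
  (forall s', (size s' <= size s)%N -> diffq (g^~ s') (g0 s') (g' s')) ->
  diffq (fun h => conv (f h) (g h) s) (conv f0 g0 s) (conv f' g0 s + conv f0 g' s).
Proof.
elim: s f g f0 g0 f' g' => [|a s IH] f g f0 g0 f' g' Hf Hg.
  rewrite !conv0; under eq_fun do rewrite conv0.
  by apply: diffqM; [exact: Hf|exact: Hg].
rewrite !conv_cons; under eq_fun do rewrite conv_cons.
rewrite addrACA; apply: diffqD; apply: IH => s' Hs';
  by [apply: Hf => //=; rewrite ltnW|apply: Hg => //=; rewrite ltnW|exact: Hf|exact: Hg].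
Qed.

(* Logarithmic differentiation: [m' / m = K] gives [(log m)' = K]. *)
Lemma diffq_cumulants (T : eqType) (m : R -> seq T -> R) (m0 K : seq T -> R) :
  (forall h, m h [::] != 0) -> m0 [::] != 0 ->
  (forall s, diffq (m^~ s) (m0 s) (conv m0 K s)) ->
  forall s, s != [::] -> diffq (fun h => cumulants (m h) s) (cumulants m0 s) (K s).
Proof.
move=> mn m0n Hm s; have [n] := ubnP (size s).
elim: n s => // n IH [|a s] // /ltnSE Hs _.
set k0 := cumulants m0.
have Hc s' : (size s' <= size s)%N ->
   diffq (fun h => trunc (size s) (shift_label a (cumulants (m h))) s')
    (trunc (size s) (shift_label a k0) s') (trunc (size s) (shift_label a K) s').
  move=> Hs'; rewrite /trunc /shift_label; case: ifP => [Hs2|_]; last exact: diffq_cst.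
  by apply: IH => //=; apply: leq_trans Hs.
have Hnum := diffqD (Hm (a :: s)) (diffqN (diffq_conv (fun s' _ => Hm s') Hc)).
have := diffqM Hnum (diffqV mn m0n (Hm [::])).
set l := (X in diffq _ _ X) => H; rewrite {1}/k0 cumulantsE /= -/k0.
have -> : K (a :: s) = l.
  rewrite /l; set N0 := m0 (a :: s) - _.
  have EN : N0 = m0 [::] * k0 (a :: s).
    by rewrite /k0 cumulantsE /= -/N0 mulrC divfK.
  have E2 : conv m0 K (a :: s) =
     conv (conv m0 K) (shift_label a k0) s + conv m0 (shift_label a K) s.
    rewrite conv_cons (shift_cumulants a m0n) -!convA.
    by congr (_ + _); congr (conv m0 _ s); exact: convC.
  rewrite EN E2 (conv_trunc (conv m0 K) (shift_label a k0)) (conv_trunc m0 (shift_label a K)) conv0.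
  rewrite /shift_label -/k0; field; exact: m0n.
apply: cvg_trans H; apply: near_eq_cvg; near=> h.
by rewrite cumulantsE.
Unshelve. all: by end_near. Qed.

End DifferenceQuotient.

(** * Averages over the angle *)

Section AngularAverage.
Variable R : realType.
Implicit Types f g : R -> R.
Local Notation mu := (@lebesgue_measure R).
Local Notation I := (`[- pi, pi]%classic : set R).

Definition angle_avg f : R := \int[mu]_(theta in I) ((2 * pi)^-1 * f theta).

Let twopi0 : 2 * pi != 0 :> R.
Proof. by rewrite mulf_neq0 // gt_eqF // pi_gt0. Qed.

Let integrableI f : continuous f -> mu.-integrable I (EFin \o f).
Proof.
move=> cf; apply: continuous_compact_integrable; first exact: segment_compact.
exact: continuous_subspaceT.
Qed.

Let contZ c f : continuous f -> continuous (fun x => c * f x).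
Proof. by move=> cf x; apply: cvgM; [exact: cvg_cst|exact: cf]. Qed.

Lemma angle_avgE f : continuous f ->
  angle_avg f = (2 * pi)^-1 * \int[mu]_(theta in I) f theta.
Proof. by move=> cf; apply: RintegralZl => //; exact: integrableI. Qed.

Lemma angle_avgD f g : continuous f -> continuous g ->
  angle_avg (fun x => f x + g x) = angle_avg f + angle_avg g.
Proof.
move=> cf cg; rewrite !angle_avgE // ?RintegralD ?mulrDr //; try exact: integrableI.
by move=> x; apply: cvgD; [exact: cf|exact: cg].
Qed.

Lemma angle_avgZ c f : continuous f -> angle_avg (fun x => c * f x) = c * angle_avg f.
Proof.
move=> cf; rewrite !angle_avgE //; last exact: contZ.
by rewrite mulrCA; congr (_ * _); apply: RintegralZl => //; exact: integrableI.
Qed.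

Lemma angle_avg_cst c : angle_avg (fun=> c) = c.
Proof.
rewrite angle_avgE; last by move=> x; exact: cvg_cst.
have p0 := pi_gt0 R.
have -> : \int[mu]_(theta in I) c = c * fine (mu I) by exact: Rintegral_cst.
have -> : mu I = (2 * pi)%:E.
  rewrite (lebesgue_measure_itv `[- pi, pi]) /= lte_fin ifT; last by lra.
  by rewrite -EFinB; congr EFin; ring.
by rewrite /= mulrCA mulVf // mulr1.
Qed.

Lemma continuous_sum (J : Type) (r : seq J) (F : J -> R -> R) :
  (forall j, continuous (F j)) -> continuous (fun x => \sum_(j <- r) F j x).
Proof.
move=> cF; elim: r => [|j r IH]; first by under eq_fun do rewrite big_nil; move=> x; exact: cvg_cst.
by under eq_fun do rewrite big_cons; move=> x; apply: cvgD; [exact: cF|exact: IH].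
Qed.

Lemma angle_avg_sum (J : Type) (r : seq J) (F : J -> R -> R) :
  (forall j, continuous (F j)) ->
  angle_avg (fun x => \sum_(j <- r) F j x) = \sum_(j <- r) angle_avg (F j).
Proof.
move=> cF; elim: r => [|j r IH].
  by under [in LHS]eq_fun do rewrite big_nil; rewrite big_nil angle_avg_cst.
under [in LHS]eq_fun do rewrite big_cons.
by rewrite big_cons -IH angle_avgD //; exact: continuous_sum.
Qed.

Lemma le_angle_avg f g : continuous f -> continuous g -> (forall x, f x <= g x) ->
  angle_avg f <= angle_avg g.
Proof.
move=> cf cg fg; apply: le_Rintegral => //; do 1?[exact/integrableI/contZ].
move=> x _; apply: ler_wpM2l => //.
by rewrite invr_ge0 mulr_ge0 // pi_ge0.
Qed.

Lemma normr_angle_avg f M : continuous f -> (forall x, `|f x| <= M) -> `|angle_avg f| <= M.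
Proof.
move=> cf fM; rewrite ler_norml -{2}(angle_avg_cst M) -{1}(angle_avg_cst (- M)).
by apply/andP; split; apply: le_angle_avg => //;
  do ?[by move=> x; exact: cvg_cst]; move=> x; have := fM x; rewrite ler_norml => /andP[].
Qed.

Lemma angle_avg_FTC f F : continuous f -> (forall x : R, is_derive x 1 F (f x)) ->
  angle_avg f = (2 * pi)^-1 * (F pi - F (- pi)).
Proof.
move=> cf dF; rewrite angle_avgE //; congr (_ * _).
have cF : continuous F.
  by move=> x; apply: differentiable_continuous; apply/derivable1_diffP; exact: ex_derive.
have p0 := pi_gt0 R.
rewrite /Rintegral (@continuous_FTC2 _ f F) //.
- by rewrite gtrN.
- exact: continuous_subspaceT.
- split=> [x _||]; first exact: ex_derive.
    by apply: cvg_at_right_filter; exact: cF.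
  by apply: cvg_at_left_filter; exact: cF.
- by move=> x _; rewrite derive1E; exact: derive_val.
Qed.

(* A primitive [H] of [f] makes the average of the shifted function [H (pi - p) - H (- pi - p)],
   whose derivative in [p] vanishes by periodicity. *)
Lemma angle_avg_shift f p : continuous f -> (forall x, f (x + 2 * pi) = f x) ->
  - pi <= p <= pi -> angle_avg (fun x => f (x - p)) = angle_avg f.
Proof.
move=> cf pf /andP[p1 p2].
have p0 := pi_gt0 R.
(* Wide enough to contain every [x - q] with [x] between [- 2 * pi] and [2 * pi] and [q] between
   [- pi] and [pi], as well as [pi - q] and [- pi - q] for [q] between [- 2 * pi] and [2 * pi]. *)
pose a : R := - 4 * pi; pose b : R := 4 * pi.
have ab : a < b by rewrite /a /b; lra.
pose H x := \int[mu]_(t in `[a, x]) f t.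
have dH x : a < x -> x < b -> is_derive x 1 H (f x).
  move=> ax xb; have [] := @continuous_FTC1_closed R f a x b xb _ ax _.
  - apply: continuous_compact_integrable; first exact: segment_compact.
    exact: continuous_subspaceT.
  - exact: cf.
  - by move=> d1 d2; rewrite -d2 derive1E; exact: derivableP.
have cH x : a < x -> x < b -> {for x, continuous H}.
  move=> ax xb; have dx := dH _ ax xb.
  by apply: differentiable_continuous; apply/derivable1_diffP; exact: ex_derive.
have cfp q : continuous (fun x => f (x - q)).
  move=> x; apply: (@continuous_comp _ _ _ (fun x => x - q) f); last exact: cf.
  by apply: cvgB; [exact: cvg_id|exact: cvg_cst].
have E q : - pi <= q <= pi -> angle_avg (fun x => f (x - q)) = (2 * pi)^-1 * (H (pi - q) - H (- pi - q)).
  move=> /andP[q1 q2]; rewrite angle_avgE //; congr (_ * _).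
  have dHq x : - 2 * pi < x -> x < 2 * pi -> is_derive x 1 (fun x => H (x - q)) (f (x - q)).
    move=> x1 x2.
    have dh : is_derive (x - q) 1 H (f (x - q)) by apply: dH; rewrite /a /b; lra.
    have D := @is_derive1_comp R H (fun x => x - q) x _ _ dh (is_deriveB (is_derive_id x (1:R)) (is_derive_cst q x (1:R))).
    by apply: is_derive_eq D _; rewrite subr0 mulr1.
  have cHq x : - 2 * pi < x -> x < 2 * pi -> {for x, continuous (fun x => H (x - q))}.
    move=> ax xb; have dx := dHq _ ax xb.
    by apply: differentiable_continuous; apply/derivable1_diffP; exact: ex_derive.
  rewrite /Rintegral (@continuous_FTC2 _ (fun x => f (x - q)) (fun x => H (x - q))) //.
  - by rewrite gtrN.
  - exact: continuous_subspaceT.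
  - split=> [x||].
    + rewrite in_itv /= => /andP[x1 x2]; have := dHq x; case=> //; lra.
    + by apply: cvg_at_right_filter; apply: cHq; lra.
    + by apply: cvg_at_left_filter; apply: cHq; lra.
  - move=> x; rewrite in_itv /= => /andP[x1 x2].
    by rewrite derive1E; have [] := dHq x _ _ => //; lra.
have -> : angle_avg f = angle_avg (fun x => f (x - 0)).
  by congr angle_avg; apply/funext => x; rewrite subr0.
rewrite !E; [|lra|lra]; congr (_ * _).
pose Phi q := H (pi - q) - H (- pi - q).
have dPhi q : - 2 * pi < q < 2 * pi -> is_derive q 1 Phi 0.
  move=> /andP[q1 q2].
  have d1 : is_derive (pi - q) 1 H (f (pi - q)) by apply: dH; rewrite /a /b; lra.
  have d2 : is_derive (- pi - q) 1 H (f (- pi - q)) by apply: dH; rewrite /a /b; lra.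
  have dq (r : R) := is_deriveB (is_derive_cst r q (1:R)) (is_derive_id q (1:R)).
  have D := is_deriveB (@is_derive1_comp R H (fun q => pi - q) q _ _ d1 (dq pi))
    (@is_derive1_comp R H (fun q => - pi - q) q _ _ d2 (dq (- pi))).
  apply: is_derive_eq D _.
  by rewrite -[f (- pi - q)]pf (_ : - pi - q + 2 * pi = pi - q) ?subrr //; ring.
have cPhi q : - 2 * pi < q < 2 * pi -> {for q, continuous Phi}.
  move=> hq; have dx := dPhi _ hq.
  by apply: differentiable_continuous; apply/derivable1_diffP; exact: ex_derive.
rewrite -!/(Phi _).
have M u v : - pi <= u -> u <= v -> v <= pi -> Phi v = Phi u.
  move=> u1 uv v2; have [] := @MVT_segment R Phi (fun=> 0) u v uv.
  - by move=> x; rewrite in_itv /= => /andP[x1 x2]; apply: dPhi; lra.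
  - apply: continuous_in_subspaceT => x; rewrite inE /= in_itv /= => /andP[x1 x2].
    by apply: cPhi; lra.
  - by move=> c _ /eqP; rewrite mul0r subr_eq0 => /eqP.
have [h|h] := leP 0 p; first by apply: M; lra.
by symmetry; apply: M; lra.
Qed.

Lemma continuous_pow f n : continuous f -> continuous (fun x : R => f x ^+ n).
Proof.
move=> cf; elim: n => [|n IH]; first by under eq_fun do rewrite expr0; move=> x; exact: cvg_cst.
by under eq_fun do rewrite exprS; move=> x; apply: cvgM; [exact: cf|exact: IH].
Qed.

Lemma continuous_cosX n : continuous (fun x : R => cos x ^+ n).
Proof. exact/continuous_pow/continuous_cos. Qed.

Lemma angle_avg_cos2 : angle_avg (fun x => cos x ^+ 2) = 2^-1.
Proof.
have dF (x : R) : is_derive x 1 (fun x : R => 2^-1 * (x + sin x * cos x)) (cos x ^+ 2).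
  have H := is_deriveZ 2^-1 (is_deriveD (is_derive_id x (1:R)) (is_deriveM (is_derive_sin x) (is_derive_cos x))).
  apply: is_derive_eq H _.
  rewrite /GRing.scale /=; have := cos2Dsin2 x; move: (cos x) (sin x) => c s E; nra.
rewrite (angle_avg_FTC (@continuous_cosX 2) dF) sinN sinpi cosN cospi.
by move: pi (lt0r_neq0 (pi_gt0 R)) => p p0; field.
Qed.

(** A label that occurs twice contributes [cos ^ 2] squared; that its mean lies strictly below 1/2
    is the source of the gap for repeated labels. *)
Lemma angle_avg_cos4 : angle_avg (fun x => cos x ^+ 4) = 3 / 8.
Proof.
have dF (x : R) : is_derive x 1
    (fun x : R => 8^-1 * (3 * x + 3 * (sin x * cos x) + 2 * (sin x * cos x ^+ 3))) (cos x ^+ 4).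
  have ds := is_derive_sin x; have dc := is_derive_cos x.
  have H := is_deriveZ 8^-1 (is_deriveD (is_deriveD (is_deriveZ 3 (is_derive_id x (1:R)))
    (is_deriveZ 3 (is_deriveM ds dc))) (is_deriveZ 2 (is_deriveM ds (is_deriveX 3 dc)))).
  apply: is_derive_eq H _.
  rewrite /GRing.scale /= fctE /=; have := sin2cos2 x; move: (cos x) (sin x) => c s E.
  suff -> : 8^-1 * (3 * 1 + 3 * (s * - s + c * c) + 2 * (s * (3 * c ^+ 2 * - s) + c ^+ 3 * c))
     = 8^-1 * (3 + 3 * (c ^+ 2 - s ^+ 2) + 2 * (c ^+ 4 - 3 * c ^+ 2 * s ^+ 2)) by rewrite E; field.
  by ring.
rewrite (angle_avg_FTC (@continuous_cosX 4) dF) sinN sinpi cosN cospi.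
by move: pi (lt0r_neq0 (pi_gt0 R)) => p p0; field.
Qed.

Lemma angle_avg_sin2 : angle_avg (fun x => sin x ^+ 2) = 2^-1.
Proof.
have -> : angle_avg (fun x => sin x ^+ 2) = angle_avg (fun x => 1 + -1 * cos x ^+ 2).
  by congr angle_avg; apply/funext => x; rewrite sin2cos2; ring.
have c2 := @continuous_cosX 2.
rewrite angle_avgD ?angle_avgZ ?angle_avg_cst ?angle_avg_cos2 //; first by field.
- by move=> x; exact: cvg_cst.
- by move=> x; apply: cvgM; [exact: cvg_cst|exact: c2].
Qed.

Lemma angle_avg_sin4 : angle_avg (fun x => sin x ^+ 4) = 3 / 8.
Proof.
have -> : angle_avg (fun x => sin x ^+ 4) =
    angle_avg (fun x => (1 + -2 * cos x ^+ 2) + cos x ^+ 4).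
  congr angle_avg; apply/funext => x; rewrite (_ : sin x ^+ 4 = (sin x ^+ 2) ^+ 2); last by ring.
  by rewrite sin2cos2; ring.
have c2 := @continuous_cosX 2; have c4 := @continuous_cosX 4.
have cZ : continuous (fun x : R => -2 * cos x ^+ 2).
  by move=> x; apply: cvgM; [exact: cvg_cst|exact: c2].
have c1 : continuous (fun x : R => 1 : R) by move=> x; exact: cvg_cst.
have cD : continuous (fun x : R => 1 + -2 * cos x ^+ 2).
  by move=> x; apply: cvgD; [exact: c1|exact: cZ].
by rewrite !angle_avgD ?angle_avgZ ?angle_avg_cst ?angle_avg_cos2 ?angle_avg_cos4 //; field.
Qed.

End AngularAverage.

(** * Moments on the sphere *)

Section SphereIntegrals.
Variables (R : realType) (N : nat).
Local Notation bs := (borel_space R N).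
Local Notation sph := (kac_sphere R N).

Lemma measurable_continuous (f : 'rV[R]_N -> R) : continuous f ->
  measurable_fun [set: bs] (f : bs -> R).
Proof.
move=> cf; apply: (measurability _ (RGenOpens.measurableE R)).
move=> _ [_ [a [b ->] <-]]; rewrite setTI; apply: sub_sigma_algebra.
move/continuousP : cf; apply; exact: interval_open.
Qed.

Lemma measurable_coord (i : 'I_N) : measurable_fun [set: bs] (fun v : bs => (v : 'rV[R]_N) 0 i).
Proof. by apply: measurable_continuous; exact: coord_continuous. Qed.

Definition energy_monomial (s : seq 'I_N) (v : 'rV[R]_N) : R := \prod_(a <- s) v 0 a ^+ 2.

Lemma measurable_energy_monomial s : measurable_fun [set: bs] (energy_monomial s : bs -> R).
Proof.
apply: measurable_prod => i _; apply: measurable_funX; exact: measurable_coord.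
Qed.

Lemma continuous_energy_monomial s : continuous (energy_monomial s).
Proof.
elim: s => [|a s IH].
  rewrite (_ : energy_monomial [::] = fun=> 1); first exact: cst_continuous.
  by apply/funext => v; rewrite /energy_monomial big_nil.
rewrite (_ : energy_monomial (a :: s) = fun v => v 0 a * v 0 a * energy_monomial s v).
  have ca : continuous (fun v : 'rV[R]_N => v 0 a) by exact: coord_continuous.
  move=> x; have FX : Filter (nbhs x) by exact: nbhs_filter.
  exact: cvgM (cvgM (ca x) (ca x)) (IH x).
by apply/funext => v; rewrite /energy_monomial big_cons expr2.
Qed.

Lemma measurable_sphere : measurable (sph : set bs).
Proof.
have -> : sph = (fun v : bs => \sum_(i < N) (v : 'rV[R]_N) 0 i ^+ 2) @^-1` [set N%:R].
  by [].
rewrite -[X in measurable X]setTI; apply: measurable_sum => //.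
by move=> i; apply: measurable_funX; exact: measurable_coord.
Qed.

Lemma energy_bound v i : sph v -> 0 <= v 0 i ^+ 2 <= N%:R.
Proof.
move=> <-; rewrite sqr_ge0 (bigD1 i) //= lerDl; apply: sumr_ge0 => j _.
exact: sqr_ge0.
Qed.

Lemma energy_monomial_bound s v : sph v -> 0 <= energy_monomial s v <= N%:R ^+ size s.
Proof.
move=> Hv; elim: s => [|a s /andP[IH1 IH2]].
  by rewrite /energy_monomial big_nil expr0 ler01 lexx.
have /andP[h1 h2] := energy_bound a Hv.
by rewrite /energy_monomial big_cons [N%:R ^+ _]exprS mulr_ge0 //= ler_pM.
Qed.

Variable F : probability bs R.
Hypothesis F1 : F sph = 1%E.

(** A class of integrands that is closed under sums and products and integrable against every law
    carried by the sphere; it replaces separate integrability arguments. *)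
Definition sphere_fun (f : bs -> R) :=
  measurable_fun [set: bs] f /\ exists M, forall v, sph v -> `|f v| <= M.

Lemma sphere_funD f g : sphere_fun f -> sphere_fun g -> sphere_fun (fun v => f v + g v).
Proof.
move=> [mf [M bf]] [mg [M' bg]]; split; first exact: measurable_funD.
by exists (M + M') => v Hv; rewrite (le_trans (ler_normD _ _)) // lerD ?bf ?bg.
Qed.

Lemma sphere_funM f g : sphere_fun f -> sphere_fun g -> sphere_fun (fun v => f v * g v).
Proof.
move=> [mf [M bf]] [mg [M' bg]]; split; first exact: measurable_funM.
by exists (M * M') => v Hv; rewrite normrM ler_pM ?bf ?bg.
Qed.

Lemma sphere_fun_cst c : sphere_fun (fun=> c).
Proof. by split; [exact: measurable_cst|exists `|c|]. Qed.

Lemma sphere_fun_sum (I : Type) (r : seq I) (P : pred I) (f : I -> bs -> R) :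
  (forall i, sphere_fun (f i)) -> sphere_fun (fun v => \sum_(i <- r | P i) f i v).
Proof.
move=> Hf; elim: r => [|i r IH].
  by under eq_fun do rewrite big_nil; exact: sphere_fun_cst.
under eq_fun do rewrite big_cons; case: (P i) => //.
exact: sphere_funD.
Qed.

Lemma sphere_fun_monomial s : sphere_fun (energy_monomial s).
Proof.
split; first exact: measurable_energy_monomial.
by exists (N%:R ^+ size s) => v /(energy_monomial_bound s)/andP[h1 h2]; rewrite ger0_norm.
Qed.

Lemma sphere_fun_integrable f : sphere_fun f -> F.-integrable sph (EFin \o f).
Proof.
move=> [mf [M bf]]; apply: measurable_bounded_integrable.
- exact: measurable_sphere.
- by rewrite [X in (X < _)%E]F1 ltry.
- exact: measurable_funS mf.
- by exists M; split; [exact: num_real|move=> x Mx v Hv; apply: le_trans (bf _ Hv) _; exact: ltW].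
Qed.

Definition sphere_mean (f : bs -> R) : R := \int[F]_(v in sph) f v.

Lemma sphere_meanD f g : sphere_fun f -> sphere_fun g ->
  sphere_mean (fun v => f v + g v) = sphere_mean f + sphere_mean g.
Proof.
by move=> hf hg; apply: RintegralD; [exact: measurable_sphere|exact: sphere_fun_integrable..].
Qed.

Lemma sphere_meanZ c f : sphere_fun f ->
  sphere_mean (fun v => c * f v) = c * sphere_mean f.
Proof.
by move=> hf; apply: RintegralZl; [exact: measurable_sphere|exact: sphere_fun_integrable].
Qed.

Lemma sphere_mean_cst c : sphere_mean (fun=> c) = c.
Proof.
rewrite /sphere_mean Rintegral_cst; last exact: measurable_sphere.
by rewrite [X in fine X]F1 mulr1.
Qed.

Lemma sphere_mean_sum (I : Type) (r : seq I) (P : pred I) (f : I -> bs -> R) :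
  (forall i, sphere_fun (f i)) ->
  sphere_mean (fun v => \sum_(i <- r | P i) f i v) = \sum_(i <- r | P i) sphere_mean (f i).
Proof.
move=> Hf; elim: r => [|i r IH].
  by under [X in sphere_mean X]eq_fun do rewrite big_nil; rewrite big_nil sphere_mean_cst.
under [X in sphere_mean X]eq_fun do rewrite big_cons; rewrite big_cons -IH.
case: (P i) => //; apply: sphere_meanD => //; exact: sphere_fun_sum.
Qed.

Lemma eq_sphere_mean f g : (forall v, sph v -> f v = g v) -> sphere_mean f = sphere_mean g.
Proof. by move=> fg; apply: eq_Rintegral => v; rewrite inE; exact: fg. Qed.

Lemma le_sphere_mean f g : sphere_fun f -> sphere_fun g ->
  (forall v, sph v -> f v <= g v) -> sphere_mean f <= sphere_mean g.
Proof.
by move=> hf hg fg; apply: le_Rintegral => //;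
  [exact: measurable_sphere|exact: sphere_fun_integrable..].
Qed.

Lemma normr_sphere_mean f M : sphere_fun f -> (forall v, sph v -> `|f v| <= M) ->
  `|sphere_mean f| <= M.
Proof.
move=> hf fM; rewrite ler_norml -{2}(sphere_mean_cst M) -{1}(sphere_mean_cst (- M)).
by apply/andP; split; apply: le_sphere_mean => //; do ?[exact: sphere_fun_cst];
  move=> v /fM; rewrite ler_norml => /andP[].
Qed.

Definition moment (s : seq 'I_N) : R := sphere_mean (energy_monomial s).

Lemma moment0 : moment [::] = 1.
Proof.
rewrite /moment -[RHS]sphere_mean_cst; congr sphere_mean; apply/funext => v.
by rewrite /energy_monomial big_nil.
Qed.

Lemma moment_bound s : `|moment s| <= N%:R ^+ size s.
Proof.
apply: normr_sphere_mean; first exact: sphere_fun_monomial.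
by move=> v /(energy_monomial_bound s)/andP[h1 h2]; rewrite ger0_norm.
Qed.

Lemma sym_moment : sym_fun moment.
Proof.
move=> s s' ss'; congr sphere_mean; apply/funext => v.
exact: perm_big.
Qed.

Lemma moment_energy s : \sum_(j < N) moment (j :: s) = N%:R * moment s.
Proof.
rewrite /moment -sphere_mean_sum; last by move=> i; exact: sphere_fun_monomial.
rewrite -sphere_meanZ; last exact: sphere_fun_monomial.
apply: eq_sphere_mean => v Hv.
rewrite -{1}Hv mulr_suml; apply: eq_bigr => i _.
by rewrite /energy_monomial big_cons.
Qed.

Definition tilt (xi v : 'rV[R]_N) : R := expR (\sum_(i < N) xi 0 i * v 0 i ^+ 2).

Definition tilt_bound (xi : 'rV[R]_N) : R := \sum_(i < N) `|xi 0 i| * N%:R.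

Lemma tilt_exponent (xi v : 'rV[R]_N) : sph v -> `|\sum_(i < N) xi 0 i * v 0 i ^+ 2| <= tilt_bound xi.
Proof.
move=> Hv; apply: le_trans (ler_norm_sum _ _ _) _; apply: ler_sum => i _.
have /andP[h1 h2] := energy_bound i Hv.
by rewrite normrM (ger0_norm h1) ler_wpM2l.
Qed.

Lemma sphere_fun_tilt xi : sphere_fun (tilt xi).
Proof.
split.
  apply: measurableT_comp => //; apply: measurable_sum => i.
  apply: measurable_funM; first exact: measurable_cst.
  by apply: measurable_funX; exact: measurable_coord.
exists (expR (tilt_bound xi)) => v /(tilt_exponent xi); rewrite ler_norml => /andP[_ h].
by rewrite ger0_norm ?expR_ge0 // ler_expR.
Qed.

(** Not normalised: the value at [[::]] is the moment generating function itself, whose logarithm is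
    [energy_log_mgf]. *)
Definition tilted_moment (xi : 'rV[R]_N) (s : seq 'I_N) : R :=
  sphere_mean (fun v => energy_monomial s v * tilt xi v).

Lemma sphere_fun_tilted xi s : sphere_fun (fun v => energy_monomial s v * tilt xi v).
Proof. by apply: sphere_funM; [exact: sphere_fun_monomial|exact: sphere_fun_tilt]. Qed.

Lemma tilted_moment0 s : tilted_moment 0 s = moment s.
Proof.
apply: eq_sphere_mean => v _; rewrite /tilt big1 ?expR0 ?mulr1 // => i _.
by rewrite mxE mul0r.
Qed.

Lemma tilted_moment_gt0 xi : 0 < tilted_moment xi [::].
Proof.
apply: (@lt_le_trans _ _ (expR (- tilt_bound xi))); first exact: expR_gt0.
rewrite -[leLHS]sphere_mean_cst; apply: le_sphere_mean.
- exact: sphere_fun_cst.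
- exact: sphere_fun_tilted.
- move=> v /(tilt_exponent xi); rewrite ler_norml => /andP[h _].
  by rewrite /energy_monomial big_nil mul1r ler_expR.
Qed.

Lemma energy_log_mgfE xi : energy_log_mgf F xi = ln (tilted_moment xi [::]).
Proof.
congr ln; apply: eq_sphere_mean => v _; by rewrite /energy_monomial big_nil mul1r.
Qed.

End SphereIntegrals.

(** * Joint cumulants are formal cumulants of the moments *)

Section Exp.
Variable R : realType.

(** The inequality [1 + y <= expR y] suffices: at [- y] it gives the upper bound
    [expR y * (1 - y) <= 1]. *)
Lemma expR_taylor1 (y : R) : `|y| <= 2^-1 -> `|expR y - 1 - y| <= 2 * y ^+ 2.
Proof.
rewrite ler_norml => /andP[y1 y2].
have h1 := expR_ge1Dx y; have h2 := expR_ge1Dx (- y).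
rewrite ger0_norm; last by rewrite -addrA -opprD subr_ge0.
have e0 := expR_gt0 y.
have : expR y * (1 - y) <= 1.
  by rewrite -[X in _ <= X](mulfV (lt0r_neq0 e0)) -expRN ler_wpM2l // ltW.
by move: (expR y) e0 h1 => e e0 h1 h3; nra.
Qed.

Lemma diffq_dnbhs_is_derive (f : R -> R) l : diffq 0^' f (f 0) l <-> is_derive (0 : R) 1 f l.
Proof.
have E : (fun h : R => h^-1 *: ((f \o shift 0) (h *: 1) - f 0)) = (fun h => h^-1 * (f h - f 0)).
  by apply/funext => h; rewrite /= addr0 /GRing.scale /= mulr1.
split=> [Hf|[df <-]].
  by split; [apply/cvg_ex; exists l; rewrite E|rewrite /derive E; apply: cvg_lim].
by rewrite /diffq /derive -E.
Qed.

Lemma diffq_ln (f : R -> R) l : 0 < f 0 -> diffq 0^' f (f 0) l ->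
  diffq 0^' (fun h => ln (f h)) (ln (f 0)) (l / f 0).
Proof.
move=> f0 /diffq_dnbhs_is_derive df; apply/(diffq_dnbhs_is_derive (fun h => ln (f h))).
have D := @is_derive1_comp R (@ln R) f 0 _ _ (is_derive1_ln f0) df.
by apply: is_derive_eq D _; rewrite mulrC.
Qed.

End Exp.

Section JointCumulants.
Variables (R : realType) (N : nat) (F : probability (borel_space R N) R).
Hypothesis F1 : F (kac_sphere R N) = 1%E.
Local Notation M := (tilted_moment F).
Local Notation line := (fun xi i (h : R) => h *: delta_mx 0 i + xi : 'rV[R]_N).

Lemma tilt_line xi i h v : tilt (line xi i h) v = expR (h * v 0 i ^+ 2) * tilt xi v.
Proof.
rewrite /tilt -expRD; congr expR.
under eq_bigr do rewrite mxE mulrDl; rewrite big_split /=; congr (_ + _).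
rewrite (bigD1 i) //= !mxE !eqxx mulr1 big1 ?addr0 // => j ji.
by rewrite !mxE eqxx (negbTE ji) mulr0 mul0r.
Qed.

(** Differentiation under the integral: energies are at most [N] on the sphere, so the second-order
    remainder of the exponential is of size [h ^ 2] uniformly there. *)
Lemma diffq_tilted_moment xi i s :
  diffq 0^' (fun h => M (line xi i h) s) (M xi s) (M xi (i :: s)).
Proof.
pose K : R := 2 * N%:R ^+ 2 * (N%:R ^+ size s * expR (tilt_bound xi)).
have K0 : 0 <= K by rewrite !mulr_ge0 ?exprn_ge0 ?expR_ge0.
have N0 : 0 <= N%:R :> R by [].
suff H (h : R) : h != 0 -> `|h| * N%:R <= 2^-1 ->
    `|M xi (i :: s) - h^-1 * (M (line xi i h) s - M xi s)| <= K * `|h|.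
  apply/cvgrPdist_le => /= e e0; near=> h; apply: le_trans (H h _ _) _.
  - by near: h; exact: nbhs_dnbhs_neq.
  - have hN : `|h| <= (2 * (N%:R + 1))^-1.
      by near: h; apply: dnbhs0_le; rewrite invr_gt0; lra.
    apply: le_trans (ler_wpM2r N0 hN) _; rewrite ler_pdivrMl; lra.
  - have hK : `|h| <= e / (K + 1).
      by near: h; apply: dnbhs0_le; rewrite divr_gt0 //; lra.
    apply: le_trans (ler_wpM2l K0 hK) _.
    rewrite mulrA ler_pdivrMr; nra.
move=> h0 hN.
have S0 := sphere_fun_tilted xi s; have S1 := sphere_fun_tilted xi (i :: s).
have S2 := sphere_fun_tilted (line xi i h) s.
have SZ c f (Sf : sphere_fun f) : sphere_fun (fun v => c * f v).
  by apply: sphere_funM => //; exact: sphere_fun_cst.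
have -> : M xi (i :: s) - h^-1 * (M (line xi i h) s - M xi s) =
  M xi (i :: s) + (- h^-1 * M (line xi i h) s + h^-1 * M xi s).
  by rewrite mulrBr opprB mulNr [- _ + _]addrC.
rewrite /M -!sphere_meanZ // -!sphere_meanD //; try exact: SZ;
  try by apply: sphere_funD; exact: SZ.
apply: normr_sphere_mean => //.
  by apply: sphere_funD => //; apply: sphere_funD; exact: SZ.
move=> v Hv; have /andP[e0 eN] := energy_bound i Hv.
have /andP[m0 mN] := energy_monomial_bound s Hv.
rewrite tilt_line {1}/energy_monomial big_cons -/(energy_monomial s v).
set e := v 0 i ^+ 2 in e0 eN *; set m := energy_monomial s v in m0 mN *.
have t0 : 0 <= tilt xi v by exact: expR_ge0.
have tN : tilt xi v <= expR (tilt_bound xi).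
  by rewrite ler_expR; have := tilt_exponent xi Hv; rewrite ler_norml => /andP[].
have -> : e * m * tilt xi v + (- h^-1 * (m * (expR (h * e) * tilt xi v)) + h^-1 * (m * tilt xi v))
    = (m * tilt xi v) * (- h^-1 * (expR (h * e) - 1 - h * e)) by field.
have he : `|h * e| <= 2^-1.
  by rewrite normrM (ger0_norm e0); apply: le_trans hN; exact: ler_wpM2l.
rewrite normrM ger0_norm ?mulr_ge0 // normrM normrN normfV.
have T : `|h|^-1 * `|expR (h * e) - 1 - h * e| <= 2 * N%:R ^+ 2 * `|h|.
  have hp : 0 < `|h| by rewrite normr_gt0.
  rewrite ler_pdivrMl //; apply: le_trans (expR_taylor1 he) _.
  rewrite exprMn -real_normK ?num_real // mulrCA [X in _ <= X](_ : _ = `|h| ^+ 2 * (2 * N%:R ^+ 2)); last by ring.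
  by rewrite ler_wpM2l ?exprn_ge0 // ler_wpM2l // lerXn2r ?nnegrE.
rewrite /K [leRHS]mulrAC [leRHS]mulrC.
by apply: ler_pM (mulr_ge0 m0 t0) _ (ler_pM m0 t0 mN tN) T; rewrite mulr_ge0 ?invr_ge0.
Unshelve. all: by end_near. Qed.

Lemma tilted_moment_path xi i : line xi i 0 = xi.
Proof. by rewrite /= scale0r add0r. Qed.

Lemma derive_diffq (g : 'rV[R]_N -> R) xi i l :
  diffq 0^' (fun h => g (line xi i h)) (g xi) l -> 'D_(delta_mx 0 i) g xi = l.
Proof. by move=> H; rewrite /derive; apply: cvg_lim. Qed.

(* Differentiating in direction [i] shifts all tilted moments by the label [i],
   hence also all their cumulants. *)
Lemma joint_cumulantE s : s != [::] -> joint_cumulant F s = cumulants (moment F) s.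
Proof.
have M0 xi : M xi [::] != 0 by rewrite gt_eqF // tilted_moment_gt0.
move=> s0; rewrite (_ : moment F = M 0); last first.
  by apply/funext => s'; rewrite tilted_moment0.
rewrite /joint_cumulant; move: (0 : 'rV[R]_N); elim: s s0 => // i [|j s] IH _ xi.
  apply: derive_diffq.
  rewrite (_ : (fun h => _) = (fun h => ln (M (line xi i h) [::]))); last first.
    by apply/funext => h; rewrite energy_log_mgfE.
  have := @diffq_ln R (fun h => M (line xi i h) [::]) (M xi [:: i]).
  rewrite tilted_moment_path energy_log_mgfE cumulantsE /= conv0 /trunc /= mulr0 subr0.
  by apply; [exact: tilted_moment_gt0|exact: diffq_tilted_moment].
have E : foldr (fun (i : 'I_N) (g : 'rV[R]_N -> R) => 'D_(delta_mx 0 i) g)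
    (energy_log_mgf F) (j :: s) = fun xi => cumulants (M xi) (j :: s).
  by apply/funext => xi'; exact: IH.
transitivity ('D_(delta_mx 0 i) (fun xi => cumulants (M xi) (j :: s)) xi); first by rewrite -E.
apply: derive_diffq.
apply: (@diffq_cumulants _ _ _ _ _ _ _ (shift_label i (cumulants (M xi)))) => //.
move=> s'; rewrite -shift_cumulants //; exact: diffq_tilted_moment.
Qed.

End JointCumulants.

(** * The generator on moments *)

Section Invariance.
Variables (R : realType) (N : nat).
Local Notation bs := (borel_space R N).
Local Notation sph := (kac_sphere R N).

Lemma measurable_continuous_map (g : 'rV[R]_N -> 'rV[R]_N) :
  (forall k, continuous (fun v => g v 0 k)) -> measurable_fun [set: bs] (g : bs -> bs).
Proof.
move=> cg; have {}cg : continuous g.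
  move=> x A /nbhs_ballP [e /= e0 eA].
  have FX : Filter (nbhs x) by exact: nbhs_filter.
  have H : \forall v \near x, forall k, `|g x 0 k - g v 0 k| < e.
    apply: (@filter_forall _ _ (fun k v => `|g x 0 k - g v 0 k| < e) _ FX) => k.
    have /(@cvgrPdist_lt _ _ _ _ FX) := cg k x; exact.
  apply: filterS H => v Hv; apply: eA; split=> // i k.
  by rewrite ord1; exact: Hv.
apply: (@measurability _ _ bs bs setT g (@open 'rV[R]_N) erefl) => _ [A oA <-].
by rewrite setTI; apply: sub_sigma_algebra; move/continuousP : cg; apply.
Qed.

Lemma moment_invariant (F : probability bs R) (g : 'rV[R]_N -> 'rV[R]_N) s :
  (forall k, continuous (fun v => g v 0 k)) -> g @^-1` sph = sph ->
  (forall A : set bs, measurable A -> F (g @^-1` A) = F A) ->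
  sphere_mean F (fun v => energy_monomial s (g v)) = moment F s.
Proof.
move=> cg gs gF; have mg := measurable_continuous_map cg.
rewrite /moment /sphere_mean /Rintegral; congr fine.
transitivity (\int[pushforward F (g : bs -> bs)]_(v in sph) (energy_monomial s v)%:E)%E.
  rewrite ge0_integral_pushforward //.
  - by rewrite gs.
  - exact: measurable_sphere.
  - apply: measurable_funS (measurableT_comp _ (measurable_energy_monomial s)) => //.
  - by move=> v; rewrite inE lee_fin => /(energy_monomial_bound s)/andP[].
by apply: eq_measure_integral => A mA _; exact: gF.
Qed.

End Invariance.

Section Polar.
Variable R : realType.

Lemma polar (x y : R) : exists r p : R,
  [/\ - pi <= p <= pi, x = r * cos p & y = r * sin p].
Proof.
pose r := Num.sqrt (x ^+ 2 + y ^+ 2).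
have s0 : 0 <= x ^+ 2 + y ^+ 2 by rewrite addr_ge0 ?sqr_ge0.
have r2 : r ^+ 2 = x ^+ 2 + y ^+ 2 by rewrite sqr_sqrtr.
have p0 := pi_gt0 R.
have [r0|rn0] := eqVneq r 0.
  exists 0, 0; rewrite cos0 sin0 !mul0r; move: r2; rewrite r0 expr0n /= => E.
  have x2 := sqr_ge0 x; have y2 := sqr_ge0 y.
  by split; [lra|apply/eqP; rewrite -sqrf_eq0; apply/eqP; lra..].
have rp : 0 < r by rewrite lt_def rn0 sqrtr_ge0.
have y2 := sqr_ge0 y.
have x1 : -1 <= x / r <= 1.
  rewrite ler_pdivlMr // ler_pdivrMr //; nra.
have E : Num.sqrt (1 - (x / r) ^+ 2) = `|y| / r.
  have -> : 1 - (x / r) ^+ 2 = (`|y| / r) ^+ 2.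
    by rewrite !expr_div_n real_normK ?num_real // r2; field; rewrite -r2 sqrf_eq0.
  by rewrite sqrtr_sqr ger0_norm // divr_ge0 // ltW.
have [a0 api] := (acos_ge0 x1, acos_lepi x1).
have x1' : x / r \in `[(-1), 1] by rewrite in_itv.
have [yp|yn] := leP 0 y.
  exists r, (acos (x / r)); rewrite sin_acos // E acosK // ger0_norm //.
  by split; [lra|field|field].
exists r, (- acos (x / r)); rewrite sinN cosN sin_acos // E acosK // ltr0_norm //.
by split; [lra|field|field].
Qed.

End Polar.

Section Generator.
Variables (R : realType) (N : nat).
Local Notation bs := (borel_space R N).
Local Notation sph := (kac_sphere R N).
Implicit Types (i j a : 'I_N) (s : seq 'I_N) (v : 'rV[R]_N).

Definition kac_coef i j s : R :=
  angle_avg (fun theta => collision_coef i j (cos theta ^+ 2) (sin theta ^+ 2) s).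

(** Defined on arbitrary functions of label sequences, since it is applied to moments, to cumulants
    and to differences of cumulants. The prefactor is the rate [N] times the normalisation of
    [kac_Q]. *)
Definition moment_rate (m : seq 'I_N -> R) s : R :=
  (N%:R - 1)^-1 * \sum_(i < N) \sum_(j < N | i != j)
    (kac_coef i j s * (\sum_(s' <- expand i j s) m s') - m s).

Lemma continuous_collision_coef i j s :
  continuous (fun theta : R => collision_coef i j (cos theta ^+ 2) (sin theta ^+ 2) s).
Proof.
move=> x; apply: cvgM.
  by apply: (@continuous_pow R (fun x => cos x ^+ 2)); exact: continuous_cosX.
apply: (@continuous_pow R (fun x => sin x ^+ 2)).
by apply: continuous_pow; exact: continuous_sin.
Qed.

Lemma shift_energy_monomial a v :
  shift_label a (fun t => energy_monomial t v) = fun s => v 0 a ^+ 2 * energy_monomial s v.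
Proof. by apply/funext => s; rewrite /shift_label /energy_monomial big_cons. Qed.

(** In polar coordinates of [(v_i, v_j)] with phase [p], the rotated components are
    [r * cos (theta - p)] and [- r * sin (theta - p)]. Since [p] depends neither on [theta] nor on
    [s], the average over the angle removes it, whatever the law of the phase. *)
Lemma energy_monomial_rotation i j v : i != j -> exists2 p : R, - pi <= p <= pi &
  forall theta s, energy_monomial s (kac_rotation i j theta v) =
    collide i j (cos (theta - p) ^+ 2) (sin (theta - p) ^+ 2) (fun t => energy_monomial t v) s.
Proof.
move=> ij; have [r [p [Hp vi vj]]] := polar (v 0 i) (v 0 j).
exists p => // theta; elim=> [|a s IH].
  by rewrite collide0 /energy_monomial !big_nil.
have r2 : v 0 i ^+ 2 + v 0 j ^+ 2 = r ^+ 2.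
  by rewrite vi vj !exprMn -mulrDr cos2Dsin2 mulr1.
have EZ c s' : collide i j (cos (theta - p) ^+ 2) (sin (theta - p) ^+ 2)
    (fun s => c * energy_monomial s v) s' =
    c * collide i j (cos (theta - p) ^+ 2) (sin (theta - p) ^+ 2) (fun t => energy_monomial t v) s'.
  by rewrite /collide -mulr_sumr mulrCA.
rewrite {1}/energy_monomial big_cons -/(energy_monomial _ _) IH.
rewrite /kac_rotation mxE.
have [->|ai] := eqVneq a i.
  rewrite collide_consl // !shift_energy_monomial !EZ -mulrDl r2 mulrA; congr (_ * _).
  by rewrite vi vj cosB; ring.
have [->|aj] := eqVneq a j.
  rewrite collide_consr // !shift_energy_monomial !EZ -mulrDl r2 mulrA; congr (_ * _).
  by rewrite vi vj sinB; ring.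
by rewrite collide_cons // shift_energy_monomial EZ.
Qed.

Lemma angle_avg_rotation i j s v : i != j ->
  angle_avg (fun theta => energy_monomial s (kac_rotation i j theta v)) =
  kac_coef i j s * \sum_(s' <- expand i j s) energy_monomial s' v.
Proof.
move=> ij; have [p Hp E] := energy_monomial_rotation v ij.
have cc := @continuous_collision_coef i j s.
pose h x := (\sum_(s' <- expand i j s) energy_monomial s' v)
   * collision_coef i j (cos x ^+ 2) (sin x ^+ 2) s.
rewrite (_ : (fun theta => _) = (fun theta => h (theta - p))); last first.
  by apply/funext => theta; rewrite E /collide mulrC.
rewrite angle_avg_shift // /h.
- by rewrite angle_avgZ // mulrC.
- by move=> x; apply: cvgM; [exact: cvg_cst|exact: cc].
- by move=> x; rewrite (_ : 2 * pi = pi *+ 2) ?mulr_natl // cosD2pi sinD2pi.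
Qed.

Hypothesis N2 : (1 < N)%N.

Lemma kac_generator_monomial s v : kac_generator (energy_monomial s) v =
  moment_rate (fun t => energy_monomial t v) s.
Proof.
rewrite /kac_generator /kac_Q /moment_rate.
have N0 : N%:R != 0 :> R by rewrite pnatr_eq0 -lt0n ltnW.
have N1 : N%:R - 1 != 0 :> R by rewrite subr_eq0 pnatr_eq1 gtn_eqF.
set S := \sum_(i < N) _.
have -> : S = \sum_(i < N) \sum_(j < N | i != j)
    (kac_coef i j s * \sum_(s' <- expand i j s) energy_monomial s' v).
  by apply: eq_bigr => i _; apply: eq_bigr => j ij; exact: angle_avg_rotation.
under [in RHS]eq_bigr do rewrite sumrB.
rewrite sumrB.
have -> : \sum_(i < N) \sum_(j < N | i != j) energy_monomial s v =
    N%:R * (N%:R - 1) * energy_monomial s v.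
  transitivity (\sum_(i < N) (N%:R - 1) * energy_monomial s v); last first.
    by rewrite sumr_const card_ord -[LHS]mulr_natl mulrA.
  apply: eq_bigr => i _; rewrite sumr_const -[LHS]mulr_natl; congr (_ * _).
  have := cardC (pred1 i); rewrite card1 card_ord => /(congr1 (fun n => n%:R : R)).
  rewrite natrD => <-; rewrite addrAC subrr add0r; congr _%:R.
  by apply: eq_card => j; rewrite !inE eq_sym.
by move: (\sum_(i < N) _) => X; field; rewrite N0 N1.
Qed.

Variable F : probability bs R.
Hypothesis F1 : F sph = 1%E.

Lemma sphere_mean_generator s :
  sphere_mean F (kac_generator (energy_monomial s)) = moment_rate (moment F) s.
Proof.
have SZ c f (Sf : @sphere_fun R N f) : sphere_fun (fun v => c * f v).
  by apply: sphere_funM => //; exact: sphere_fun_cst.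
have Sm t : sphere_fun (energy_monomial t : bs -> R) by exact: sphere_fun_monomial.
have Sx i j : sphere_fun (fun v : bs => \sum_(s' <- expand i j s) energy_monomial s' v).
  exact: sphere_fun_sum.
have Sij i j : sphere_fun (fun v : bs => kac_coef i j s * (\sum_(s' <- expand i j s) energy_monomial s' v)
    + -1 * energy_monomial s v).
  by apply: sphere_funD; exact: SZ.
rewrite (_ : kac_generator _ = fun v => (N%:R - 1)^-1 * \sum_(i < N) \sum_(j < N | i != j)
   (kac_coef i j s * (\sum_(s' <- expand i j s) energy_monomial s' v) + -1 * energy_monomial s v)); last first.
  apply/funext => v; rewrite kac_generator_monomial; congr (_ * _).
  by apply: eq_bigr => i _; apply: eq_bigr => j _; rewrite mulN1r.
rewrite sphere_meanZ //; last by apply: sphere_fun_sum => i; exact: sphere_fun_sum.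
congr (_ * _); rewrite sphere_mean_sum //; last by move=> i; exact: sphere_fun_sum.
apply: eq_bigr => i _; rewrite sphere_mean_sum //; apply: eq_bigr => j _.
by rewrite sphere_meanD ?sphere_meanZ ?sphere_mean_sum ?mulN1r //; exact: SZ.
Qed.

End Generator.

(** * Symmetries and the forward equation *)

Section Symmetry.
Variables (R : realType) (N : nat).
Local Notation bs := (borel_space R N).
Local Notation sph := (kac_sphere R N).
Implicit Types (i j a : 'I_N) (s : seq 'I_N) (v w : 'rV[R]_N).

Lemma moment_relabel (F : probability bs R) (sg : 'S_N) s : symmetric_law F ->
  moment F (map sg s) = moment F s.
Proof.
move=> HF; rewrite -(moment_invariant (g := fun v => col_perm sg v) s _ _ (HF sg)).
- congr sphere_mean; apply/funext => v; rewrite /energy_monomial big_map.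
  by apply: eq_bigr => a _; rewrite mxE.
- move=> k; rewrite (_ : (fun v => _) = fun v => v 0 (sg k)); first exact: coord_continuous.
  by apply/funext => v; rewrite mxE.
- have E v : \sum_i col_perm sg v 0 i ^+ 2 = \sum_i v 0 i ^+ 2.
    by rewrite [RHS](reindex_inj (@perm_inj _ sg)); apply: eq_bigr => i _; rewrite mxE.
  by apply/seteqP; split=> v; rewrite /kac_sphere /= E.
Qed.

Lemma kac_rotation_dot i j theta v w : i != j ->
  \sum_k kac_rotation i j theta v 0 k * kac_rotation i j theta w 0 k = \sum_k v 0 k * w 0 k.
Proof.
move=> ij; rewrite (bigD1 i) // (bigD1 j) 1?eq_sym //= [RHS](bigD1 i) // [X in _ = _ + X](bigD1 j) 1?eq_sym //=.
rewrite !mxE !eqxx (eq_sym j) (negbTE ij) !addrA; congr (_ + _).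
  rewrite [LHS](_ : _ = (cos theta ^+ 2 + sin theta ^+ 2) * (v 0 i * w 0 i + v 0 j * w 0 j)); last by ring.
  by rewrite cos2Dsin2 mul1r.
by apply: eq_bigr => k /andP[/negbTE ki /negbTE kj]; rewrite !mxE ki kj.
Qed.

Lemma kac_rotation_mul i j theta : i != j -> exists2 O : 'M[R]_N, O *m O^T = 1%:M &
  forall v, kac_rotation i j theta v = v *m O.
Proof.
move=> ij; pose O := \matrix_(a < N, b < N) kac_rotation i j theta (delta_mx 0 a) 0 b : 'M[R]_N.
have dot v (a : 'I_N) : \sum_k v 0 k * (delta_mx 0 a : 'rV[R]_N) 0 k = v 0 a.
  rewrite (bigD1 a) //= mxE !eqxx mulr1 big1 ?addr0 // => k ka.
  by rewrite mxE (negbTE ka) andbF mulr0.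
have dot' v (a : 'I_N) : \sum_k v 0 k * (delta_mx 0 k : 'rV[R]_N) 0 a = v 0 a.
  rewrite -[RHS]dot; apply: eq_bigr => k _; rewrite !mxE (eq_sym a) //.
have OE a b : O a b = kac_rotation i j theta (delta_mx 0 a) 0 b by rewrite mxE.
exists O.
  apply/matrixP => a b; rewrite mxE.
  transitivity (\sum_k kac_rotation i j theta (delta_mx 0 a) 0 k * kac_rotation i j theta (delta_mx 0 b) 0 k).
    by apply: eq_bigr => k _; rewrite OE [X in _ * X]mxE OE.
  by rewrite kac_rotation_dot // dot !mxE eqxx eq_sym.
move=> v; apply/rowP => k; rewrite [RHS]mxE.
have [->|ki] := eqVneq k i.
  rewrite mxE eqxx -(dot' v i) -(dot' v j) !mulr_sumr -big_split; apply: eq_bigr => a _.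
  by rewrite OE [kac_rotation _ _ _ _ _ _]mxE eqxx mulrDr !(mulrCA (v 0 a)).
have [->|kj] := eqVneq k j.
  rewrite mxE eqxx (eq_sym j) (negbTE ij) -(dot' v i) -(dot' v j) !mulr_sumr -big_split.
  apply: eq_bigr => a _.
  by rewrite OE [kac_rotation _ _ _ _ _ _]mxE eqxx (eq_sym j) (negbTE ij) mulrDr !(mulrCA (v 0 a)).
rewrite mxE (negbTE ki) (negbTE kj) -(dot' v k); apply: eq_bigr => a _.
by rewrite OE [kac_rotation _ _ _ _ _ _]mxE (negbTE ki) (negbTE kj).
Qed.

Lemma continuous_rotation i j theta k : continuous (fun v => kac_rotation i j theta v 0 k).
Proof.
have cc (a : 'I_N) : continuous (fun v => v 0 a) by exact: coord_continuous.
have cl (c d : R) : continuous (fun v => c * v 0 i + d * v 0 j).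
  move=> x; have FX : Filter (nbhs x) by exact: nbhs_filter.
  by apply: cvgD; apply: cvgM; [exact: cvg_cst|exact: cc|exact: cvg_cst|exact: cc].
rewrite (_ : (fun v => _) = fun v => if k == i then cos theta * v 0 i + sin theta * v 0 j
  else if k == j then - sin theta * v 0 i + cos theta * v 0 j else v 0 k); last first.
  by apply/funext => v; rewrite mxE.
by case: (k == i); [exact: cl|case: (k == j); [exact: cl|exact: cc]].
Qed.

Lemma moment_rotation (U : probability bs R) i j theta s : i != j -> uniform_sphere_law U ->
  sphere_mean U (fun v => energy_monomial s (kac_rotation i j theta v)) = moment U s.
Proof.
move=> ij [_ HU]; have [Q QQ rQ] := kac_rotation_mul theta ij.
apply: moment_invariant.
- exact: continuous_rotation.
- have E v : \sum_k kac_rotation i j theta v 0 k ^+ 2 = \sum_k v 0 k ^+ 2.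
    exact: (kac_rotation_dot theta v v ij).
  by apply/seteqP; split=> v; rewrite /kac_sphere /= E.
- move=> A mA; rewrite -(HU Q A QQ mA); congr (U _).
  by apply/seteqP; split=> v /=; rewrite rQ.
Qed.

(* Finite-rank kernels, for which the two averages commute without Fubini. *)
Definition separable (h : R -> bs -> R) := exists l : seq ((R -> R) * (bs -> R)),
  (forall p, p \in l -> continuous p.1 /\ sphere_fun p.2) /\
  forall theta v, h theta v = \sum_(p <- l) p.1 theta * p.2 v.

Lemma separableM h h' : separable h -> separable h' ->
  separable (fun theta v => h theta v * h' theta v).
Proof.
move=> [l [Hl El]] [l' [Hl' El']].
exists [seq ((fun t => p.1 t * q.1 t), (fun v => p.2 v * q.2 v)) | p <- l, q <- l']; split.
  move=> _ /allpairsP [[p q] /= [/Hl [c1 s1] /Hl' [c2 s2] ->]] /=; split.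
    by move=> x; apply: cvgM; [exact: c1|exact: c2].
  exact: sphere_funM.
move=> theta v; rewrite El El' big_allpairs_dep mulr_suml; apply: eq_bigr => p _.
by rewrite mulr_sumr; apply: eq_bigr => q _ /=; rewrite mulrACA.
Qed.

Lemma separable_rotation i j s : separable (fun theta v => energy_monomial s (kac_rotation i j theta v)).
Proof.
have scoord (a : 'I_N) : sphere_fun (fun v : bs => (v : 'rV[R]_N) 0 a).
  split; first exact: measurable_coord.
  exists (N%:R + 1) => v Hv; have /andP[_ h] := energy_bound a Hv.
  have N0 : 0 <= N%:R :> R by [].
  by rewrite -(ler_pXn2r (n := 2)) // ?nnegrE ?addr_ge0 // real_normK ?num_real //; nra.
have cst c : continuous (fun _ : R => c : R) by move=> x; exact: cvg_cst.
have sep_coord (k : 'I_N) : separable (fun theta v => kac_rotation i j theta v 0 k).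
  pose c : R -> R := @cos R; pose d : R -> R := @sin R.
  have cc : continuous c by exact: continuous_cos.
  have cs : continuous d by exact: continuous_sin.
  have cns : continuous (fun t => - d t) by move=> x; apply: cvgN; exact: cs.
  exists (if k == i then [:: (c, fun v : bs => (v : 'rV[R]_N) 0 i); (d, fun v : bs => (v : 'rV[R]_N) 0 j)]
   else if k == j then [:: (fun t => - d t, fun v : bs => (v : 'rV[R]_N) 0 i); (c, fun v : bs => (v : 'rV[R]_N) 0 j)]
   else [:: (fun=> 1, fun v : bs => (v : 'rV[R]_N) 0 k)]); split.
    move=> p; case: ifP => _; last case: ifP => _; rewrite !inE;
      do ?[case/orP]; move=> /eqP -> /=; split=> //.
  move=> theta v; rewrite mxE; case: ifP => _; last case: ifP => _; rewrite !big_cons big_nil addr0 //.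
  by rewrite mul1r.
elim: s => [|a s IH].
  exists [:: (fun=> 1, fun=> 1)]; split.
    by move=> p; rewrite inE => /eqP -> /=; split=> //; exact: sphere_fun_cst.
  by move=> theta v; rewrite big_seq1 mulr1 /energy_monomial big_nil.
have := separableM (separableM (sep_coord a) (sep_coord a)) IH; congr separable.
by apply/funext => theta; apply/funext => v; rewrite /energy_monomial big_cons expr2.
Qed.

Lemma separable_swap (U : probability bs R) h : U sph = 1%E -> separable h ->
  angle_avg (fun theta => sphere_mean U (h theta)) = sphere_mean U (fun v => angle_avg (h^~ v)).
Proof.
move=> U1 [l [Hl El]].
have S (c : (R -> R) * (bs -> R) -> R) : sphere_fun (fun v => \sum_(p <- l) c p * p.2 v) /\
    sphere_mean U (fun v => \sum_(p <- l) c p * p.2 v) = \sum_(p <- l) c p * sphere_mean U p.2.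
  elim: l Hl {El} => [|p l IH] Hl.
    under eq_fun do rewrite big_nil; rewrite big_nil; split; first exact: sphere_fun_cst.
    by rewrite sphere_mean_cst.
  have [|s1 s2] := IH; first by move=> q ql; apply: Hl; rewrite inE ql orbT.
  have [_ sp] := Hl p (mem_head _ _).
  have scp : sphere_fun (fun v => c p * p.2 v) by apply: sphere_funM => //; exact: sphere_fun_cst.
  under eq_fun do rewrite big_cons; rewrite big_cons; split; first exact: sphere_funD.
  by rewrite sphere_meanD // s2 sphere_meanZ.
have A (c : (R -> R) * (bs -> R) -> R) : continuous (fun t => \sum_(p <- l) p.1 t * c p) /\
    angle_avg (fun t => \sum_(p <- l) p.1 t * c p) = \sum_(p <- l) angle_avg p.1 * c p.
  elim: l Hl {El S} => [|p l IH] Hl.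
    under eq_fun do rewrite big_nil; rewrite big_nil; split; first by move=> x; exact: cvg_cst.
    by rewrite angle_avg_cst.
  have [|s1 s2] := IH; first by move=> q ql; apply: Hl; rewrite inE ql orbT.
  have [cp _] := Hl p (mem_head _ _).
  have ccp : continuous (fun t => p.1 t * c p).
    by move=> x; apply: cvgM; [exact: cp|exact: cvg_cst].
  under eq_fun do rewrite big_cons; rewrite big_cons; split.
    by move=> x; apply: cvgD; [exact: ccp|exact: s1].
  rewrite angle_avgD // s2 (_ : (fun t => p.1 t * c p) = fun t => c p * p.1 t) ?angle_avgZ 1?mulrC //.
  by apply/funext => t; rewrite mulrC.
transitivity (\sum_(p <- l) angle_avg p.1 * sphere_mean U p.2).
  rewrite -(A (fun p => sphere_mean U p.2)).2; congr angle_avg; apply/funext => t.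
  by rewrite -(S (fun p => p.1 t)).2; congr sphere_mean; apply/funext => v.
rewrite -(S (fun p => angle_avg p.1)).2; congr sphere_mean; apply/funext => v.
by rewrite -(A (fun p => p.2 v)).2; congr angle_avg; apply/funext => t.
Qed.

(** Rotation invariance at each fixed angle, averaged over the angle: the balance holds for every
    pair by itself, before any summation. *)
Lemma uniform_moment_coef (U : probability bs R) i j s : i != j -> uniform_sphere_law U ->
  kac_coef R i j s * (\sum_(s' <- expand i j s) moment U s') = moment U s.
Proof.
move=> ij HU; have U1 := HU.1.
rewrite -[RHS]angle_avg_cst.
rewrite [X in _ = angle_avg X](_ : _ = fun theta => sphere_mean U
   (fun v => energy_monomial s (kac_rotation i j theta v))); last first.
  by apply/funext => theta; rewrite (moment_rotation theta s ij HU).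
rewrite separable_swap //; last exact: separable_rotation.
under [X in sphere_mean _ X]eq_fun do rewrite angle_avg_rotation //.
rewrite sphere_meanZ; first by rewrite sphere_mean_sum // => s'; exact: sphere_fun_monomial.
  exact: U1.
by apply: sphere_fun_sum => s'; exact: sphere_fun_monomial.
Qed.

Lemma uniform_moment_rate (U : probability bs R) s : uniform_sphere_law U ->
  moment_rate (moment U) s = 0.
Proof.
move=> HU; rewrite /moment_rate big1 ?mulr0 // => i _; rewrite big1 // => j ij.
by rewrite uniform_moment_coef // subrr.
Qed.

Lemma kac_law_moment0 (F0 : probability bs R) F s : kac_law F0 F -> moment (F 0) s = moment F0 s.
Proof.
move=> [H _ _]; rewrite /moment /sphere_mean /Rintegral; congr fine.
by apply: eq_measure_integral => A mA _; exact: H.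
Qed.

Definition forward_filter (t : R) : set_system R := within [set h | 0 <= t + h] 0^'.

Lemma diffq_kac_law (F0 : probability bs R) F t s : (1 < N)%N -> kac_law F0 F -> 0 <= t ->
  diffq (forward_filter t) (fun h => moment (F (t + h)) s) (moment (F t) s)
    (moment_rate (moment (F t)) s).
Proof.
move=> N2 [_ H1 H2] t0.
rewrite -(sphere_mean_generator N2 (H1 t t0)).
apply: H2 => //; apply: continuous_subspaceT; exact: continuous_energy_monomial.
Qed.

End Symmetry.

(** * The cumulant equation *)

Section CumulantRate.
Variables (R : realType) (N : nat).
Local Notation bs := (borel_space R N).
Local Notation sph := (kac_sphere R N).
Implicit Types (i j a : 'I_N) (s : seq 'I_N) (m k : seq 'I_N -> R).

Definition excess i j k (theta : R) s : R :=
  collide i j (cos theta ^+ 2) (sin theta ^+ 2) k s - k s.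

(** On non-empty sequences this is the part of the exponential that is at least quadratic in [d]. It
    consults [d] only on strictly shorter sequences, which makes the hierarchy of cumulants closed
    from below. *)
Definition exp_tail (d : seq 'I_N -> R) s : R := conv_exp d s - d s.

Definition interaction k s : R := (N%:R - 1)^-1 * \sum_(i < N) \sum_(j < N | i != j)
  angle_avg (fun theta => exp_tail (excess i j k theta) s).

Lemma continuous_conv (f g : R -> seq 'I_N -> R) s :
  (forall s', (size s' <= size s)%N -> continuous (f^~ s')) ->
  (forall s', (size s' <= size s)%N -> continuous (g^~ s')) ->
  continuous (fun x => conv (f x) (g x) s).
Proof.
elim: s f g => [|a s IH] f g Hf Hg.
  by under eq_fun do rewrite conv0; move=> x; apply: cvgM; [exact: Hf|exact: Hg].
under eq_fun do rewrite conv_cons; move=> x; apply: cvgD; apply: IH => s' Hs';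
  by [apply: Hf => //=; rewrite ltnW|apply: Hg => //=; rewrite ltnW|exact: Hf|exact: Hg].
Qed.

Lemma continuous_conv_exp (d : R -> seq 'I_N -> R) s :
  (forall s', continuous (d^~ s')) -> continuous (fun x => conv_exp (d x) s).
Proof.
move=> cd; have [n] := ubnP (size s); elim: n s => // n IH [|a s] /ltnSE Hs.
  by under eq_fun do rewrite conv_exp0; move=> x; exact: cvg_cst.
rewrite (_ : (fun x => _) = fun x => conv (conv_exp (d x)) (shift_label a (d x)) s).
  apply: continuous_conv => s' Hs'; last exact: cd.
  by apply: IH; apply: leq_ltn_trans Hs' Hs.
by apply/funext => x; rewrite conv_expE.
Qed.

Lemma continuous_excess i j k s : continuous (fun theta => excess i j k theta s).
Proof.
move=> x; apply: cvgB; last exact: cvg_cst.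
by apply: cvgM; [exact: continuous_collision_coef|exact: cvg_cst].
Qed.

Lemma angle_avg_excess i j k s : angle_avg (fun theta => excess i j k theta s) =
  kac_coef R i j s * (\sum_(s' <- expand i j s) k s') - k s.
Proof.
have cc := @continuous_collision_coef R N i j s.
rewrite (_ : (fun theta => _) = fun theta => (\sum_(s' <- expand i j s) k s') *
   collision_coef i j (cos theta ^+ 2) (sin theta ^+ 2) s + - k s); last first.
  by apply/funext => theta; rewrite /excess /collide mulrC.
rewrite angle_avgD ?angle_avgZ ?angle_avg_cst //; first by rewrite mulrC.
- by move=> x; apply: cvgM; [exact: cvg_cst|exact: cc].
- by move=> x; exact: cvg_cst.
Qed.

(** The logarithmic derivative of the moments in time: by [collide_cumulants] each collision
    multiplies the moments by the exponential of the excess, and [conv_unit] accounts for the loss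
    term. *)
Definition cumulant_rate k s : R := (N%:R - 1)^-1 * \sum_(i < N) \sum_(j < N | i != j)
  angle_avg (fun theta => conv_exp (excess i j k theta) s - conv_unit R s).

Lemma cumulant_rateE k s : s != [::] -> cumulant_rate k s = moment_rate k s + interaction k s.
Proof.
move=> s0; rewrite -mulrDr; congr (_ * _); rewrite -big_split; apply: eq_bigr => i _ /=.
rewrite -big_split; apply: eq_bigr => j _ /=.
rewrite -angle_avg_excess -angle_avgD.
- by congr angle_avg; apply/funext => theta; rewrite /conv_unit (negbTE s0) subr0 /exp_tail addrCA subrr addr0.
- exact: continuous_excess.
- move=> x; apply: cvgB; last exact: continuous_excess.
  by apply: continuous_conv_exp => s'; exact: continuous_excess.
Qed.

Lemma moment_rate_conv m s : m [::] = 1 ->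
  moment_rate m s = conv m (cumulant_rate (cumulants m)) s.
Proof.
move=> m1; have m0 : m [::] != 0 by rewrite m1 oner_neq0.
rewrite /cumulant_rate convZr; congr (_ * _).
rewrite conv_sumr; apply: eq_bigr => i _; rewrite conv_sumr; apply: eq_bigr => j ij.
rewrite -angle_avg_excess.
set k := cumulants m.
have cE t : continuous (fun theta => conv_exp (excess i j k theta) t - conv_unit R t).
  move=> x; apply: cvgB; last exact: cvg_cst.
  by apply: continuous_conv_exp => s'; exact: continuous_excess.
transitivity (angle_avg (fun theta => \sum_(p <- splits s) m p.1 *
    (conv_exp (excess i j k theta) p.2 - conv_unit R p.2))).
  congr angle_avg; apply/funext => theta.
  rewrite /excess (collide_cumulants _ _ ij m0) -/k.
  have E1 : m s = conv m (conv_unit R) s by rewrite conv_unitr.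
  rewrite E1 /conv -sumrB.
  by apply: eq_bigr => p _; rewrite mulrBr.
rewrite angle_avg_sum; last by move=> p x; apply: cvgM; [exact: cvg_cst|exact: cE].
by apply: eq_bigr => p _; rewrite angle_avgZ.
Qed.

(** The moments of [U] convolved with [cumulant_rate k] give their rate of change, which is zero,
    and the moments can be cancelled. *)
Lemma uniform_cumulant_rate (U : probability bs R) (k := cumulants (moment U)) s :
  uniform_sphere_law U -> s != [::] -> moment_rate k s + interaction k s = 0.
Proof.
move=> HU s0; rewrite -cumulant_rateE //.
have m1 := moment0 HU.1.
suff -> : cumulant_rate k = fun=> 0 by [].
apply: (@conv_inj _ _ (moment U)); first by rewrite m1 oner_neq0.
by move=> s'; rewrite conv_zeror -moment_rate_conv // uniform_moment_rate.
Qed.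

(** As the energies add up to [N], the sum of all first derivatives of the moments is [N] times the
    moments; the sum of their logarithmic derivatives is thus the constant [N] and has no terms of
    higher order. *)
Lemma cumulant_energy (F : probability bs R) s : F sph = 1%E ->
  \sum_(j < N) cumulants (moment F) (j :: s) = N%:R * (s == [::])%:R.
Proof.
move=> F1; have m1 := moment0 F1; have m0 : moment F [::] != 0 by rewrite m1 oner_neq0.
suff /(congr1 (fun f => f s)) : (fun s => \sum_(j < N) cumulants (moment F) (j :: s)) =
  (fun s => N%:R * conv_unit R s) by [].
apply: (conv_inj m0) => s'; rewrite convZr conv_unitr -moment_energy //.
rewrite (conv_sumr _ _ (fun j s => cumulants (moment F) (j :: s))).
apply: eq_bigr => j _; rewrite -[RHS]/(shift_label j (moment F) s').
by rewrite (shift_cumulants j m0).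
Qed.

Lemma forward_filter0 (t : R) : forward_filter t --> 0^'.
Proof. exact: cvg_within. Qed.

Lemma diffq_kac_cumulants (F0 : probability bs R) F t s (k := fun t => cumulants (moment (F t))) :
  (1 < N)%N -> kac_law F0 F -> 0 <= t -> s != [::] ->
  diffq (forward_filter t) (fun h => k (t + h) s) (k t s)
    (moment_rate (k t) s + interaction (k t) s).
Proof.
move=> N2 HF t0 s0; have [_ HF1 _] := HF.
(* Nothing is known about [F] at negative times, while [diffq_cumulants] asks for [m h [::] != 0] at
   every [h]; the moments are therefore frozen there, which the filter does not see. *)
pose m h := if 0 <= t + h then moment (F (t + h)) else moment (F t).
have FF : Filter (forward_filter t) by exact: within_filter.
have E : \forall h \near forward_filter t, m h = moment (F (t + h)).
  by near=> h; rewrite /m ifT //; near: h; exact: withinT.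
have m1 h : m h [::] = 1.
  by rewrite /m; case: ifP => [h0|_]; apply: moment0; apply: HF1.
have mt1 := moment0 (HF1 t t0).
have H := @diffq_cumulants R (forward_filter t) FF (@forward_filter0 t) _ m (moment (F t))
  (cumulant_rate (k t)).
have {}H : diffq (forward_filter t) (fun h => cumulants (m h) s) (k t s) (cumulant_rate (k t) s).
  apply: H => //; [by move=> h; rewrite m1 oner_neq0|by rewrite mt1 oner_neq0|].
  move=> s'; rewrite -moment_rate_conv //.
  have := @diffq_kac_law R N F0 F t s' N2 HF t0; apply: cvg_trans; apply: near_eq_cvg.
  near=> h; have -> : m h = moment (F (t + h)) by near: h; exact: E.
  by [].
rewrite -cumulant_rateE //; apply: cvg_trans H; apply: near_eq_cvg.
near=> h; have -> : m h = moment (F (t + h)) by near: h; exact: E.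
by [].
Unshelve. all: by end_near. Qed.

End CumulantRate.

(** * Bounds on the nonlinear terms *)

Definition distinct (T : eqType) (s : seq T) : nat := size (undup s).

Lemma distinct_gt0 (T : eqType) (s : seq T) : s != [::] -> (0 < distinct s)%N.
Proof.
case: s => // a s _; rewrite /distinct lt0n size_eq0.
by apply/eqP => E; have := mem_undup (a :: s) a; rewrite E mem_head.
Qed.

Section Labels.
Variables (T : eqType) (i j : T).
Hypothesis ij : i != j.
Implicit Types (s : seq T).

Definition others s := [seq a <- s | (a != i) && (a != j)].

Definition touches s := (i \in s) || (j \in s).

Lemma distinct_others s :
  distinct s = (distinct (others s) + (i \in s) + (j \in s))%N.
Proof.
rewrite /distinct /others -filter_undup size_filter.
rewrite -!(mem_undup s) -!(count_uniq_mem _ (undup_uniq s)).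
elim: (undup s) => //= a u ->.
by have [->|ai] := eqVneq a i; [rewrite (negbTE ij) /=|case: eqVneq => /= _]; lia.
Qed.

Lemma touches_others s : touches s = (size (others s) < size s)%N.
Proof.
rewrite /touches size_filter.
elim: s => //= a s IH; have H := count_size (fun a => (a != i) && (a != j)) s.
rewrite !inE (eq_sym i) (eq_sym j); have [/= _|/= ai] := eqVneq a i; first by lia.
have [/= _|/= aj] := eqVneq a j; first by rewrite orbT; lia.
by rewrite IH; lia.
Qed.

Lemma mem_expand_others s s' : s' \in expand i j s ->
  others s' = others s /\ size s' = size s.
Proof.
elim: s s' => [|a s IH] s' /=; first by rewrite inE => /eqP ->.
have [->|ai] := eqVneq a i; last have [->|aj] := eqVneq a j => /=.
- rewrite /= mem_cat => /orP[] /mapP[t /IH [H1 H2] ->] /=; rewrite ?eqxx /= ?andbF H1 H2 //.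
- rewrite /= mem_cat => /orP[] /mapP[t /IH [H1 H2] ->] /=; rewrite ?eqxx /= ?andbF H1 H2 //.
- by move=> /mapP[t /IH [H1 H2] ->] /=; rewrite ai aj H1 H2.
Qed.

Lemma expand_touches s s' : s' \in expand i j s -> touches s' = touches s.
Proof. by move=> /mem_expand_others [H1 H2]; rewrite !touches_others H1 H2. Qed.

Lemma size_expand s : (size (expand i j s) <= 2 ^ size s)%N.
Proof.
elim: s => //= a s IH; rewrite expnS.
by case: ifP => _; rewrite ?size_cat !size_map; lia.
Qed.

Lemma expand_ntouch s : ~~ touches s -> expand i j s = [:: s].
Proof.
rewrite /touches; elim: s => //= a s IH; rewrite !inE !negb_or (eq_sym i) (eq_sym j).
move=> /andP[/andP[/negbTE ai nis] /andP[/negbTE aj njs]].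
by rewrite ai aj /= IH // negb_or nis njs.
Qed.

Lemma distinct_cat s1 s2 : (distinct (s1 ++ s2) <= distinct s1 + distinct s2)%N.
Proof. by rewrite /distinct undup_cat size_cat leq_add2r size_filter count_size. Qed.

Lemma distinct_perm s1 s2 : perm_eq s1 s2 -> distinct s1 = distinct s2.
Proof. by move=> /perm_mem H; apply/perm_size/perm_undup. Qed.

Lemma distinct_others_splits s p : p \in splits s ->
  (distinct (others s) <= distinct (others p.1) + distinct (others p.2))%N.
Proof.
move=> /perm_splits Hp.
rewrite -(distinct_perm (perm_filter _ Hp)) filter_cat; exact: distinct_cat.
Qed.

Lemma touches_splits s p : p \in splits s -> touches s = touches p.1 || touches p.2.
Proof.
by move=> /perm_splits /perm_mem Hp; rewrite /touches -!Hp !mem_cat orbACA.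
Qed.

Variables (R : realFieldType) (q : R).
Hypothesis q01 : 0 < q <= 1.

(** The size of an excess for the pair [(i, j)]. It vanishes on non-empty sequences that avoid the
    pair; otherwise the expansion may merge [i] and [j] into one label, and only the other labels
    can be relied upon. The value 1 at [[::]] matches the formal exponential. *)
Definition weight s : R :=
  if s == [::] then 1 else if touches s then q ^+ distinct (others s) else 0.

Let q0 : 0 < q. Proof. by case/andP: q01. Qed.
Let q1 : q <= 1. Proof. by case/andP: q01. Qed.

Lemma weight_ge0 s : 0 <= weight s.
Proof. by rewrite /weight; do 2?case: ifP => // _; rewrite exprn_ge0 // ltW. Qed.

(** If a non-empty part avoids the pair, the product is zero. Otherwise every label counted in [s]
    is counted in some part, so the exponents add up to at least that of [s]. The weight with
    exponent [(distinct s).-1] fails here: splitting [[:: i; j]] would lose a factor [q]. *)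
Lemma weight_splits s p : p \in splits s -> weight p.1 * weight p.2 <= weight s.
Proof.
move=> Hp; have Hsz := size_splits_mem Hp.
have Ho := distinct_others_splits Hp; have Ht := touches_splits Hp.
rewrite /weight -!size_eq0 -Hsz addn_eq0 Ht !size_eq0.
have [p1|p1] := eqVneq p.1 [::].
  rewrite p1 mul1r [touches [::]]/= /=; case: ifP => // _; case: ifP => // _.
  by rewrite p1 /= in Ho; rewrite ler_wiXn2l // ?ltW //.
have [p2|p2] := eqVneq p.2 [::].
  rewrite p2 mulr1 [touches [::]]/= orbF /=; case: ifP => // _.
  by rewrite p2 addn0 /= in Ho; rewrite ler_wiXn2l // ?ltW //.
rewrite /=; case: ifP => // _; last by rewrite mul0r; case: ifP => // _; rewrite exprn_ge0 // ltW.
case: ifP => /= _; last by rewrite mulr0 exprn_ge0 // ltW.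
by rewrite -exprD ler_wiXn2l // ltW.
Qed.

Variables (u w : R).
Hypotheses (u01 : 0 <= u <= 1) (w01 : 0 <= w <= 1).

Lemma collision_coef01 s : 0 <= collision_coef i j u w s <= 1.
Proof.
have [u0 u1] := andP u01; have [w0 w1] := andP w01.
by rewrite mulr_ge0 ?exprn_ge0 // mulr_ile1 ?exprn_ge0 // exprn_ile1.
Qed.

Lemma normr_collide (k : seq T -> R) s (M : R) : 0 <= M ->
  (forall s', s' \in expand i j s -> `|k s'| <= M) -> `|\sum_(s' <- expand i j s) k s'| <= 2 ^+ size s * M.
Proof.
move=> M0 HM; apply: le_trans (ler_norm_sum _ _ _) _.
apply: (@le_trans _ _ (\sum_(s' <- expand i j s) M)).
  by rewrite big_seq [leRHS]big_seq; apply: ler_sum.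
rewrite big_const_seq count_predT iter_addr addr0 -[leLHS]mulr_natl; apply: ler_wpM2r => //.
by rewrite -natrX ler_nat size_expand.
Qed.

Lemma normr_excess (k : seq T -> R) s (M : R) : s != [::] -> 0 <= M ->
  (forall s', size s' = size s -> `|k s'| <= M * q ^+ (distinct s').-1) ->
  `|collide i j u w k s - k s| <= (2 ^+ size s + 1) * M * weight s.
Proof.
move=> s0 M0 HM; rewrite /weight (negbTE s0).
case: (boolP (touches s)) => ts; last first.
  have /norP [is_ js] := ts.
  rewrite /collide expand_ntouch // big_seq1 /collision_coef.
  by rewrite !(count_memPn _) // !mul1r subrr normr0 mulr0.
have B s' : size s' = size s -> others s' = others s -> `|k s'| <= M * q ^+ distinct (others s).
  move=> Hs' Ho; apply: le_trans (HM s' Hs') _; apply: ler_wpM2l => //.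
  apply: ler_wiXn2l => //; first exact: ltW.
  rewrite (distinct_others s') Ho.
  have : touches s' by rewrite touches_others Ho Hs' -touches_others.
  by rewrite /touches; case: (i \in s'); case: (j \in s') => //= _; rewrite ?addn0 !addn1 /=.
pose W := M * q ^+ distinct (others s).
have W0 : 0 <= W by rewrite mulr_ge0 // exprn_ge0 // ltW.
have -> : (2 ^+ size s + 1) * M * q ^+ distinct (others s) = 2 ^+ size s * W + W.
  by rewrite /W; ring.
apply: le_trans (ler_normB _ _) _; apply: lerD; last exact: B.
have [c0 c1] := andP (collision_coef01 s).
rewrite /collide normrM (ger0_norm c0).
apply: le_trans (ler_piMl _ c1) _ => //; apply: normr_collide => // s' Hs'.
by have [H1 H2] := mem_expand_others Hs'; exact: B.
Qed.

End Labels.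

(** * Majorants and the tail of the exponential *)

Section Majorant.
Variables (R : realFieldType) (C P : R).
Hypotheses (C1 : 1 <= C) (P1 : 1 <= P).

(** The bound of the theorem without its decay in time, [P] standing for [N ^ c]. At order 0 the
    truncated predecessor yields the value 1. *)
Definition majorant (n : nat) : R := n`!%:R * C ^+ (n ^ 2) * P ^+ n.-1.

Lemma majorant_gt0 n : 0 < majorant n.
Proof.
have C0 : 0 < C := lt_le_trans ltr01 C1; have P0 : 0 < P := lt_le_trans ltr01 P1.
by rewrite !mulr_gt0 ?exprn_gt0 // ltr0n fact_gt0.
Qed.

Lemma majorant0 : majorant 0 = 1.
Proof. by rewrite /majorant fact0 !expr0 !mul1r. Qed.

Lemma fact_mul_leq a b : (a`! * b`! <= (a + b)`!)%N.
Proof.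
have := bin_fact (leq_addr b a); rewrite addKn => <-.
by rewrite leq_pmull // bin_gt0 leq_addr.
Qed.

(** From [(a - 1) * (b - 1) >= 0] one gets [a * b >= n], hence
    [a ^ 2 + b ^ 2 + 2 * n <= (n + 1) ^ 2]. *)
Lemma majorant_mul n a b : (0 < a)%N -> (0 < b)%N -> (a + b = n.+1)%N ->
  majorant a * majorant b <= majorant n.+1 * (C ^- 2) ^+ n.
Proof.
move=> a0 b0 ab; have C0 : 0 < C := lt_le_trans ltr01 C1; have P0 : 0 < P := lt_le_trans ltr01 P1.
rewrite exprVn -exprM ler_pdivlMr ?exprn_gt0 //.
have -> : majorant a * majorant b * C ^+ (2 * n) =
  (a`!%:R * b`!%:R) * C ^+ (a ^ 2 + b ^ 2 + 2 * n) * P ^+ (a.-1 + b.-1).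
  by rewrite /majorant !exprD; ring.
rewrite /majorant; apply: ler_pM => //.
- by rewrite !mulr_ge0 ?exprn_ge0 // ltW.
- by rewrite exprn_ge0 // ltW.
- apply: ler_pM; [by rewrite mulr_ge0|by rewrite exprn_ge0 // ltW| |].
    by rewrite -natrM ler_nat -ab fact_mul_leq.
  by rewrite ler_weXn2l // -ab; nia.
- by rewrite ler_weXn2l //; lia.
Qed.

End Majorant.

Arguments majorant : simpl never.

Section TailBound.
Variables (T : eqType) (i j : T) (R : realFieldType) (q C P : R).
Hypotheses (ij : i != j) (q01 : 0 < q <= 1) (C1 : 2 ^+ 10 <= C) (P1 : 1 <= P).
Local Notation K := (majorant C P).
Local Notation W := (weight i j q).
Local Notation x := (C ^- 2).
Implicit Types (s : seq T) (d : seq T -> R).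

Let C1' : 1 <= C. Proof. by apply: le_trans C1; rewrite -natrX ler1n. Qed.

Let x0 : 0 <= x.
Proof. by rewrite invr_ge0 exprn_ge0 // (le_trans ler01). Qed.

Let xs : x * 2 ^+ 20 <= 1.
Proof.
have C0 : 0 < C by exact: lt_le_trans ltr01 C1'.
rewrite mulrC ler_pdivrMr ?exprn_gt0 // mul1r (_ : 20 = 10 * 2)%N // exprM.
by rewrite lerXn2r ?nnegrE ?exprn_ge0 // ltW.
Qed.

Let K0 n : 0 <= K n. Proof. by rewrite ltW // majorant_gt0. Qed.

Let W0 s : 0 <= W s. Proof. exact: weight_ge0. Qed.

Lemma exp_tail_cons d a s : conv_exp d (a :: s) - d (a :: s) =
  \sum_(p <- splits s | p.1 != [::]) conv_exp d p.1 * d (a :: p.2).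
Proof.
rewrite conv_expE /= conv_nonempty ?conv_exp0 // /shift_label.
by rewrite addrAC subrr add0r.
Qed.

(* There are [2 ^ n] splits; each contributes at most [majorant n.+1 * C ^- (2 n)]. *)
Lemma split_sum (f : seq T * seq T -> R) a s (M : R) : 0 <= M ->
  (forall p, p \in splits s -> p.1 != [::] ->
    `|f p| <= M * (K (size p.1) * K (size p.2).+1) * (W p.1 * W (a :: p.2))) ->
  `|\sum_(p <- splits s | p.1 != [::]) f p| <=
    M * (2 * x) ^+ size s * K (size s).+1 * W (a :: s).
Proof.
move=> M0 Hf; apply: le_trans (ler_norm_sum _ _ _) _.
pose B := M * (K (size s).+1 * x ^+ size s) * W (a :: s).
have B0 : 0 <= B by do !apply: mulr_ge0 => //; exact: exprn_ge0.
have -> : M * (2 * x) ^+ size s * K (size s).+1 * W (a :: s) = 2 ^+ size s * B.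
  by rewrite /B exprMn; ring.
apply: (@le_trans _ _ (\sum_(p <- splits s) B)); last first.
  rewrite big_const_seq count_predT iter_addr addr0 -[leLHS]mulr_natl; apply: ler_wpM2r => //.
  by rewrite size_splits natrX.
rewrite big_seq_cond [leRHS](bigID (fun p => p.1 != [::])) /= -[leLHS]addr0; apply: lerD; last first.
  by apply: sumr_ge0.
rewrite [leRHS]big_seq_cond; apply: ler_sum => p /andP[Hp p1].
apply: le_trans (Hf p Hp p1) _; rewrite /B; apply: ler_pM.
- by do !apply: mulr_ge0 => //.
- exact: mulr_ge0.
- apply: ler_wpM2l => //; apply: majorant_mul => //; first by rewrite lt0n size_eq0.
  by rewrite addnS (size_splits_mem Hp).
- apply: (@weight_splits _ i j R q q01 (a :: s) (p.1, a :: p.2)); rewrite /= mem_cat; apply/orP; right.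
  by apply/mapP; exists p.
Qed.

(** The base 8 absorbs the [2 ^ size s + 1] terms of an excess. The base then grows to 16 for an
    exponential and to 32 for a difference of two exponentials; the gain [x] of each splitting pays
    for the growth. *)
Definition majorized n (M : R) d := forall s, s != [::] -> (size s <= n)%N ->
  `|d s| <= M * 8 ^+ size s * K (size s) * W s.

Let pow_le (c1 c2 : R) a b n : 0 <= c1 -> c1 <= c2 -> 8 <= c2 -> (a + b = n)%N ->
  c1 ^+ a * 8 ^+ b <= c2 ^+ n.
Proof.
move=> h0 h1 h2 <-; rewrite exprD; apply: ler_pM; rewrite ?exprn_ge0 //.
  by rewrite lerXn2r ?nnegrE // (le_trans h0).
by rewrite lerXn2r ?nnegrE // (le_trans _ h2).
Qed.

Let small (c : R) n : 0 <= c -> c <= 2 ^+ 20 -> (0 < n)%N -> (c * x) ^+ n <= c * x.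
Proof.
move=> c0 c1; case: n => // n _; have cx0 : 0 <= c * x by rewrite mulr_ge0.
rewrite exprS ler_piMr // exprn_ile1 //; apply: le_trans xs.
by rewrite [leRHS]mulrC ler_wpM2r.
Qed.

Lemma conv_exp_bound n d : majorized n 1 d -> forall s, (size s <= n)%N ->
  `|conv_exp d s| <= 16 ^+ size s * K (size s) * W s.
Proof.
move=> Hd s; have [l] := ubnP (size s); elim: l s => // l IH [|a s] /ltnSE Hl Hn.
  by rewrite conv_exp0 majorant0 // normr1 expr0 !mul1r.
rewrite -[conv_exp d (a :: s)](subrK (d (a :: s))) exp_tail_cons.
apply: le_trans (ler_normD _ _) _.
have {Hl IH} H1 : `|\sum_(p <- splits s | p.1 != [::]) conv_exp d p.1 * d (a :: p.2)| <=
    16 ^+ (size s).+1 * (2 * x) ^+ size s * K (size s).+1 * W (a :: s).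
  apply: split_sum => [|p Hp p1]; first by rewrite exprn_ge0.
  have Hsz := size_splits_mem Hp.
  have p10 : (0 < size p.1)%N by rewrite lt0n size_eq0.
  have s1 : (size p.1 < l)%N by apply: leq_trans Hl; rewrite /= ltnS -Hsz leq_addr.
  have s2 : (size p.1 <= n)%N by apply: leq_trans Hn; rewrite /= -Hsz ltnW // ltnS leq_addr.
  have s3 : (size (a :: p.2) <= n)%N by apply: leq_trans Hn; rewrite /= ltnS -Hsz leq_addl.
  have h1 := IH _ s1 s2; have h2 := Hd (a :: p.2) isT s3.
  rewrite normrM; apply: le_trans (ler_pM _ _ h1 h2) _ => //=.
  rewrite mul1r [leLHS](_ : _ = 16 ^+ size p.1 * 8 ^+ (size p.2).+1 *
    (K (size p.1) * K (size p.2).+1) * (W p.1 * W (a :: p.2))); last by ring.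
  by do 2![apply: ler_wpM2r; first by rewrite mulr_ge0]; apply: pow_le; rewrite ?ler_nat // addnS Hsz.
have h2 := Hd (a :: s) isT Hn; rewrite /= mul1r in h2 *.
have KW : 0 <= K (size s).+1 * W (a :: s) by rewrite mulr_ge0.
move: H1 h2 KW; rewrite -!(mulrA _ (K _)); set k := K _ * W _ => H1 h2 KW.
case: (posnP (size s)) => [/size0nil s0|sn].
  rewrite s0 big_cons big_nil normr0 add0r /=.
  rewrite s0 /= in h2; apply: le_trans h2 _; rewrite !expr1.
  by apply: ler_wpM2r => //; rewrite ler_nat.
apply: le_trans (lerD H1 h2) _; rewrite -mulrDl; apply: ler_wpM2r => //.
have h3 : (2 * x) ^+ size s <= 2^-1.
  apply: le_trans (small _ _ sn) _ => //; first by rewrite -natrX ler_nat.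
  by have := xs; move: x => y; rewrite -[2 ^+ 20]natrX; lra.
have h4 : 8 ^+ (size s).+1 <= 16 ^+ (size s).+1 * 2^-1 :> R.
  rewrite ler_pdivlMr //; have -> : 16 = 8 * 2 :> R by rewrite -natrM.
  by rewrite exprMn ler_wpM2l ?exprn_ge0 // exprS ler_peMr // exprn_ege1 // ler1n.
have e0 : 0 <= 16 ^+ (size s).+1 :> R by rewrite exprn_ge0.
have := ler_wpM2l e0 h3; lra.
Qed.

Section Difference.
Variables (n : nat) (eta : R) (d1 d2 : seq T -> R).
Hypotheses (eta0 : 0 <= eta) (Hd1 : majorized n 1 d1) (Hd2 : majorized n 1 d2)
  (Hd : majorized n eta (fun s => d1 s - d2 s)).

(** The difference of the products is telescoped into two terms. The factor [(0 < size s)%:R]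
    records that the tail vanishes on a single label; without it that case would come with no power
    of [x] to make it small. *)
Lemma tail_sum_diff a s : (size s <= n)%N ->
  (forall s', (size s' <= size s)%N ->
    `|conv_exp d1 s' - conv_exp d2 s'| <= eta * 32 ^+ size s' * K (size s') * W s') ->
  `|(conv_exp d1 (a :: s) - d1 (a :: s)) - (conv_exp d2 (a :: s) - d2 (a :: s))| <=
    eta * 64 * (64 * x) ^+ size s * (0 < size s)%:R * K (size s).+1 * W (a :: s).
Proof.
move=> Hn IH; rewrite !exp_tail_cons -sumrB.
case: (posnP (size s)) => [/size0nil ->|sn].
  by rewrite big_cons big_nil normr0 mulr0 !mul0r.
rewrite mulr1.
have -> : eta * 64 * (64 * x) ^+ size s = eta * 2 * 32 ^+ (size s).+1 * (2 * x) ^+ size s.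
  have -> : 64 * x = 32 * (2 * x) by ring.
  by rewrite [(32 * _) ^+ _]exprMn (exprS 32); ring.
apply: split_sum => [|p Hp p1]; first by rewrite !mulr_ge0 // exprn_ge0.
have Hsz := size_splits_mem Hp.
have p10 : (0 < size p.1)%N by rewrite lt0n size_eq0.
have s1 : (size p.1 <= size s)%N by rewrite -Hsz leq_addr.
have s2 : (size p.1 <= n)%N by exact: leq_trans s1 Hn.
have s3 : (size (a :: p.2) <= n)%N by apply: leq_trans Hn; rewrite /= -Hsz -add1n leq_add2r.
have -> : conv_exp d1 p.1 * d1 (a :: p.2) - conv_exp d2 p.1 * d2 (a :: p.2) =
  (conv_exp d1 p.1 - conv_exp d2 p.1) * d1 (a :: p.2) +
  conv_exp d2 p.1 * (d1 (a :: p.2) - d2 (a :: p.2)) by ring.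
apply: le_trans (ler_normD _ _) _; rewrite !normrM.
have h1 := IH _ s1; have h2 := conv_exp_bound Hd2 s2.
have h3 := Hd1 (s := a :: p.2) isT s3; have h4 := Hd (s := a :: p.2) isT s3.
apply: le_trans (lerD (ler_pM _ _ h1 h3) (ler_pM _ _ h2 h4)) _ => //=.
have [kk ww] : 0 <= K (size p.1) * K (size p.2).+1 /\ 0 <= W p.1 * W (a :: p.2).
  by split; apply: mulr_ge0.
move: kk ww; move: (K (size p.1)) (K (size p.2).+1) (W p.1) (W (a :: p.2)) => k1 k2 w1 w2 kk ww.
have -> : eta * 32 ^+ size p.1 * k1 * w1 * (1 * 8 ^+ (size p.2).+1 * k2 * w2) +
   16 ^+ size p.1 * k1 * w1 * (eta * 8 ^+ (size p.2).+1 * k2 * w2) =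
   eta * (32 ^+ size p.1 * 8 ^+ (size p.2).+1 + 16 ^+ size p.1 * 8 ^+ (size p.2).+1) *
   (k1 * k2) * (w1 * w2) by ring.
do 2![apply: ler_wpM2r => //]; rewrite -mulrA; apply: ler_wpM2l => //.
rewrite mulr_natl mulr2n.
by apply: lerD; apply: pow_le; rewrite ?ler_nat // addnS Hsz.
Qed.

Lemma conv_exp_diff s : (size s <= n)%N ->
  `|conv_exp d1 s - conv_exp d2 s| <= eta * 32 ^+ size s * K (size s) * W s.
Proof.
have [l] := ubnP (size s); elim: l s => // l IH [|a s] /ltnSE Hl Hn.
  by rewrite !conv_exp0 subrr normr0 !mulr_ge0 // exprn_ge0.
have IH' s' : (size s' <= size s)%N ->
    `|conv_exp d1 s' - conv_exp d2 s'| <= eta * 32 ^+ size s' * K (size s') * W s'.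
  by move=> Hs'; apply: IH; [apply: leq_ltn_trans Hs' Hl|apply: leq_trans Hs' (ltnW Hn)].
have H1 := tail_sum_diff a (ltnW Hn) IH'.
have H2 := Hd (s := a :: s) isT Hn.
have -> : conv_exp d1 (a :: s) - conv_exp d2 (a :: s) =
  ((conv_exp d1 (a :: s) - d1 (a :: s)) - (conv_exp d2 (a :: s) - d2 (a :: s)))
   + (d1 (a :: s) - d2 (a :: s)) by ring.
apply: le_trans (ler_normD _ _) _; apply: le_trans (lerD H1 H2) _.
rewrite -!mulrDl; do 2![apply: ler_wpM2r => //].
rewrite -!mulrA -mulrDr; apply: ler_wpM2l => //.
have h1 : 64 * ((64 * x) ^+ size s * (0 < size s)%:R) <= 1.
  case: (posnP (size s)) => [_|sn]; first by rewrite !mulr0 ler01.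
  rewrite mulr1; apply: le_trans (ler_wpM2l _ (small _ _ sn)) _ => //; first by rewrite -natrX ler_nat.
  by have := xs; move: x => y; rewrite -[2 ^+ 20]natrX; lra.
have h2 : 8 ^+ size (a :: s) + 1 <= 32 ^+ size (a :: s) :> R.
  have -> : 32 = 8 * 4 :> R by rewrite -natrM.
  rewrite exprMn; set e := 8 ^+ _; have e1 : 1 <= e by rewrite exprn_ege1 // ler1n.
  have : 4 <= 4 ^+ size (a :: s) :> R by rewrite /= exprS ler_peMr // exprn_ege1 // ler1n.
  by move: (4 ^+ _) => f; nra.
by lra.
Qed.

(** The factor [4 * (size s).+1] is the cost of the later summation over pairs in
    [interaction_diff]; it is paid in advance out of the powers of [x]. *)
Lemma exp_tail_diff a s : (size s <= n)%N ->
  `|(conv_exp d1 (a :: s) - d1 (a :: s)) - (conv_exp d2 (a :: s) - d2 (a :: s))|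
     * (4 * (size s).+1%:R) <= eta / 32 * K (size s).+1 * W (a :: s).
Proof.
move=> Hn; have := tail_sum_diff a Hn (fun s' Hs' => conv_exp_diff (leq_trans Hs' Hn)).
set t := `|_| => Ht; have n0 : 0 <= 4 * (size s).+1%:R :> R by apply: mulr_ge0.
apply: le_trans (ler_wpM2r n0 Ht) _.
move: (K0 (size s).+1) (W0 (a :: s)); set k := K _; set w := W _; move: k w => k w k0 w0.
have -> : eta * 64 * (64 * x) ^+ size s * (0 < size s)%:R * k * w * (4 * (size s).+1%:R) =
  eta * (64 * ((64 * x) ^+ size s * (4 * (size s).+1%:R)) * (0 < size s)%:R) * k * w by ring.
do 2![apply: ler_wpM2r => //]; apply: ler_wpM2l => //.
case: (posnP (size s)) => [_|sn]; first by rewrite mulr0 invr_ge0.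
have h1 : 4 * (size s).+1%:R <= 8 ^+ size s :> R.
  rewrite -natrM -natrX ler_nat; case: (size s) sn => // l _; clear.
  elim: l => // l; rewrite [(8 ^ l.+2)%N]expnS; move: (8 ^ l.+1)%N => y; lia.
rewrite mulr1; apply: le_trans (ler_wpM2l _ (ler_wpM2l _ h1)) _ => //.
  by rewrite exprn_ge0 // mulr_ge0.
rewrite -exprMn (_ : 64 * x * 8 = 512 * x); last by ring.
apply: le_trans (ler_wpM2l _ (small _ _ sn)) _ => //; first by rewrite -natrX ler_nat.
by have := xs; move: x => y; rewrite -[2 ^+ 20]natrX; lra.
Qed.

End Difference.

End TailBound.

(** * Collision coefficients and expansions for a pair that meets the sequence *)

Section KacCoef.
Variables (R : realType) (N : nat).
Implicit Types (i j : 'I_N) (s : seq 'I_N).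
Local Notation A i j s := (kac_coef R i j s).

Lemma cos2_01 (t : R) : 0 <= cos t ^+ 2 <= 1.
Proof. by rewrite sqr_ge0 cos2sin2 gerBl sqr_ge0. Qed.

Lemma sin2_01 (t : R) : 0 <= sin t ^+ 2 <= 1.
Proof. by rewrite sqr_ge0 sin2cos2 gerBl sqr_ge0. Qed.

Lemma kac_coef01 i j s : 0 <= A i j s <= 1.
Proof.
have cc := @continuous_collision_coef R N i j s.
have c1 (c : R) : continuous (fun _ : R => c) by move=> x; exact: cvg_cst.
apply/andP; split.
  rewrite -[leLHS]angle_avg_cst; apply: le_angle_avg => // t.
  by have /andP[] := collision_coef01 i j (cos2_01 t) (sin2_01 t) s.
rewrite -[leRHS]angle_avg_cst; apply: le_angle_avg => // t.
by have /andP[] := collision_coef01 i j (cos2_01 t) (sin2_01 t) s.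
Qed.

Definition one_of i j s := (i \in s) (+) (j \in s).

(** The function [g] is [cos ^ 2] or [sin ^ 2], according to which of the two labels occurs; the
    bounds below use only the range and the first two means, which agree. *)
Lemma kac_coef_one i j s : one_of i j s ->
  exists2 g : R -> R, (forall t, 0 <= g t <= 1) /\ continuous g &
    [/\ angle_avg g = 2^-1, angle_avg (fun t => g t ^+ 2) = 3 / 8 &
     A i j s = angle_avg (fun t => g t ^+ (count_mem i s + count_mem j s))].
Proof.
rewrite /one_of /kac_coef /collision_coef.
case: (boolP (i \in s)) => is_; case: (boolP (j \in s)) => js //= _.
- exists (fun t => cos t ^+ 2); first by split; [exact: cos2_01|exact: continuous_cosX].
  split; [exact: angle_avg_cos2| |].
    by rewrite -angle_avg_cos4; congr angle_avg; apply/funext => t; rewrite -exprM.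
  by rewrite (count_memPn js) addn0; congr angle_avg; apply/funext => t; rewrite expr0 mulr1.
- exists (fun t => sin t ^+ 2).
    by split; [exact: sin2_01|apply: continuous_pow; exact: continuous_sin].
  split; [exact: angle_avg_sin2| |].
    by rewrite -angle_avg_sin4; congr angle_avg; apply/funext => t; rewrite -exprM.
  by rewrite (count_memPn is_) add0n; congr angle_avg; apply/funext => t; rewrite expr0 mul1r.
Qed.

Let count_one i j s : one_of i j s -> (0 < count_mem i s + count_mem j s)%N.
Proof.
rewrite /one_of -!has_pred1 !has_count.
by case: (count_mem i s); case: (count_mem j s).
Qed.

Lemma kac_coef_le_half i j s : one_of i j s -> A i j s <= 2^-1.
Proof.
move=> H; have := count_one H; have [g [g01 cg] [<- _ ->]] := kac_coef_one H.
move=> c0; apply: le_angle_avg => //; first exact: continuous_pow.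
move=> t; have /andP[g0 g1] := g01 t.
by rewrite -[leRHS]expr1; apply: ler_wiXn2l.
Qed.

Lemma kac_coef_le38 i j s : one_of i j s -> (1 < count_mem i s + count_mem j s)%N ->
  A i j s <= 3 / 8.
Proof.
move=> H c1; have [g [g01 cg] [_ <- ->]] := kac_coef_one H.
apply: le_angle_avg; [exact: continuous_pow|exact: continuous_pow|].
by move=> t; have /andP[g0 g1] := g01 t; apply: ler_wiXn2l.
Qed.

Lemma kac_coef_half i j s : one_of i j s -> (count_mem i s + count_mem j s)%N = 1%N ->
  A i j s = 2^-1.
Proof.
by move=> H c1; have [g _ [<- _ ->]] := kac_coef_one H; rewrite c1.
Qed.

End KacCoef.

Section ExpandSwap.
Variables (T : eqType) (i j : T).
Hypothesis ij : i != j.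
Implicit Types s : seq T.

Definition swap_label (a : T) := if a == i then j else if a == j then i else a.

Local Notation sw s := (map swap_label s).

Lemma expand_id s : s \in expand i j s.
Proof.
elim: s => //= a s IH; case: ifP => [|_]; last by rewrite map_f.
by rewrite mem_cat => /orP[]/eqP ->; rewrite map_f ?orbT.
Qed.

Lemma expand_swap s : sw s \in expand i j s.
Proof.
elim: s => //= a s IH; rewrite /swap_label; case: eqVneq => [_|ai] /=.
  by rewrite mem_cat [X in _ || X]map_f ?orbT.
by case: eqVneq => [_|aj] /=; rewrite ?mem_cat map_f.
Qed.

Lemma expand_uniq s : uniq (expand i j s).
Proof.
elim: s => //= a s IH; have inj b : injective (@cons T b) by move=> ? ? [].
case: ifP => _; rewrite ?cat_uniq !map_inj_uniq ?IH //= andbT.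
apply/hasPn => _ /mapP[t _ ->]; apply/negP => /mapP[t' _ [E]].
by move: ij; rewrite E eqxx.
Qed.

Lemma size_expandE s : size (expand i j s) = (2 ^ (count_mem i s + count_mem j s))%N.
Proof.
elim: s => //= a s IH; case: (eqVneq a i) => [->|ai] /=.
  by rewrite (negbTE ij) size_cat !size_map IH add0n -addnA add1n expnS mul2n addnn.
case: (eqVneq a j) => [_|aj] /=; last by rewrite size_map IH.
by rewrite size_cat !size_map IH add0n add1n addnS expnS mul2n addnn.
Qed.

(** Only [s] itself and its relabelling keep the number of distinct labels; the terms that contain
    both [i] and [j] have one label more and so gain a factor [q]. *)
Lemma expand_cases s s' : s' \in expand i j s -> (i \in s) (+) (j \in s) ->
  [\/ s' = s, s' = sw s | (i \in s') && (j \in s')].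
Proof.
move=> Hs'.
have P1 : i \notin s -> i \notin s' -> s' = s.
  elim: s s' Hs' => [|a s IH] s' /=; first by rewrite inE => /eqP.
  have [->|ai] := eqVneq a i; first by rewrite mem_head.
  have [->|aj] := eqVneq a j => /=.
    rewrite mem_cat => /orP[]/mapP[t Ht ->]; rewrite !inE ?eqxx //= => /norP[_ h1] /norP[_ h2].
    by rewrite (IH t).
  by move=> /mapP[t Ht ->]; rewrite !inE => /norP[_ h1] /norP[_ h2]; rewrite (IH t).
have P2 : j \notin s -> j \notin s' -> s' = s.
  elim: s s' Hs' {P1} => [|a s IH] s' /=; first by rewrite inE => /eqP.
  have [->|ai] := eqVneq a i => /=.
    rewrite mem_cat => /orP[]/mapP[t Ht ->]; rewrite !inE ?eqxx //= => /norP[_ h1] /norP[_ h2].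
    by rewrite (IH t).
  have [->|aj] := eqVneq a j; first by rewrite mem_head.
  by move=> /mapP[t Ht ->]; rewrite !inE => /norP[_ h1] /norP[_ h2]; rewrite (IH t).
have P3 : j \notin s -> i \notin s' -> s' = sw s.
  elim: s s' Hs' {P1 P2} => [|a s IH] s' /=; first by rewrite inE => /eqP.
  rewrite /swap_label; have [->|ai] := eqVneq a i => /=.
    rewrite mem_cat => /orP[]/mapP[t Ht ->]; rewrite !inE ?eqxx //= => /norP[_ h1] /norP[_ h2].
    by rewrite (IH t).
  have [->|aj] := eqVneq a j; first by rewrite mem_head.
  by move=> /mapP[t Ht ->]; rewrite !inE => /norP[_ h1] /norP[_ h2]; rewrite (IH t).
have P4 : i \notin s -> j \notin s' -> s' = sw s.
  elim: s s' Hs' {P1 P2 P3} => [|a s IH] s' /=; first by rewrite inE => /eqP.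
  rewrite /swap_label; have [->|ai] := eqVneq a i => /=; first by rewrite mem_head.
  have [->|aj] := eqVneq a j => /=.
    rewrite mem_cat => /orP[]/mapP[t Ht ->]; rewrite !inE ?eqxx //= => /norP[_ h1] /norP[_ h2].
    by rewrite (IH t).
  by move=> /mapP[t Ht ->]; rewrite !inE => /norP[_ h1] /norP[_ h2]; rewrite (IH t).
case: (boolP (i \in s')) => is'; case: (boolP (j \in s')) => js' /=.
- by constructor 3.
- case: (boolP (i \in s)) => is_; case: (boolP (j \in s)) => js //= _.
    by constructor 1; apply: P2.
  by constructor 2; apply: P4.
- case: (boolP (i \in s)) => is_; case: (boolP (j \in s)) => js //= _.
    by constructor 2; apply: P3.
  by constructor 1; apply: P1.
- case: (boolP (i \in s)) => is_; case: (boolP (j \in s)) => js //= _.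
    by constructor 1; apply: P2.
  by constructor 1; apply: P1.
Qed.

Lemma sum_expand_one (R : zmodType) (x : seq T -> R) s : (i \in s) (+) (j \in s) ->
  exists2 rest, (forall s', s' \in rest -> s' \in expand i j s /\ (i \in s') && (j \in s')) &
    (size rest).+2 = (2 ^ (count_mem i s + count_mem j s))%N /\
    \sum_(s' <- expand i j s) x s' = x s + x (sw s) + \sum_(s' <- rest) x s'.
Proof.
move=> H; have us := expand_uniq s.
have ssw : sw s != s.
  apply/eqP => E.
  have Hi : (i \in sw s) = (j \in s).
    elim: (s) => //= a t IH; rewrite !inE IH /swap_label.
    case: (eqVneq a i) => [->|ai]; first by rewrite (negbTE ij) (eq_sym j) (negbTE ij).
    by case: (eqVneq a j) => [_|aj]; rewrite ?eqxx // (eq_sym i) (negbTE ai).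
  by move: H; rewrite -Hi E addbb.
exists (rem (sw s) (rem s (expand i j s))).
  move=> s'; rewrite mem_rem_uniq ?rem_uniq // inE mem_rem_uniq // inE.
  move=> /andP[h1 /andP[h2 h3]]; split=> //.
  by case: (expand_cases h3 H) => [E|E|//]; rewrite E eqxx in h1 h2.
have h1 : sw s \in rem s (expand i j s) by rewrite mem_rem_uniq // inE ssw expand_swap.
split.
  rewrite !size_rem // ?expand_id // size_expandE.
  have : (1 < 2 ^ (count_mem i s + count_mem j s))%N; last by case: (2 ^ _)%N => [|[|]].
  rewrite -{1}(expn0 2) ltn_exp2l //; move: H.
  by rewrite -!has_pred1 !has_count; case: (count_mem i s); case: (count_mem j s).
by rewrite (big_rem s) ?expand_id //= (big_rem (sw s)) //= addrA.
Qed.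

End ExpandSwap.

Section PairSums.
Variables (R : realType) (N : nat) (s : seq 'I_N).
Implicit Types i j : 'I_N.
Local Notation L := (distinct s).
Local Notation ind i := ((i \in s)%:R : R).

Lemma sum_indicator : \sum_(i < N) ind i = L%:R.
Proof.
rewrite -natr_sum; congr (_%:R); rewrite /distinct -(card_uniqP (undup_uniq s)).
by rewrite -sum1_card [RHS]big_mkcond; apply: eq_bigr => i _; rewrite mem_undup; case: (i \in s).
Qed.

(** Each label of [s] has [N - 1] partners on either side, whereas at most [L ^ 2] ordered pairs lie
    inside [s]; the second kind can therefore carry a coefficient [c] of order [1 / q]. *)
Lemma sum_pairs_le (b c : R) : 0 <= b -> 0 <= c ->
  \sum_(i < N) \sum_(j < N | i != j) (b * (ind i + ind j) + c * (ind i * ind j)) <=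
  2 * b * L%:R * (N%:R - 1) + c * L%:R ^+ 2.
Proof.
move=> b0 c0.
have card_ne i : \sum_(j < N | i != j) (1 : R) = N%:R - 1.
  have := @sumr_const R 'I_N predT 1; rewrite card_ord -[RHS]/(N%:R) => <-.
  by rewrite [in RHS](bigD1 i) //= addrAC subrr add0r; apply: eq_bigl => j; rewrite eq_sym.
have -> : \sum_(i < N) \sum_(j < N | i != j) (b * (ind i + ind j) + c * (ind i * ind j)) =
  b * (\sum_(i < N) \sum_(j < N | i != j) ind i + \sum_(i < N) \sum_(j < N | i != j) ind j)
  + c * \sum_(i < N) \sum_(j < N | i != j) ind i * ind j.
  rewrite -big_split !mulr_sumr -big_split; apply: eq_bigr => i _ /=.
  by rewrite -big_split !mulr_sumr -big_split.
have E1 : \sum_(i < N) \sum_(j < N | i != j) ind i = L%:R * (N%:R - 1).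
  rewrite -sum_indicator mulr_suml; apply: eq_bigr => i _.
  by rewrite -(card_ne i) mulr_sumr; apply: eq_bigr => j _; rewrite mulr1.
have E2 : \sum_(i < N) \sum_(j < N | i != j) ind j = L%:R * (N%:R - 1).
  rewrite -E1 (exchange_big_dep xpredT) //=; apply: eq_bigr => i _; apply: eq_bigl => j.
  by rewrite eq_sym.
rewrite E1 E2; have -> : b * (L%:R * (N%:R - 1) + L%:R * (N%:R - 1)) = 2 * b * L%:R * (N%:R - 1) by ring.
rewrite lerD2l; apply: ler_wpM2l => //.
rewrite expr2 -{1}sum_indicator mulr_suml; apply: ler_sum => i _.
rewrite -mulr_sumr; apply: ler_wpM2l => //.
rewrite -sum_indicator [leRHS](bigID (fun j => i != j)) /= lerDl.
by apply: sumr_ge0.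
Qed.

End PairSums.

(** * The interaction as a Lipschitz perturbation *)

Section InteractionBound.
Variables (R : realType) (N : nat) (q C P eta : R) (n : nat) (k1 k2 : seq 'I_N -> R).
Hypotheses (N2 : (1 < N)%N) (q01 : 0 < q <= 1) (C1 : 2 ^+ 10 <= C) (P1 : 1 <= P) (eta0 : 0 <= eta).
Local Notation K := (majorant C P).
Hypothesis Hk1 : forall s, s != [::] -> (size s <= n)%N -> `|k1 s| <= 2 * K (size s) * q ^+ (distinct s).-1.
Hypothesis Hk2 : forall s, s != [::] -> (size s <= n)%N -> `|k2 s| <= 2 * K (size s) * q ^+ (distinct s).-1.
Hypothesis Hk : forall s, s != [::] -> (size s <= n)%N ->
  `|k1 s - k2 s| <= eta * K (size s) * q ^+ (distinct s).-1.
Hypothesis Hq : n.+1%:R <= q * (N%:R - 1).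

Let K0 m : 0 <= K m.
Proof. by rewrite ltW // majorant_gt0 // (le_trans _ C1) // -natrX ler1n. Qed.

Let excess_majorized (k : seq 'I_N -> R) (c M : R) i j theta : i != j -> 0 <= c ->
  (forall m, (0 < m)%N -> (2 ^+ m + 1) * c <= M * 8 ^+ m) ->
  (forall s, s != [::] -> (size s <= n)%N -> `|k s| <= c * K (size s) * q ^+ (distinct s).-1) ->
  majorized i j q C P n M (excess i j k theta).
Proof.
move=> ij c0 cM Hs s s0 sn; have K0s := K0 (size s).
have H : forall s', size s' = size s -> `|k s'| <= c * K (size s) * q ^+ (distinct s').-1.
  move=> s' Es; rewrite -Es; apply: Hs; last by rewrite Es.
  by rewrite -size_eq0 Es size_eq0.
apply: le_trans (normr_excess ij q01 (cos2_01 theta) (sin2_01 theta) s0 _ H) _; first exact: mulr_ge0.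
apply: ler_wpM2r; first exact: weight_ge0.
by rewrite mulrA; apply: ler_wpM2r => //; apply: cM; rewrite lt0n size_eq0.
Qed.

Let pow_bound (c M : R) m : 0 <= M -> c <= 2 * M -> (0 < m)%N -> (2 ^+ m + 1) * c <= M * 8 ^+ m.
Proof.
move=> M0 cM; case: m => // m _.
have -> : 8 = 2 * 4 :> R by rewrite -natrM.
rewrite exprMn; have : 1 <= 2 ^+ m.+1 :> R by rewrite exprn_ege1 // ler1n.
have : 4 <= 4 ^+ m.+1 :> R by rewrite exprS ler_peMr // exprn_ege1 // ler1n.
move: (2 ^+ m.+1) (4 ^+ m.+1) => a b hb ha.
have h1 : (a + 1) * c <= (a + 1) * (2 * M) by apply: ler_wpM2l => //; lra.
have h2 : a * 4 * M <= a * b * M by apply: ler_wpM2r => //; apply: ler_wpM2l => //; lra.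
have h3 : (a + 1) * (2 * M) <= a * 4 * M by nra.
by lra.
Qed.

(** Each pair contributes its [weight]. Relative to [q ^ (L - 1)] the pairs add up to at most
    [2 * L * (N - 1) + L ^ 2 / q], and [Hq] bounds this by [4 * n.+1 * (N - 1)]. The prefactor of
    the generator cancels [N - 1], and [exp_tail_diff] has provided for the rest. *)
Lemma interaction_diff s : size s = n.+1 ->
  `|interaction k1 s - interaction k2 s| <= eta / 32 * K n.+1 * q ^+ (distinct s).-1.
Proof.
case: s => // a s [Hs]; have q0 : 0 < q by case/andP: q01.
have q1 : q <= 1 by case/andP: q01.
have N1 : 0 < N%:R - 1 :> R by rewrite subr_gt0 ltr1n.
set X := eta / 32 * K n.+1.
have X0 : 0 <= X by rewrite mulr_ge0 // divr_ge0.
have Hpair i j : i != j ->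
  `|angle_avg (fun theta => exp_tail (excess i j k1 theta) (a :: s)) -
    angle_avg (fun theta => exp_tail (excess i j k2 theta) (a :: s))| * (4 * n.+1%:R) <=
   X * weight i j q (a :: s).
  move=> ij.
  have ct k : continuous (fun theta => exp_tail (excess i j k theta) (a :: s)).
    move=> x; apply: cvgB; last exact: continuous_excess.
    by apply: continuous_conv_exp => s'; exact: continuous_excess.
  have cN k : continuous (fun theta => -1 * exp_tail (excess i j k theta) (a :: s)).
    by move=> x; apply: cvgM; [exact: cvg_cst|exact: ct].
  rewrite -mulN1r -angle_avgZ // -angle_avgD //.
  rewrite -ler_pdivlMr ?mulr_gt0 // ?ltr0n //; apply: normr_angle_avg.
    by move=> x; apply: cvgD; [exact: ct|exact: cN].
  move=> theta; rewrite mulN1r ler_pdivlMr ?mulr_gt0 // ?ltr0n //.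
  have M1 : majorized i j q C P n 1 (excess i j k1 theta).
    by apply: excess_majorized Hk1 => // m; apply: pow_bound; rewrite ?mulr1.
  have M2 : majorized i j q C P n 1 (excess i j k2 theta).
    by apply: excess_majorized Hk2 => // m; apply: pow_bound; rewrite ?mulr1.
  have M3 : majorized i j q C P n eta (fun s => excess i j k1 theta s - excess i j k2 theta s).
    rewrite (_ : (fun s => _) = excess i j (fun s => k1 s - k2 s) theta).
      apply: excess_majorized Hk => // m m0; apply: pow_bound => //.
      by rewrite mulr_natl mulr2n lerDl.
    apply/funext => t; rewrite /excess /collide sumrB; ring.
  have := exp_tail_diff q01 C1 P1 eta0 M1 M2 M3 a; rewrite -Hs => /(_ s (leqnn _)).
  by rewrite /exp_tail Hs.
have Lle : (distinct (a :: s) <= n.+1)%N by rewrite -Hs; exact: size_undup.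
have L0 : (0 < distinct (a :: s))%N by exact: distinct_gt0.
set L := distinct (a :: s) in Lle L0 *.
(* The weight ignores both labels of the pair: if one of them occurs the exponent is [L - 1], if
   both do it is [L - 2], hence the division by [q]. *)
have Wle i j : i != j -> weight i j q (a :: s) <=
    q ^+ L.-1 * ((i \in a :: s)%:R + (j \in a :: s)%:R) + q ^+ L.-1 / q * ((i \in a :: s)%:R * (j \in a :: s)%:R).
  move=> ij; rewrite /weight /touches (_ : (_ == [::]) = false) //.
  have := distinct_others ij (a :: s); rewrite -/L; move: (distinct (others i j (a :: s))) => d EL.
  have e0 m : 0 <= q ^+ m by rewrite exprn_ge0 // ltW.
  case: (boolP (i \in a :: s)) EL => is_; case: (boolP (j \in a :: s)) => js /= EL.
  - rewrite mulr1 EL !addn1 /= mulr1 exprSr mulfK ?gt_eqF //.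
    have := e0 d; have := mulr_ge0 (e0 d) (ltW q0); lra.
  - by rewrite EL ?addn0 ?addn1 /= ?(mulr0, mul0r, addr0, add0r, mulr1).
  - by rewrite EL ?addn0 ?addn1 /= ?(mulr0, mul0r, addr0, add0r, mulr1).
  - by rewrite ?(mulr0, mul0r, addr0, add0r, mulr1).
have N1V : 0 <= (N%:R - 1)^-1 :> R by rewrite invr_ge0 ltW.
rewrite /interaction -mulrBr normrM (ger0_norm N1V) ler_pdivrMl //.
rewrite -sumrB.
apply: (@le_trans _ _ (\sum_(i < N) \sum_(j < N | i != j) X / (4 * n.+1%:R) * weight i j q (a :: s))).
  apply: le_trans (ler_norm_sum _ _ _) _; apply: ler_sum => i _; rewrite -sumrB.
  apply: le_trans (ler_norm_sum _ _ _) _; apply: ler_sum => j ij.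
  rewrite mulrAC ler_pdivlMr ?mulr_gt0 // ?ltr0n //; exact: Hpair.
have W2 : \sum_(i < N) \sum_(j < N | i != j) weight i j q (a :: s) <=
    2 * q ^+ L.-1 * L%:R * (N%:R - 1) + q ^+ L.-1 / q * L%:R ^+ 2.
  have e0 : 0 <= q ^+ L.-1 by rewrite exprn_ge0 // ltW.
  have e1 : 0 <= q ^+ L.-1 / q by rewrite divr_ge0 // ltW.
  apply: le_trans (sum_pairs_le (a :: s) e0 e1).
  by apply: ler_sum => i _; apply: ler_sum => j ij; exact: Wle.
have -> : \sum_(i < N) \sum_(j < N | i != j) X / (4 * n.+1%:R) * weight i j q (a :: s) =
   X / (4 * n.+1%:R) * \sum_(i < N) \sum_(j < N | i != j) weight i j q (a :: s).
  by rewrite mulr_sumr; apply: eq_bigr => i _; rewrite mulr_sumr.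
move: W2; set S := \sum_(i < N) _ => W2.
have -> : X / (4 * n.+1%:R) * S = X * (S / (4 * n.+1%:R)) by ring.
have -> : (N%:R - 1) * (X * q ^+ L.-1) = X * ((N%:R - 1) * q ^+ L.-1) by ring.
apply: ler_wpM2l => //; rewrite ler_pdivrMr ?mulr_gt0 // ?ltr0n //.
apply: le_trans W2 _.
have e0 : 0 <= q ^+ L.-1 by rewrite exprn_ge0 // ltW.
have LR : L%:R <= n.+1%:R :> R by rewrite ler_nat.
have L0R : 0 <= L%:R :> R by [].
have H1 : L%:R ^+ 2 / q <= n.+1%:R * (N%:R - 1).
  rewrite ler_pdivrMr // expr2 -mulrA; apply: ler_pM => //.
  by rewrite mulrC; apply: le_trans Hq.
have H2 : L%:R * (N%:R - 1) <= n.+1%:R * (N%:R - 1) :> R by rewrite ler_pM2r.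
have -> : 2 * q ^+ L.-1 * L%:R * (N%:R - 1) + q ^+ L.-1 / q * L%:R ^+ 2 =
  q ^+ L.-1 * (2 * (L%:R * (N%:R - 1)) + L%:R ^+ 2 / q) by ring.
have -> : (N%:R - 1) * q ^+ L.-1 * (4 * n.+1%:R) = q ^+ L.-1 * (4 * (n.+1%:R * (N%:R - 1))) by ring.
apply: ler_wpM2l => //; have : 0 <= n.+1%:R * (N%:R - 1) :> R by rewrite mulr_ge0 // ltW.
by lra.
Qed.

End InteractionBound.

(** * The spectral gap of the linear part *)

Lemma count_mem_pair (T : eqType) (i j : T) (s : seq T) : i != j ->
  (count_mem i s + count_mem j s <= size s)%N.
Proof.
move=> ij; rewrite -count_predUI (_ : count (predI _ _) s = 0%N) ?addn0 ?count_size //.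
rewrite (@eq_count _ _ pred0) ?count_pred0 // => a /=.
by case: eqVneq => //= ->; rewrite (negbTE ij).
Qed.

Section LinearGap.
Variables (R : realType) (N : nat) (q : R) (s : seq 'I_N).
Local Notation n := (size s).
Local Notation L := (distinct s).
Local Notation A i j := (kac_coef R i j s).
Local Notation ind i := ((i \in s)%:R : R).
Implicit Types i j : 'I_N.
Hypotheses (N2 : (1 < N)%N) (q01 : 0 < q <= 1) (s0 : s != [::]).
Hypothesis hqa : 256 * (2 ^+ n * n%:R ^+ 2) * q <= 1.
Hypothesis hqb : 256 * (2 ^+ n * n%:R ^+ 2) <= q * (N%:R - 1).

Let q0 : 0 < q. Proof. by case/andP: q01. Qed.
Let q1 : q <= 1. Proof. by case/andP: q01. Qed.
Let N1 : 0 < N%:R - 1 :> R. Proof. by rewrite subr_gt0 ltr1n. Qed.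
Let qX m : 0 <= q ^+ m. Proof. by rewrite exprn_ge0 // ltW. Qed.
Let t1 : 1 <= 2 ^+ n :> R. Proof. by rewrite exprn_ege1 // ler1n. Qed.
Let n1 : 1 <= n%:R :> R. Proof. by rewrite ler1n lt0n size_eq0. Qed.
Let LR : L%:R <= n%:R :> R. Proof. by rewrite ler_nat size_undup. Qed.
Let L0 : (0 < L)%N. Proof. exact: distinct_gt0. Qed.

Section Fixed.
Variables (x : seq 'I_N -> R) (S : R).
Hypotheses (S0 : 0 <= S)
  (Hx : forall s', size s' = n -> `|x s'| <= S * q ^+ (distinct s').-1).

Lemma expand_bound i j : i != j -> touches i j s ->
  `|\sum_(s' <- expand i j s) x s'| <= 2 ^+ n * (S * q ^+ distinct (others i j s)).
Proof.
move=> ij ts; apply: (normr_collide ij); first exact: mulr_ge0.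
move=> s' Hs'; have [H1 H2] := mem_expand_others Hs'.
apply: le_trans (Hx H2) _; apply: ler_wpM2l => //; apply: ler_wiXn2l => //; first exact: ltW.
rewrite (distinct_others ij s') H1; have : touches i j s' by rewrite (expand_touches ij Hs').
by rewrite /touches; case: (i \in s'); case: (j \in s') => //= _; rewrite ?addn0 !addn1 /=.
Qed.

Lemma rate_both i j : i != j -> i \in s -> j \in s ->
  `|(A i j * (\sum_(s' <- expand i j s) x s') - x s) + 1 * x s| <= 2 ^+ n / q * (S * q ^+ L.-1).
Proof.
move=> ij is_ js; rewrite mul1r subrK normrM.
have /andP[a0 a1] := kac_coef01 R i j s.
rewrite (ger0_norm a0); apply: le_trans (ler_piMl _ a1) _ => //.
have H := expand_bound ij (_ : touches i j s); apply: le_trans (H _) _; first by rewrite /touches is_.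
have -> : L.-1 = (distinct (others i j s)).+1 by rewrite (distinct_others ij s) is_ js !addn1.
rewrite exprS (_ : 2 ^+ n / q * (S * (q * q ^+ distinct (others i j s))) =
  2 ^+ n * (S * q ^+ distinct (others i j s)) * (q / q)); last by ring.
by rewrite divff ?mulr1 // gt_eqF.
Qed.

Lemma rate_one i j : i != j -> one_of i j s ->
  `|(A i j * (\sum_(s' <- expand i j s) x s') - x s) + (1 - A i j) * x s| <=
     A i j * (1 + 2 ^+ n * q) * (S * q ^+ L.-1).
Proof.
move=> ij H; have [rest Hr [szr ->]] := sum_expand_one ij x H.
have /andP[a0 a1] := kac_coef01 R i j s.
have EL : L = (distinct (others i j s)).+1.
  by rewrite (distinct_others ij s); move: H; rewrite /one_of; case: (i \in s); case: (j \in s) => //= _; rewrite ?addn0 addn1.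
have ts : touches i j s by move: H; rewrite /one_of /touches; case: (i \in s); case: (j \in s).
set sw := map _ s.
have sw_exp : sw \in expand i j s := expand_swap i j s.
have Hsw : `|x sw| <= S * q ^+ L.-1.
  have [h1 h2] := mem_expand_others sw_exp.
  apply: le_trans (Hx h2) _; apply: ler_wpM2l => //; apply: ler_wiXn2l => //; first exact: ltW.
  rewrite EL (distinct_others ij sw) h1; have : touches i j sw by rewrite (expand_touches ij sw_exp).
  by rewrite /touches; case: (i \in sw); case: (j \in sw) => //= _; rewrite ?addn0 !addn1 /=.
have Hrest : `|\sum_(s' <- rest) x s'| <= 2 ^+ n * q * (S * q ^+ L.-1).
  apply: le_trans (ler_norm_sum _ _ _) _.
  apply: (@le_trans _ _ (\sum_(s' <- rest) S * q ^+ L)).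
    rewrite big_seq [leRHS]big_seq; apply: ler_sum => s' /Hr [Hs' /andP[is' js']].
    have [h1 h2] := mem_expand_others Hs'.
    apply: le_trans (Hx h2) _; apply: ler_wpM2l => //; apply: ler_wiXn2l => //; first exact: ltW.
    by rewrite EL (distinct_others ij s') h1 is' js' !addn1.
  rewrite big_const_seq count_predT iter_addr addr0 -[leLHS]mulr_natl.
  have -> : 2 ^+ n * q * (S * q ^+ L.-1) = 2 ^+ n * (S * q ^+ L).
    by rewrite -{2}(prednK L0) exprS; ring.
  apply: ler_wpM2r; first exact: mulr_ge0.
  rewrite -natrX ler_nat; apply: leq_trans (leqW (leqnSn _)) _; rewrite szr leq_pexp2l //.
  exact: count_mem_pair.
have -> : A i j * (x s + x sw + \sum_(s' <- rest) x s') - x s + (1 - A i j) * x s =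
  A i j * (x sw + \sum_(s' <- rest) x s') by ring.
rewrite normrM (ger0_norm a0) -mulrA; apply: ler_wpM2l => //.
apply: le_trans (ler_normD _ _) _; rewrite mulrDl mul1r; exact: lerD.
Qed.

Lemma rate_none i j : ~~ touches i j s ->
  A i j * (\sum_(s' <- expand i j s) x s') - x s = 0.
Proof.
move=> ts; rewrite (expand_ntouch ts) big_seq1.
have /norP[is_ js] := ts; rewrite /kac_coef /collision_coef.
rewrite (count_memPn is_) (count_memPn js).
have -> : angle_avg (fun t : R => (cos t ^+ 2) ^+ 0 * (sin t ^+ 2) ^+ 0) = 1.
  by rewrite -[RHS]angle_avg_cst; congr angle_avg; apply/funext => t; rewrite !expr0 mulr1.
by rewrite mul1r subrr.
Qed.

End Fixed.

(** If the pair meets [s] in one label, [x s] occurs in its own expansion with coefficient [A i j],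
    which reduces the loss 1 to [1 - A i j]. If both labels are in [s], the whole expansion is
    treated as an error and the full loss is kept. *)
Definition decay i j : R :=
  if (i \in s) && (j \in s) then 1 else if one_of i j s then 1 - A i j else 0.

(** In [1 + 2 ^ n * q] the 1 is the relabelled sequence, of the same weight as [s], and the rest
    stands for the terms that contain both labels. *)
Definition coupling i j : R :=
  if (i \in s) && (j \in s) then 2 ^+ n / q
  else if one_of i j s then A i j * (1 + 2 ^+ n * q) else 0.

Lemma rate_pair x (S : R) i j : 0 <= S ->
  (forall s', size s' = n -> `|x s'| <= S * q ^+ (distinct s').-1) -> i != j ->
  `|(A i j * (\sum_(s' <- expand i j s) x s') - x s) + decay i j * x s| <=
     coupling i j * (S * q ^+ L.-1).
Proof.
move=> S0 Hx ij; rewrite /decay /coupling.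
case: ifP => [/andP[is_ js]|Hb]; first exact: rate_both.
case: ifP => Ho; first exact: rate_one.
rewrite rate_none ?mul0r ?addr0 ?normr0 //.
by move: Hb Ho; rewrite /one_of /touches; case: (i \in s); case: (j \in s).
Qed.

Section Repeated.
Variable a0 : 'I_N.
Hypothesis Ha0 : (1 < count_mem a0 s)%N.

Let a0s : a0 \in s. Proof. by rewrite -has_pred1 has_count ltnW. Qed.

(** For a pair that meets [s] once the balance is [1 - 2 * A i j] up to terms in [q]. It is
    non-negative because [A i j <= 1 / 2], and at least 1/4 when the label met is the repeated [a0],
    because then [A i j <= 3 / 8]. *)
Lemma decay_coupling i j : i != j ->
  4^-1 * ((i == a0)%:R * (1 - ind j) + (j == a0)%:R * (1 - ind i))
   - (2 ^+ n * q * (ind i + ind j) + 2 ^+ n / q * (ind i * ind j)) <= decay i j - coupling i j.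
Proof.
move=> ij; rewrite /decay /coupling.
have tq : 0 <= 2 ^+ n * q by rewrite mulr_ge0 ?exprn_ge0 // ltW.
have tq' : 0 <= 2 ^+ n / q by rewrite divr_ge0 ?exprn_ge0 // ltW.
have /andP[A0 A1] := kac_coef01 R i j s.
have gen : one_of i j s -> - (2 ^+ n * q) <= 1 - A i j - A i j * (1 + 2 ^+ n * q).
  move=> /(@kac_coef_le_half R) h.
  have : A i j * (2 ^+ n * q) <= 2^-1 * (2 ^+ n * q) by apply: ler_wpM2r.
  by move: (A i j) h => a h; lra.
have gen2 : one_of i j s -> (1 < count_mem i s + count_mem j s)%N ->
    4^-1 - (2 ^+ n * q) <= 1 - A i j - A i j * (1 + 2 ^+ n * q).
  move=> h1 h2; have h := kac_coef_le38 R h1 h2.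
  have : A i j * (2 ^+ n * q) <= 1 * (2 ^+ n * q) by apply: ler_wpM2r.
  by move: (A i j) h => a h; lra.
case: (boolP (i \in s)) => is_; case: (boolP (j \in s)) => js /=.
- rewrite !subrr !mulr0 addr0 mulr0 sub0r !mulr1; lra.
- have o : one_of i j s by rewrite /one_of is_ (negbTE js).
  rewrite o; have -> : (j == a0) = false by apply/eqP => E; rewrite E a0s in js.
  case: (eqVneq i a0) => [Ei|_] /=; last by have := gen o; lra.
  have c1 : (1 < count_mem i s + count_mem j s)%N by rewrite Ei ltn_addr.
  by have := gen2 o c1; lra.
- have o : one_of i j s by rewrite /one_of js (negbTE is_).
  rewrite o; have -> : (i == a0) = false by apply/eqP => E; rewrite E a0s in is_.
  case: (eqVneq j a0) => [Ej|_] /=; last by have := gen o; lra.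
  have c1 : (1 < count_mem i s + count_mem j s)%N by rewrite Ej ltn_addl.
  by have := gen2 o c1; lra.
- have -> : one_of i j s = false by rewrite /one_of (negbTE is_) (negbTE js).
  have -> : (j == a0) = false by apply/eqP => E; rewrite E a0s in js.
  have -> : (i == a0) = false by apply/eqP => E; rewrite E a0s in is_.
  by rewrite /=; lra.
Qed.

Lemma sum_first : \sum_(i < N) \sum_(j < N | i != j) (i == a0)%:R * (1 - ind j) = N%:R - L%:R :> R.
Proof.
rewrite (bigD1 a0) //= [X in _ + X]big1 ?addr0; last first.
  by move=> i /negbTE ->; rewrite big1 // => j _; rewrite mul0r.
have -> : N%:R = \sum_(j < N) 1 :> R by rewrite sumr_const card_ord.
rewrite -sum_indicator -sumrB [RHS](bigD1 a0) //= a0s subrr add0r.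
by apply: eq_big => [j|j _]; rewrite 1?eq_sym // eqxx mul1r.
Qed.

Lemma sum_second : \sum_(i < N) \sum_(j < N | i != j) (j == a0)%:R * (1 - ind i) = N%:R - L%:R :> R.
Proof.
rewrite -sum_first (exchange_big_dep xpredT) //=; apply: eq_bigr => i _.
by apply: eq_bigl => j; rewrite eq_sym.
Qed.

End Repeated.

(** The [2 * (N - L)] ordered pairs of [a0] with a label outside [s] contribute 1/4 each, almost
    [(N - 1) / 2] together. The errors cost at most [3 * (N - 1) / 256], and [L] is at most
    [(N - 1) / 256], so more than [3 / 8 * (N - 1)] remains. *)
Lemma gap_repeated a0 : (1 < count_mem a0 s)%N ->
  exists a : R, 3 / 8 <= a /\ forall x (S : R), 0 <= S ->
    (forall s', size s' = n -> `|x s'| <= S * q ^+ (distinct s').-1) ->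
    `|moment_rate x s + a * x s| <= (a - 3 / 8) * (S * q ^+ L.-1).
Proof.
move=> Ha0.
pose D := \sum_(i < N) \sum_(j < N | i != j) decay i j.
pose B := \sum_(i < N) \sum_(j < N | i != j) coupling i j.
have B0 : 0 <= B.
  apply: sumr_ge0 => i _; apply: sumr_ge0 => j _; rewrite /coupling.
  have /andP[A0 A1] := kac_coef01 R i j s.
  case: ifP => _; first by rewrite divr_ge0 ?exprn_ge0 // ltW.
  case: ifP => // _; rewrite mulr_ge0 // addr_ge0 // mulr_ge0 ?exprn_ge0 // ltW //.
have DB : 3 / 8 * (N%:R - 1) <= D - B.
  have tq : 0 <= 2 ^+ n * q by rewrite mulr_ge0 ?exprn_ge0 // ltW.
  have tq' : 0 <= 2 ^+ n / q by rewrite divr_ge0 ?exprn_ge0 // ltW.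
  have H1 := sum_pairs_le s tq tq'.
  have H2 : 4^-1 * (2 * (N%:R - L%:R)) - \sum_(i < N) \sum_(j < N | i != j)
     (2 ^+ n * q * (ind i + ind j) + 2 ^+ n / q * (ind i * ind j)) <= D - B.
    rewrite /D /B -sumrB mulr_natl [_ *+ 2]mulr2n -{1}(sum_first Ha0) -(sum_second Ha0) -big_split mulr_sumr -sumrB.
    apply: ler_sum => i _; rewrite -sumrB -big_split mulr_sumr -sumrB /=.
    by apply: ler_sum => j ij; exact: decay_coupling.
  apply: le_trans H2.
  have e1 : 2 ^+ n * n%:R * q <= 256^-1.
    have h := mulr_ge0 tq (le_trans ler01 n1); have : 2 ^+ n * q * n%:R * (n%:R - 1) >= 0 by rewrite mulr_ge0 ?subr_ge0.
    by move: hqa; rewrite expr2; lra.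
  have Ln : L%:R ^+ 2 <= n%:R ^+ 2 :> R by rewrite lerXn2r ?nnegrE.
  have e2 : 2 ^+ n / q * L%:R ^+ 2 <= (N%:R - 1) / 256.
    have -> : 2 ^+ n / q * L%:R ^+ 2 = (2 ^+ n * L%:R ^+ 2) / q by ring.
    have h : 2 ^+ n * L%:R ^+ 2 <= 2 ^+ n * n%:R ^+ 2 :> R by apply: ler_wpM2l => //; exact: le_trans t1.
    by move: hqb; rewrite ler_pdivrMr //; lra.
  have e3 : 2 * (2 ^+ n * q) * L%:R * (N%:R - 1) <= 2 * 256^-1 * (N%:R - 1).
    apply: ler_wpM2r; first exact: ltW.
    have : 2 ^+ n * q * L%:R <= 2 ^+ n * q * n%:R by apply: ler_wpM2l.
    by lra.
  have e4 : L%:R * 256 <= N%:R - 1 :> R.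
    apply: (@le_trans _ _ (q * (N%:R - 1))); last by rewrite ler_piMl // ltW.
    apply: le_trans hqb; have h2 : n%:R <= n%:R ^+ 2 :> R by rewrite expr2 ler_peMl // (le_trans ler01).
    have h3 : n%:R ^+ 2 <= 2 ^+ n * n%:R ^+ 2 :> R by rewrite ler_peMl // exprn_ge0.
    by have := LR; lra.
  have e5 : 1 <= L%:R :> R by rewrite ler1n.
  by lra.
exists (D / (N%:R - 1)); split; first by rewrite ler_pdivlMr //; lra.
move=> x S S0 Hx; rewrite /moment_rate.
have -> : forall Z, (N%:R - 1)^-1 * Z + D / (N%:R - 1) * x s = (N%:R - 1)^-1 * (Z + D * x s) by move=> Z; ring.
have N1V : 0 <= (N%:R - 1)^-1 :> R by rewrite invr_ge0 ltW.
rewrite normrM (ger0_norm N1V) ler_pdivrMl //.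
have W0 : 0 <= S * q ^+ L.-1 by rewrite mulr_ge0.
apply: (@le_trans _ _ (B * (S * q ^+ L.-1))).
  rewrite /D mulr_suml -big_split; apply: le_trans (ler_norm_sum _ _ _) _.
  rewrite /B mulr_suml; apply: ler_sum => i _ /=; rewrite mulr_suml -big_split.
  apply: le_trans (ler_norm_sum _ _ _) _; rewrite mulr_suml; apply: ler_sum => j ij.
  exact: rate_pair.
rewrite [leRHS]mulrA; apply: ler_wpM2r => //.
rewrite mulrBr mulrCA divff ?gt_eqF // mulr1; lra.
Qed.

Section Distinct.
Hypothesis us : uniq s.

Let Ln : L = n. Proof. by rewrite /distinct undup_id. Qed.

Lemma perm_rem_map i j : i \in s -> j \notin s ->
  perm_eq (map (swap_label i j) s) (j :: rem i s).
Proof.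
move=> is_ js; have Hp := perm_to_rem is_.
apply: perm_trans (perm_map _ Hp) _; rewrite /= {1}/swap_label eqxx perm_cons.
rewrite (_ : map _ _ = rem i s) //; apply: map_id_in => a.
rewrite mem_rem_uniq // inE /swap_label => /andP[/negbTE -> as_].
by case: eqVneq => // aj; rewrite -aj as_ in js.
Qed.

Lemma perm_rem_map' i j : j \in s -> i \notin s ->
  perm_eq (map (swap_label i j) s) (i :: rem j s).
Proof.
move=> js is_; have Hp := perm_to_rem js.
have ji : (j == i) = false by apply/eqP => E; rewrite -E js in is_.
apply: perm_trans (perm_map _ Hp) _; rewrite /= {1}/swap_label ji eqxx perm_cons.
rewrite (_ : map _ _ = rem j s) //; apply: map_id_in => a.
rewrite mem_rem_uniq // inE /swap_label => /andP[/negbTE -> as_].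
by case: eqVneq => // ai; rewrite -ai as_ in is_.
Qed.

Lemma rate_distinct x i j : sym_fun x -> i != j -> i \in s -> j \notin s ->
  A i j * (\sum_(s' <- expand i j s) x s') - x s = 2^-1 * (x (j :: rem i s) - x s) /\
  A j i * (\sum_(s' <- expand j i s) x s') - x s = 2^-1 * (x (j :: rem i s) - x s).
Proof.
move=> xsym ij is_ js.
have c1 : (count_mem i s + count_mem j s)%N = 1%N.
  by rewrite !count_uniq_mem // is_ (negbTE js).
have o1 : one_of i j s by rewrite /one_of is_ (negbTE js).
have o2 : one_of j i s by rewrite /one_of is_ (negbTE js).
split.
  have [rest _ [szr ->]] := sum_expand_one ij x o1.
  rewrite kac_coef_half // (xsym _ _ (perm_rem_map is_ js)).
  by move: szr; rewrite c1 => -[/size0nil ->]; rewrite big_nil; lra.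
have ji : j != i by rewrite eq_sym.
have [rest _ [szr ->]] := sum_expand_one ji x o2.
rewrite kac_coef_half 1?addnC // (xsym _ _ (perm_rem_map' is_ js)).
by move: szr; rewrite addnC c1 => -[/size0nil ->]; rewrite big_nil; lra.
Qed.

(** A collision of [i] in [s] with [j] outside only averages [x s] with its relabelling
    [x (j :: rem i s)]. The zero sum over all [j] converts these relabellings into minus the terms
    with [j] in [s]: the one with [j = i] is [x s], the others have a repeated label and are few.
    The diagonal coefficient becomes exactly [L * N / (N - 1)]. *)
Lemma gap_distinct : exists a : R, 3 / 8 <= a /\ forall x (S : R), 0 <= S ->
  sym_fun x -> (forall t, (size t).+1 = n -> \sum_(j < N) x (j :: t) = 0) ->
  (forall s', size s' = n -> `|x s'| <= S * q ^+ (distinct s').-1) ->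
  `|moment_rate x s + a * x s| <= (a - 3 / 8) * (S * q ^+ L.-1).
Proof.
exists (L%:R * N%:R / (N%:R - 1)).
have L1 : 1 <= L%:R :> R by rewrite ler1n.
have NR : 0 <= N%:R - 1 :> R by exact: ltW.
split.
  rewrite ler_pdivlMr //; have : 1 * (N%:R : R) <= L%:R * N%:R by apply: ler_wpM2r.
  by lra.
move=> x S S0 xsym xsum Hx.
pose Y i j := x (j :: rem i s).
pose X i j := A i j * (\sum_(s' <- expand i j s) x s').
have EP i j : i != j -> X i j - x s =
    (ind i * (1 - ind j)) * (2^-1 * (Y i j - x s)) + (ind j * (1 - ind i)) * (2^-1 * (Y j i - x s))
    + ind i * ind j * (X i j - x s).
  move=> ij; case: (boolP (i \in s)) => is_; case: (boolP (j \in s)) => js /=.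
  - by rewrite !subrr !mulr0 !mul0r !add0r !mul1r.
  - by have [-> _] := rate_distinct xsym ij is_ js; rewrite subr0 mulr1 !mul0r mul1r mulr0 mul0r !addr0.
  - have ji : j != i by rewrite eq_sym.
    have [_ ->] := rate_distinct xsym ji js is_.
    by rewrite subr0 mulr1 !mul0r mul1r add0r addr0.
  - rewrite !mul0r !addr0; apply: rate_none; by rewrite /touches (negbTE is_) (negbTE js).
have Y_self i : i \in s -> Y i i = x s.
  by move=> is_; apply: xsym; rewrite perm_sym perm_to_rem.
have sumY i : i \in s -> \sum_(j < N) (1 - ind j) * Y i j = - \sum_(j < N) ind j * Y i j.
  move=> is_; apply/eqP; rewrite -subr_eq0 opprK -big_split /=; apply/eqP.
  transitivity (\sum_(j < N) Y i j); first by apply: eq_bigr => j _; ring.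
  by apply: xsum; rewrite size_rem // prednK // lt0n size_eq0.
(* All that is left off the diagonal. Only the [L * L - L] ordered pairs inside [s] occur, each with
   a loss of at most one factor [q]. *)
pose V := \sum_(i < N) \sum_(j < N | i != j) ind i * ind j * (X i j - Y i j).
have swapS (f : 'I_N -> 'I_N -> R) :
    \sum_(i < N) \sum_(j < N | i != j) f j i = \sum_(i < N) \sum_(j < N | i != j) f i j.
  rewrite (exchange_big_dep xpredT) //=; apply: eq_bigr => i _.
  by apply: eq_bigl => j; rewrite eq_sym.
have indS : \sum_(i < N) ind i * ind i = L%:R.
  by rewrite -sum_indicator; apply: eq_bigr => i _; case: (i \in s); rewrite ?mulr1 ?mul0r.
have pairS : \sum_(i < N) \sum_(j < N | i != j) ind i * ind j = L%:R * L%:R - L%:R.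
  rewrite -{3}indS -[X in X * _]sum_indicator mulr_suml -sumrB; apply: eq_bigr => i _.
  rewrite -sum_indicator mulr_sumr [X in X - _](bigD1 i) //= addrAC subrr add0r.
  by apply: eq_bigl => j; rewrite eq_sym.
have key : \sum_(i < N) \sum_(j < N | i != j) (X i j - x s) + L%:R * N%:R * x s = V.
  pose T1 i j := ind i * (1 - ind j) * (2^-1 * (Y i j - x s)).
  have -> : \sum_(i < N) \sum_(j < N | i != j) (X i j - x s) =
     (\sum_(i < N) \sum_(j < N | i != j) T1 i j + \sum_(i < N) \sum_(j < N | i != j) T1 j i)
     + \sum_(i < N) \sum_(j < N | i != j) ind i * ind j * (X i j - x s).
    rewrite -!big_split; apply: eq_bigr => i _ /=; rewrite -!big_split; apply: eq_bigr => j ij /=.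
    by rewrite [LHS]EP.
  rewrite (swapS T1).
  have -> : \sum_(i < N) \sum_(j < N | i != j) T1 i j + \sum_(i < N) \sum_(j < N | i != j) T1 i j =
     - (\sum_(i < N) \sum_(j < N | i != j) ind i * ind j * Y i j) - L%:R * x s - L%:R * (N%:R - L%:R) * x s.
    rewrite -big_split.
    have -> : L%:R * x s = \sum_(i < N) ind i * ind i * x s by rewrite -mulr_suml indS.
    have -> : L%:R * (N%:R - L%:R) * x s = \sum_(i < N) ind i * (N%:R - L%:R) * x s.
      by rewrite -!mulr_suml sum_indicator.
    rewrite -sumrN -!sumrB; apply: eq_bigr => i _ /=; rewrite -big_split /=.
    transitivity (\sum_(j < N) ind i * (1 - ind j) * (Y i j - x s)).
      rewrite [RHS](bigD1 i) //= (_ : ind i * (1 - ind i) = 0) ?mul0r ?add0r; last first.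
        by case: (i \in s); rewrite ?subrr ?mulr0 ?mul0r.
      apply: eq_big => [j|j _]; first by rewrite eq_sym.
      by rewrite /T1 -mulrDr; congr (_ * _); lra.
    transitivity (ind i * (\sum_(j < N) (1 - ind j) * Y i j - (N%:R - L%:R) * x s)).
      have -> : N%:R - L%:R = \sum_(j < N) (1 - ind j) :> R.
        by rewrite sumrB sum_indicator sumr_const card_ord.
      rewrite mulr_suml -sumrB mulr_sumr; apply: eq_bigr => j _; ring.
    case: (boolP (i \in s)) => is_; last first.
      by rewrite !mul0r !subr0 big1 ?oppr0 // => j _; rewrite !mul0r.
    rewrite sumY // (bigD1 i) //= Y_self // is_ !mul1r.
    have -> : \sum_(j < N | i != j) 1 * ind j * Y i j = \sum_(j < N | j != i) ind j * Y i j.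
      by apply: eq_big => [j|j _]; rewrite 1?eq_sym // mul1r.
    by ring.
  have -> : \sum_(i < N) \sum_(j < N | i != j) ind i * ind j * (X i j - x s) =
    \sum_(i < N) \sum_(j < N | i != j) ind i * ind j * X i j - (L%:R * L%:R - L%:R) * x s.
    rewrite -pairS mulr_suml -sumrB; apply: eq_bigr => i _.
    by rewrite mulr_suml -sumrB; apply: eq_bigr => j _; rewrite mulrBr.
  have -> : V = \sum_(i < N) \sum_(j < N | i != j) ind i * ind j * X i j
    - \sum_(i < N) \sum_(j < N | i != j) ind i * ind j * Y i j.
    rewrite -sumrB; apply: eq_bigr => i _; rewrite -sumrB; apply: eq_bigr => j _.
    by rewrite mulrBr.
  by ring.
rewrite /moment_rate -/(X _ _).
have -> : L%:R * N%:R / (N%:R - 1) * x s = (N%:R - 1)^-1 * (L%:R * N%:R * x s) by ring.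
rewrite -mulrDr key normrM.
have N1V : 0 <= (N%:R - 1)^-1 :> R by rewrite invr_ge0.
rewrite (ger0_norm N1V) ler_pdivrMl //.
set W := S * q ^+ L.-1.
have W0 : 0 <= W by rewrite mulr_ge0.
pose c := (2 ^+ n + 1) / q.
have c0 : 0 <= c by rewrite divr_ge0 // ?addr_ge0 ?exprn_ge0 // ltW.
have XY i j : i != j -> i \in s -> j \in s -> `|X i j - Y i j| <= c * W.
  move=> ij is_ js; have := rate_both S0 Hx ij is_ js; rewrite mul1r subrK -/(X i j) -/W => HX.
  have HY : `|Y i j| <= 1 / q * W.
    have jr : j \in rem i s by rewrite mem_rem_uniq // inE eq_sym ij.
    have sr : (size (rem i s)).+1 = n by rewrite size_rem // prednK // lt0n size_eq0.
    apply: le_trans (Hx (j :: rem i s) sr) _.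
    have -> : (distinct (j :: rem i s)).-1 = n.-2.
      by rewrite /distinct /= jr undup_id ?rem_uniq // -sr.
    have : (1 < n)%N by rewrite -sr ltnS; case: (rem i s) jr.
    rewrite /W Ln; case: (size s) => [|[|m]] //= _.
    rewrite (_ : 1 / q * (S * q ^+ m.+1) = S * q ^+ m); first exact: lexx.
    by rewrite exprS; field; rewrite gt_eqF.
  apply: le_trans (ler_normB _ _) _; apply: le_trans (lerD HX HY) _.
  by rewrite /c -mulrDl -mulrDl.
have HV : `|V| <= c * W * (L%:R * L%:R - L%:R).
  rewrite -pairS mulr_sumr; apply: le_trans (ler_norm_sum _ _ _) _; apply: ler_sum => i _.
  rewrite mulr_sumr; apply: le_trans (ler_norm_sum _ _ _) _; apply: ler_sum => j ij.
  case: (boolP (i \in s)) => is_; last by rewrite !mul0r normr0 mulr0.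
  case: (boolP (j \in s)) => js; last by rewrite mulr0 mul0r normr0 mulr0.
  by rewrite !mul1r mulr1; exact: XY.
apply: le_trans HV _; rewrite mulrAC [leRHS]mulrA; apply: ler_wpM2r => //.
have -> : (N%:R - 1) * (L%:R * N%:R / (N%:R - 1) - 3 / 8) = L%:R * N%:R - 3 / 8 * (N%:R - 1) :> R.
  by field; rewrite gt_eqF.
have h1 : c * (L%:R * L%:R - L%:R) <= (N%:R - 1) / 128.
  rewrite /c mulrAC ler_pdivrMr //.
  have h2 : (2 ^+ n + 1) * (L%:R * L%:R - L%:R) <= (2 ^+ n + 2 ^+ n) * n%:R ^+ 2 :> R.
    apply: ler_pM.
    - by rewrite addr_ge0 ?exprn_ge0.
    - by rewrite subr_ge0 ler_peMl.
    - by rewrite lerD2l.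
    - by rewrite Ln expr2 gerBl.
  apply: le_trans h2 _; move: hqb; lra.
apply: le_trans h1 _.
have : 1 * (N%:R : R) <= L%:R * N%:R by apply: ler_wpM2r.
by move: NR; lra.
Qed.

End Distinct.

End LinearGap.

(** * A weighted Gronwall lemma *)

Section ForwardDerivative.
Variable R : realType.
Implicit Types (f df : R -> R) (t T : R).

Definition fwd_derive f df t := diffq (forward_filter t) (fun h => f (t + h)) (f t) (df t).

Lemma is_derive_fwd f df t : is_derive t 1 f (df t) -> fwd_derive f df t.
Proof.
move=> [Df Ef]; rewrite /fwd_derive /diffq.
have : h^-1 *: ((f \o shift t) (h *: (1 : R)) - f t) @[h --> 0^'] --> df t.
  by rewrite -Ef; exact: Df.
move=> H; apply: (@cvg_trans _ (h^-1 * (f (t + h) - f t) @[h --> 0^'])).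
  by apply: cvg_app; exact: forward_filter0.
apply: cvg_trans H; apply: near_eq_cvg; near=> h.
by rewrite /= /GRing.scale /= mulr1 [t + h]addrC.
Unshelve. all: by end_near. Qed.

Lemma fwd_is_derive f df t : 0 < t -> fwd_derive f df t -> is_derive t 1 f (df t).
Proof.
move=> t0 H.
have {}H : h^-1 *: ((f \o shift t) (h *: (1 : R)) - f t) @[h --> 0^'] --> df t.
  rewrite (_ : (fun h => _) = fun h => h^-1 * (f (t + h) - f t)); last first.
    by apply/funext => h; rewrite /= /GRing.scale /= mulr1 [t + h]addrC.
  apply: cvg_trans H; apply: cvg_app => A /= HA.
  have h0 : \forall h \near (0 : R)^', 0 <= t + h.
    have : \forall h \near (0 : R)^', `|h| < t by exact: dnbhs0_lt.
    apply: filterS => h; rewrite ltr_norml => /andP[h1 _]; lra.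
  have HA' : \forall h \near (0 : R)^', 0 <= t + h -> A h by exact: HA.
  by rewrite /= in HA' *; near=> h; apply: (near HA' h) => //; near: h.
split; first by apply/cvg_ex; exists (df t).
by apply: cvg_lim.
Unshelve. all: by end_near. Qed.

(** The mean value theorem needs two-sided derivatives only at interior points; at 0 the one-sided
    quotient still provides the right continuity. *)
Lemma fwd_nondecreasing f df T : 0 <= T ->
  (forall t, 0 <= t -> t <= T -> fwd_derive f df t) ->
  (forall t, 0 <= t -> t <= T -> 0 <= df t) -> f 0 <= f T.
Proof.
rewrite le_eqVlt => /predU1P[<- //|T0] Hd Hp.
have Hd' t : 0 < t -> t <= T -> is_derive t 1 f (df t).
  by move=> t0 tT; apply: fwd_is_derive => //; apply: Hd => //; exact: ltW.
have cf t : 0 < t -> t <= T -> {for t, continuous f}.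
  move=> t0 tT; have dx := Hd' _ t0 tT.
  by apply: differentiable_continuous; apply/derivable1_diffP; exact: ex_derive.
have [||c] := @MVT_segment R f df 0 T (ltW T0).
- by move=> x; rewrite in_itv /= => /andP[x0 xT]; apply: Hd' => //; exact: ltW.
- apply/continuous_within_itvP => //; split.
  + by move=> x; rewrite in_itv /= => /andP[x0 xT]; apply: cf => //; exact: ltW.
  + have FF : Filter (forward_filter (0 : R)) by exact: within_filter.
    have := diffq_cvg (@forward_filter0 R 0) (Hd 0 (lexx _) (ltW T0)).
    rewrite (_ : (fun h => f (0 + h)) = f); last by apply/funext => h; rewrite add0r.
    move=> H A /H HA.
    have HA' : \forall h \near (0 : R), h != 0 -> 0 <= 0 + h -> A (f h) by exact: HA.
    have : \forall h \near (0 : R), 0 < h -> A (f h).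
      by apply: filterS HA' => h HAh h0; apply: HAh; [rewrite gt_eqF|rewrite add0r ltW].
    exact.
  + by apply: cvg_at_left_filter; apply: cf.
- rewrite in_itv /= => /andP[c0 cT] E; rewrite -subr_ge0 E mulr_ge0 ?subr0 ?(ltW T0) //.
  exact: Hp.
Qed.

Lemma fwd_expR c t : fwd_derive (fun t => expR (c * t)) (fun t => c * expR (c * t)) t.
Proof.
apply: is_derive_fwd.
have D := @is_derive1_comp R (@expR R) (fun x => c * x) t _ _ (is_derive_expR (c * t))
   (is_deriveZ c (is_derive_id t (1 : R))).
by apply: is_derive_eq D _; rewrite /GRing.scale /= mulr1 mulrC.
Qed.

(** Integrating factor: [(M * expR (- l * t) - y t) * expR (a * t)] has a non-negative derivative
    and a non-negative initial value. *)
Lemma fwd_compare_ub y dy (a l M b : R) T : 0 <= T ->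
  (forall t, 0 <= t -> t <= T -> fwd_derive y dy t) -> y 0 <= M -> b <= (a - l) * M ->
  (forall t, 0 <= t -> t <= T -> dy t + a * y t <= b * expR (- l * t)) ->
  y T <= M * expR (- l * T).
Proof.
move=> T0 Hy y0 hb Hdy.
pose f t := (M * expR (- l * t) + - y t) * expR (a * t).
pose df t := (M * (- l * expR (- l * t)) + - dy t) * expR (a * t) +
  (M * expR (- l * t) + - y t) * (a * expR (a * t)).
have : f 0 <= f T.
  apply: (@fwd_nondecreasing f df) => // t t0 tT.
    have FF : Filter (forward_filter t) by exact: within_filter.
    have G0 := @forward_filter0 R t.
    apply: (diffqM G0); last exact: fwd_expR.
    apply: diffqD; last by apply: diffqN; exact: Hy.
    have := diffqM G0 (@diffq_cst R (forward_filter t) FF M) (@fwd_expR (- l) t).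
    by rewrite mul0r add0r; apply.
  have -> : df t = ((a - l) * M * expR (- l * t) - (dy t + a * y t)) * expR (a * t).
    by rewrite /df; ring.
  rewrite mulr_ge0 ?expR_ge0 // subr_ge0; apply: le_trans (Hdy t t0 tT) _.
  by apply: ler_wpM2r => //; exact: expR_ge0.
have f0 : 0 <= f 0 by rewrite /f !mulr0 expR0 !mulr1 subr_ge0.
by move=> /(le_trans f0); rewrite /f pmulr_lge0 ?expR_gt0 // subr_ge0.
Qed.

Lemma fwd_compare y dy (a l M b : R) T : 0 <= T ->
  (forall t, 0 <= t -> t <= T -> fwd_derive y dy t) -> `|y 0| <= M -> b <= (a - l) * M ->
  (forall t, 0 <= t -> t <= T -> `|dy t + a * y t| <= b * expR (- l * t)) ->
  `|y T| <= M * expR (- l * T).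
Proof.
move=> T0 Hy; rewrite !ler_norml => /andP[y1 y2] hb Hdy; apply/andP; split.
  rewrite lerNl; apply: (@fwd_compare_ub (fun t => - y t) (fun t => - dy t) a l M b) => //.
  - move=> t t0 tT; have FF : Filter (forward_filter t) by exact: within_filter.
    by apply: diffqN; exact: Hy.
  - by rewrite lerNl.
  - move=> t t0 tT; have := Hdy t t0 tT; rewrite ler_norml => /andP[h _].
    by rewrite mulrN -opprD lerNl.
apply: (@fwd_compare_ub y dy a l M b) => // t t0 tT.
by have := Hdy t t0 tT; rewrite ler_norml => /andP[].
Qed.

End ForwardDerivative.

Section Gronwall.
Variables (R : realType) (I : finType) (y dy : I -> R -> R) (w a : I -> R) (M b : R).
Hypotheses (w0 : forall i, 0 < w i) (a38 : forall i, 3 / 8 <= a i) (b8 : 8 * b <= M) (M0 : 0 <= M).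
Hypothesis bounded : forall i, exists B, forall t, 0 <= t -> `|y i t| <= B.
Hypothesis Hy : forall i t, 0 <= t -> fwd_derive (y i) (dy i) t.
Hypothesis Hy0 : forall i, `|y i 0| <= M * w i.
Hypothesis Hdy : forall i t S, 0 <= t -> 0 <= S -> (forall j, `|y j t| <= S * w j) ->
  `|dy i t + a i * y i t| <= ((a i - 3 / 8) * S + b * expR (- (t / 4))) * w i.

(* If the weighted supremum [S] over a time interval exceeded [M], the equation attaining it
   would be bounded by [S - (S - M) / (8 (a i - 1 / 4))]. *)
Lemma weighted_gronwall i t : 0 <= t -> `|y i t| <= M * expR (- (t / 4)) * w i.
Proof.
move=> T0; move: t T0 => T T0.
pose z i t := `|y i t| * expR (t / 4) / w i.
pose E i := [set z i t | t in [set t | 0 <= t <= T]].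
have z0 j t : 0 <= z j t by rewrite divr_ge0 ?mulr_ge0 ?expR_ge0 // ltW.
have Eub j : has_ubound (E j).
  have [B HB] := bounded j.
  exists (B * expR (T / 4) / w j) => _ [t /= /andP[t0 tT] <-].
  rewrite ler_pM2r ?invr_gt0 //; apply: ler_pM; rewrite ?expR_ge0 //; first exact: HB.
  by rewrite ler_expR ler_pM2r.
have E0 j : E j !=set0 by exists (z j T); exists T => //=; rewrite T0 lexx.
have zE j t : 0 <= t -> t <= T -> z j t <= sup (E j).
  by move=> t0 tT; apply: ub_le_sup => //; exists t => //=; rewrite t0.
have [m _ Hm] := @arg_maxP _ _ _ i xpredT (fun j => sup (E j)) isT.
set S := sup (E m) in Hm.
have S0 : 0 <= S by apply: le_trans (z0 m T) _; exact: zE.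
have yz j t S' : z j t <= S' -> `|y j t| <= S' * expR (- (t / 4)) * w j.
  rewrite /z ler_pdivrMr // => h; rewrite expRN mulrAC ler_pdivlMr ?expR_gt0 //.
have [SM|MS] := leP S M.
  by apply: yz; apply: le_trans (zE i T T0 (lexx _)) _; apply: le_trans (Hm i isT) SM.
have am : 0 < a m - 4^-1 by have := a38 m; lra.
(* The first entry covers the initial value, the second the forcing: [(a - 3 / 8) * S + M / 8]
   equals [(a - 1 / 4) * S - (S - M) / 8], and division by [a - 1 / 4] gives the entry. Both lie
   strictly below [S], although the supremum over time need not be attained. *)
pose M' := Num.max M (S - (S - M) / (8 * (a m - 4^-1))).
have M'S : M' < S.
  rewrite /M' gt_max MS /= gtrBl divr_gt0 ?subr_gt0 // mulr_gt0 //.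
have : S <= M'.
  apply: ge_sup => // _ [t /= /andP[t0 tT] <-].
  rewrite /z ler_pdivrMr // mulrC -ler_pdivlMl ?expR_gt0 // -expRN.
  have -> : - (t / 4) = - 4^-1 * t by ring.
  rewrite mulrC; apply: (@fwd_compare R (y m) (dy m) (a m) 4^-1 _ (((a m - 3 / 8) * S + b) * w m)) => //.
  - by move=> u u0 ut; exact: Hy.
  - by apply: le_trans (Hy0 m) _; rewrite ler_pM2r // le_max lexx.
  - rewrite mulrA ler_pM2r //.
    have h : S - (S - M) / (8 * (a m - 4^-1)) <= M' by rewrite le_max lexx orbT.
    apply: le_trans (ler_wpM2l (ltW am) h).
    have -> : (a m - 4^-1) * (S - (S - M) / (8 * (a m - 4^-1))) = (a m - 4^-1) * S - (S - M) / 8.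
      by field; apply: lt0r_neq0; move: am; move: (a m) => z1; lra.
    have lin (x S1 M1 b1 : R) : 8 * b1 <= M1 -> (x - 3 / 8) * S1 + b1 <= (x - 4^-1) * S1 - (S1 - M1) / 8 by lra.
    exact: lin.
  - move=> u u0 ut; have H := Hdy m u0 (mulr_ge0 S0 (expR_ge0 (- (u / 4)))) _.
    apply: le_trans (H _) _ => [j|].
      apply: yz; apply: le_trans (Hm j isT); apply: zE => //; exact: le_trans tT.
    have -> : - 4^-1 * u = - (u / 4) by ring.
    by rewrite le_eqVlt; apply/orP; left; apply/eqP; ring.
by rewrite leNgt M'S.
Qed.

End Gronwall.

(** * Relaxation of the cumulants *)

Lemma not_uniq_count (T : eqType) (s : seq T) : ~~ uniq s -> exists a, (1 < count_mem a s)%N.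
Proof.
elim: s => //= a s IH; have [sa _|sa /= /IH[b Hb]] := boolP (a \in s).
  by exists a; rewrite eqxx ltnS -has_count has_pred1.
by exists b; apply: leq_trans Hb (leq_addl _ _).
Qed.

Section Preparations.
Variables (R : realType) (N : nat).
Implicit Types (s : seq 'I_N).

Lemma moment_rateB (x y : seq 'I_N -> R) s :
  moment_rate (fun s => x s - y s) s = moment_rate x s - moment_rate y s.
Proof.
rewrite /moment_rate -mulrBr -sumrB; congr (_ * _); apply: eq_bigr => i _.
rewrite -sumrB; apply: eq_bigr => j _; rewrite sumrB; ring.
Qed.

Lemma interaction_zero s : s != [::] -> interaction (fun=> 0 : R) s = 0.
Proof.
move=> s0; rewrite /interaction big1 ?mulr0 // => i _; rewrite big1 // => j _.
rewrite (_ : (fun theta => _) = fun=> 0) ?angle_avg_cst //; apply/funext => theta.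
rewrite (_ : excess _ _ _ _ = fun=> 0); last first.
  by apply/funext => t; rewrite /excess /collide big1 // mulr0 subr0.
rewrite /exp_tail subr0 conv_expE; case: s s0 => //= a s _.
by rewrite conv_zeror.
Qed.

(** Serves only to make the suprema over time in [weighted_gronwall] finite; its size does not enter
    the final estimate. *)
Lemma cumulants_bounded s : exists B : R, forall F : probability (borel_space R N) R,
  F (kac_sphere R N) = 1%E -> `|cumulants (moment F) s| <= B.
Proof.
have [n] := ubnP (size s); elim: n s => // n IH [|a s] /ltnSE Hs.
  by exists 0 => F _; rewrite cumulants0 normr0.
have sum_bounded (r : seq (seq 'I_N * seq 'I_N)) : exists B : R, forall F : probability (borel_space R N) R,
    F (kac_sphere R N) = 1%E ->
    `|\sum_(p <- r) moment F p.1 * trunc (size s) (shift_label a (cumulants (moment F))) p.2| <= B.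
  elim: r => [|p r [B HB]]; first by exists 0 => F _; rewrite big_nil normr0.
  have [B' HB'] : exists B' : R, forall F : probability (borel_space R N) R, F (kac_sphere R N) = 1%E ->
      `|trunc (size s) (shift_label a (cumulants (moment F))) p.2| <= B'.
    rewrite /trunc /shift_label; case: (ltnP (size p.2) (size s)) => Hp; last first.
      by exists 0 => F _; rewrite normr0.
    by apply: IH; rewrite /= (leq_trans _ Hs).
  exists (N%:R ^+ size p.1 * B' + B) => F F1; rewrite big_cons.
  apply: le_trans (ler_normD _ _) _; rewrite lerD ?HB // normrM ler_pM //; last exact: HB'.
  exact: moment_bound.
have [B HB] := sum_bounded (splits s).
exists (N%:R ^+ (size s).+1 + B) => F F1.
rewrite cumulantsE /= (moment0 F1) divr1; apply: le_trans (ler_normB _ _) _.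
by rewrite lerD ?(moment_bound F1 (a :: s)) //; exact: HB.
Qed.

(** A rotation by [pi / 2] exchanges two energies, so all means agree, and they add up to [N]. *)
Lemma uniform_first_cumulant (U : probability (borel_space R N) R) a : (1 < N)%N ->
  uniform_sphere_law U -> cumulants (moment U) [:: a] = 1.
Proof.
move=> N2 HU; have U1 := HU.1.
rewrite cumulantsE /= conv0 (moment0 U1) /trunc /= mulr0 subr0 divr1.
have E i : moment U [:: i] = moment U [:: a].
  have [->//|ia] := eqVneq i a.
  rewrite -(moment_rotation (pi / 2) [:: a] ia HU); congr sphere_mean; apply/funext => v.
  rewrite /energy_monomial !big_cons !big_nil /kac_rotation !mxE eq_sym (negbTE ia) eqxx.
  by rewrite sin_pihalf cos_pihalf mul0r addr0 mulN1r sqrrN.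
have := moment_energy U1 [::]; under eq_bigr do rewrite E.
rewrite sumr_const card_ord (moment0 U1) -[moment U _ *+ _]mulr_natl => /mulfI; apply.
by rewrite pnatr_eq0 -lt0n ltnW.
Qed.

End Preparations.

Section CumulantBounds.
Variables (R : realType) (N nmax : nat) (q C P : R).
Hypotheses (N2 : (1 < N)%N) (q01 : 0 < q <= 1) (C1 : 2 ^+ 10 <= C) (P1 : 1 <= P).
Hypothesis hqa : 256 * (2 ^+ nmax * nmax%:R ^+ 2) * q <= 1.
Hypothesis hqb : 256 * (2 ^+ nmax * nmax%:R ^+ 2) <= q * (N%:R - 1).
Local Notation K := (majorant C P).
Local Notation w s := (q ^+ (distinct s).-1).
Implicit Types s : seq 'I_N.

Let q0 : 0 < q. Proof. by case/andP: q01. Qed.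
Let K0 n : 0 < K n. Proof. by apply: majorant_gt0 => //; apply: le_trans C1; rewrite -natrX ler1n. Qed.
Let w0 s : 0 < w s. Proof. exact: exprn_gt0. Qed.

Lemma linear_gap s : s != [::] -> (size s <= nmax)%N ->
  exists a : R, 3 / 8 <= a /\ forall x (S : R), 0 <= S -> sym_fun x ->
  (forall t, (size t).+1 = size s -> \sum_(j < N) x (j :: t) = 0) ->
  (forall s', size s' = size s -> `|x s'| <= S * w s') ->
  `|moment_rate x s + a * x s| <= (a - 3 / 8) * (S * w s).
Proof.
move=> s0 sn.
have mono : 256 * (2 ^+ size s * (size s)%:R ^+ 2) <= 256 * (2 ^+ nmax * nmax%:R ^+ 2) :> R.
  rewrite ler_wpM2l // ler_pM ?exprn_ge0 //; first by rewrite ler_weXn2l // ler1n.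
  by rewrite lerXn2r ?nnegrE // ler_nat.
have ha := le_trans (ler_wpM2r (ltW q0) mono) hqa.
have hb := le_trans mono hqb.
have [us|/not_uniq_count[a0 Ha0]] := boolP (uniq s); first exact: gap_distinct.
have [a [a38 Ha]] := gap_repeated N2 q01 s0 ha hb Ha0.
by exists a; split => // x S S0 _ _; exact: Ha.
Qed.

Let Hq n : (n < nmax)%N -> n.+1%:R <= q * (N%:R - 1).
Proof.
move=> nn; apply: le_trans hqb.
have h1 : n.+1%:R <= nmax%:R :> R by rewrite ler_nat.
have h2 : 1 <= nmax%:R :> R by rewrite ler1n (leq_trans _ nn).
have h3 : 1 <= 2 ^+ nmax :> R by rewrite exprn_ege1 // ler1n.
move: (2 ^+ nmax) (nmax%:R : R) (n.+1%:R : R) h1 h2 h3 => a b c h1 h2 h3.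
have h4 : 1 * b <= a * b ^+ 2 by rewrite expr2; apply: ler_pM => //; nra.
by nra.
Qed.

Section Uniform.
Variable U : probability (borel_space R N) R.
Hypothesis HU : uniform_sphere_law U.
Local Notation k := (cumulants (moment U)).

(** At a sequence where the weighted cumulant of order [n] is maximal, stationarity and the gap give
    [3 / 8] of the maximum at most [K n / 32]; here the interaction is compared with that of the
    zero function. The factor 1/2 leaves the other half of the majorant to the initial cumulants. *)
Lemma uniform_cumulant_bound n : (n <= nmax)%N -> forall s, s != [::] -> (size s <= n)%N ->
  `|k s| <= 2^-1 * K (size s) * w s.
Proof.
elim: n => [|n IH] nn s s0; first by rewrite leqn0 size_eq0 (negbTE s0).
rewrite leq_eqVlt => /predU1P[|/ltnSE]; last by apply: IH => //; exact: ltnW.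
(* Order one is separate: the means add up to [N], so the zero-sum condition of [linear_gap] fails
   there. *)
case: n IH nn => [|n] IH nn Es.
  case: s s0 Es => // a [|//] _ _; rewrite uniform_first_cumulant // normr1 expr0 mulr1.
  by rewrite /majorant expr0 mulr1 expr1 mul1r; move: C1; rewrite -natrX; lra.
have Hint t : size t = n.+2 -> `|interaction k t| <= K n.+2 / 32 * w t.
  have hb (c : R) u : 2^-1 <= c -> u != [::] -> (size u <= n.+1)%N -> `|k u| <= c * K (size u) * w u.
    move=> hc u0 un; apply: le_trans (IH (ltnW nn) u u0 un) _.
    by rewrite -[leLHS]mulrA -[leRHS]mulrA ler_wpM2r // ltW // mulr_gt0.
  move=> Et; have t0 : t != [::] by rewrite -size_eq0 Et.
  have := @interaction_diff R N q C P 1 n.+1 k (fun=> 0) N2 q01 C1 P1 ler01 _ _ _ (Hq nn) t Et.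
  rewrite (interaction_zero _ t0) subr0 div1r [_^-1 * K _]mulrC; apply.
  - by move=> u; apply: hb; lra.
  - by move=> u _ _; rewrite normr0 mulr_ge0 ?ltW // mulr_gt0.
  - by move=> u; rewrite subr0; apply: hb; lra.
suff H : forall t : n.+2.-tuple 'I_N, `|k t| <= 2^-1 * K n.+2 * w t.
  by have := H (Tuple (introT eqP Es)); rewrite /= Es.
move=> t; pose f (t : n.+2.-tuple 'I_N) := `|k t| / w t.
have [m _ Hm] := @arg_maxP _ _ _ t xpredT f isT.
have S0 : 0 <= f m by rewrite divr_ge0 // ltW.
have HS (s' : seq 'I_N) : size s' = n.+2 -> `|k s'| <= f m * w s'.
  by move=> Es'; rewrite -ler_pdivrMr //; exact: (Hm (Tuple (introT eqP Es')) isT).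
have m0 : tval m != [::] by rewrite -size_eq0 size_tuple.
have [|a [a38 Ha]] := @linear_gap m m0; first by rewrite size_tuple.
have := Ha k (f m) S0 (sym_cumulants (moment0 HU.1) (sym_moment U)) _ _.
rewrite size_tuple => /(_ _ HS) H.
have {}H : `|moment_rate k m + a * k m| <= (a - 3 / 8) * (f m * w m).
  apply: H => u [Eu]; rewrite cumulant_energy; last exact: HU.1.
  by rewrite -size_eq0 Eu mulr0.
have HI := Hint m (size_tuple m).
have E : a * k m = (moment_rate k m + a * k m) + interaction k m.
  by rewrite addrAC uniform_cumulant_rate // add0r.
have Ekm : `|k m| = f m * w m by rewrite divfK // gt_eqF.
have key : a * (f m * w m) <= ((a - 3 / 8) * f m + K n.+2 / 32) * w m.
  rewrite -Ekm -{1}[a]ger0_norm -?normrM; last lra.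
  by rewrite E (le_trans (ler_normD _ _)) // mulrDl lerD // -mulrA.
have fK : f m <= 2^-1 * K n.+2.
  move: key; rewrite mulrA ler_pM2r // => key; have := K0 n.+2.
  by move: (f m) (K _) key => x y; lra.
by apply: le_trans (HS t (size_tuple t)) _; rewrite ler_pM2r.
Qed.

Variables (F0 : probability (borel_space R N) R) (F : R -> probability (borel_space R N) R).
Hypothesis HF : kac_law F0 F.
Local Notation kt t := (cumulants (moment (F t))).
Hypothesis Hinit : forall s, s != [::] -> (size s <= nmax)%N -> `|kt 0 s - k s| <= K (size s) * w s.

(** In the difference of the two laws the constant energy cancels, so the zero-sum condition holds
    from order one on. The interaction is Lipschitz in the lower orders, with
    [eta = expR (- (u / 4))], and passes their rate on undiminished. *)
Lemma cumulant_relaxation n : (n <= nmax)%N -> forall s (t : R), s != [::] -> (size s <= n)%N -> 0 <= t ->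
  `|kt t s - k s| <= K (size s) * expR (- (t / 4)) * w s.
Proof.
elim: n => [|n IH] nn s t s0; first by rewrite leqn0 size_eq0 (negbTE s0).
rewrite leq_eqVlt => /predU1P[|/ltnSE Es]; last by apply: IH => //; exact: ltnW.
move=> Es T0; have F1 (u : R) : 0 <= u -> F u (kac_sphere R N) = 1%E by case: HF => _ H _; exact: H.
have gap (i : n.+1.-tuple 'I_N) : exists a : R, 3 / 8 <= a /\ forall x (S : R), 0 <= S -> sym_fun x ->
    (forall t, size t = n -> \sum_(j < N) x (j :: t) = 0) ->
    (forall s' : n.+1.-tuple 'I_N, `|x s'| <= S * w s') ->
    `|moment_rate x i + a * x i| <= (a - 3 / 8) * (S * w i).
  have i0 : tval i != [::] by rewrite -size_eq0 size_tuple.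
  have [|a [a38 Ha]] := @linear_gap i i0; first by rewrite size_tuple.
  exists a; split => // x S S0 sx x0 xS; apply: Ha => //.
    by move=> u; rewrite size_tuple => -[]; exact: x0.
  by move=> s'; rewrite size_tuple => Es'; exact: (xS (Tuple (introT eqP Es'))).
have [a Ha] := choice gap.
pose y (i : n.+1.-tuple 'I_N) u := kt u i - k i.
pose dy (i : n.+1.-tuple 'I_N) u := moment_rate (kt u) i + interaction (kt u) i.
suff H : forall i : n.+1.-tuple 'I_N, `|y i t| <= K n.+1 * expR (- (t / 4)) * w i.
  by have := H (Tuple (introT eqP Es)); rewrite /y /= => Hs; rewrite Es.
move=> i; apply: (@weighted_gronwall R _ y dy (fun i => w i) a (K n.+1) (K n.+1 / 32)) => //.
- by move=> j; case: (Ha j).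
- by have := K0 n.+1; move: (K _) => x; lra.
- move=> j; have [B HB] := @cumulants_bounded R N j.
  exists (B + B) => u u0; apply: le_trans (ler_normB _ _) _.
  by rewrite lerD //; apply: HB; [exact: F1|exact: HU.1].
- move=> j u u0; have FF : Filter (forward_filter u) by exact: within_filter.
  rewrite /fwd_derive /y /dy -[X in diffq _ _ _ X]addr0; apply: diffqD; last exact: diffq_cst.
  by apply: (diffq_kac_cumulants N2 HF u0); rewrite -size_eq0 size_tuple.
- by move=> j; have := @Hinit j; rewrite size_tuple -size_eq0 size_tuple; apply.
- move=> j u S u0 S0 HS; have [a38 Haj] := Ha j.
  have j0 : tval j != [::] by rewrite -size_eq0 size_tuple.
  have eu : expR (- (u / 4)) <= 1 by rewrite expR_le1 oppr_le0 divr_ge0.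
  have Hlin := Haj (fun s => kt u s - k s) S S0.
  have {}Hlin : `|moment_rate (fun s => kt u s - k s) j + a j * y j u| <= (a j - 3 / 8) * (S * w j).
    apply: Hlin => //.
    + have sk (G : probability (borel_space R N) R) : G (kac_sphere R N) = 1%E -> sym_fun (cumulants (moment G)).
        by move=> G1; apply: sym_cumulants; [exact: moment0|exact: sym_moment].
      by move=> s1 s2 s12; rewrite (sk _ (F1 u u0) _ _ s12) (sk _ HU.1 _ _ s12).
    + by move=> v _; rewrite sumrB !cumulant_energy ?subrr //; [exact: HU.1|exact: F1].
  have Hint : `|interaction (kt u) j - interaction k j| <= expR (- (u / 4)) / 32 * K n.+1 * w j.
    have hU v : v != [::] -> (size v <= n)%N -> `|k v| <= 2^-1 * (K (size v) * w v).
      by move=> v0 vn; rewrite mulrA; apply: (@uniform_cumulant_bound n) => //; exact: ltnW.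
    have hx v : v != [::] -> (size v <= n)%N -> `|kt u v - k v| <= expR (- (u / 4)) * (K (size v) * w v).
      by move=> v0 vn; rewrite mulrCA mulrA; apply: IH => //; exact: ltnW.
    have Kw (v : seq 'I_N) : 0 < K (size v) * w v by apply: mulr_gt0; [exact: K0|exact: w0].
    apply: (@interaction_diff R N q C P _ n) => //; rewrite ?expR_ge0 ?size_tuple //; last exact: Hq.
    (* The difference contributes at most 1 and the uniform law 1/2, within the factor 2 allowed by
       [interaction_diff]. *)
    + move=> v v0 vn; have -> : kt u v = (kt u v - k v) + k v by rewrite subrK.
      apply: le_trans (ler_normD _ _) _; rewrite -[leRHS]mulrA.
      apply: le_trans (lerD (hx v v0 vn) (hU v v0 vn)) _.
      by rewrite -mulrDl ler_wpM2r // ltW //; move: eu; lra.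
    + move=> v v0 vn; rewrite -[leRHS]mulrA; apply: le_trans (hU v v0 vn) _.
      by rewrite ler_wpM2r ?ltW //; lra.
    + by move=> v v0 vn; rewrite -[leRHS]mulrA; exact: hx.
  have -> : dy j u + a j * y j u = (moment_rate (fun s => kt u s - k s) j + a j * y j u) +
      (interaction (kt u) j - interaction k j).
    rewrite moment_rateB /dy -[LHS]subr0 -(uniform_cumulant_rate HU j0); ring.
  apply: le_trans (ler_normD _ _) _; apply: le_trans (lerD Hlin Hint) _.
  by rewrite le_eqVlt; apply/orP; left; apply/eqP; move: (K _) (w _) => x1 x2; ring.
Qed.

End Uniform.
End CumulantBounds.

(** * Classifiers *)

Section Classifiers.
Variables (n N : nat) (nN : (n <= N)%N).
Implicit Types r : n.-tuple nat.

Lemma size_e_labels r : size (e_labels nN r) = sumn r.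
Proof.
rewrite size_flatten /shape -map_comp -[in RHS](map_tnth_enum r); congr sumn.
by apply: eq_map => k; rewrite /= size_nseq.
Qed.

Lemma distinct_e_labels r : distinct (e_labels nN r) = len r.
Proof.
rewrite /distinct /len -[in RHS](map_tnth_enum r) count_map -size_filter.
rewrite -(size_map (widen_ord nN)); apply: perm_size; apply: uniq_perm.
- exact: undup_uniq.
- rewrite map_inj_uniq; first by apply: filter_uniq; exact: enum_uniq.
  by move=> k l /(congr1 val) /= /val_inj.
- move=> a; rewrite mem_undup; apply/flatten_mapP/mapP => -[k].
    move=> _; rewrite mem_nseq => /andP[rk /eqP ->]; exists k => //.
    by rewrite mem_filter mem_enum /= -lt0n rk.
  rewrite mem_filter => /andP[rk _] ->; exists k; rewrite ?mem_enum // mem_nseq eqxx andbT.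
  by rewrite lt0n.
Qed.

Lemma e_labels_nth (x0 : 'I_N) r (w : seq 'I_N) (sg : 'I_N -> 'I_N) :
  (forall k : 'I_n, sg (widen_ord nN k) = nth x0 w k) ->
  map sg (e_labels nN r) = flatten [seq nseq (nth 0 r k) (nth x0 w k) | k <- iota 0 n].
Proof.
move=> Hsg; rewrite map_flatten -map_comp -val_enum_ord -map_comp; congr flatten.
by apply: eq_map => k; rewrite /= map_nseq Hsg (tnth_nth 0%N).
Qed.

(** The classifier lists the multiplicities in [s] in decreasing order, and the permutation sends
    the k-th label to the k-th most frequent one. *)
Lemma classifier_of_labels (s : seq 'I_N) : size s = n -> s != [::] ->
  exists (r : n.-tuple nat) (sg : 'S_N), [/\ classifiers n r, len r = distinct s &
    perm_eq (map sg (e_labels nN r)) s].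
Proof.
move=> Es; case E : s => [//|x0 s'] _; rewrite -E; clear E s'.
pose le (x y : 'I_N) := (count_mem y s <= count_mem x s)%N.
have le_trans : transitive le by move=> y x z /[swap]; exact: leq_trans.
have le_total : total le by move=> x y; exact: leq_total.
pose u := sort le (undup s); pose L := distinct s.
have uL : size u = L by rewrite size_sort.
have Ln : (L <= n)%N by rewrite -Es size_undup.
have uu : uniq u by rewrite sort_uniq undup_uniq.
have us : perm_eq u (undup s) by rewrite perm_sort.
have cu x : x \in u -> (0 < count_mem x s)%N.
  by rewrite (perm_mem us) mem_undup -has_count has_pred1.
(* The labels absent from [s] complete [u] to an enumeration of all labels, so that a permutation
   results. *)
pose w := u ++ [seq x <- enum 'I_N | x \notin u].
have wu : uniq w.
  rewrite cat_uniq uu (filter_uniq _ (enum_uniq _)) andbT /=.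
  by apply/hasPn => x; rewrite mem_filter => /andP[].
have wN : size w = N.
  rewrite -[RHS](size_enum_ord N); apply: perm_size; apply: uniq_perm => //; first exact: enum_uniq.
  by move=> x; rewrite mem_cat mem_filter mem_enum andbT orbN.
pose sg0 (k : 'I_N) := nth x0 w k.
have sg_inj : injective sg0.
  by move=> k l /eqP; rewrite nth_uniq ?wN // => /eqP/val_inj.
pose rs := [seq count_mem x s | x <- u] ++ nseq (n - L) 0%N.
have rn : size rs == n by rewrite size_cat size_map size_nseq uL subnKC.
pose r := Tuple rn.
have us_sum : sumn [seq count_mem x s | x <- u] = n.
  rewrite (perm_sumn (perm_map _ us)) -[RHS]Es -(perm_size (perm_count_undup s)) size_flatten.
  by rewrite /shape -map_comp; congr sumn; apply: eq_map => x /=; rewrite size_nseq.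
exists r, (perm sg_inj); split.
- split; last by rewrite /= sumn_cat us_sum sumn_nseq mul0n addn0.
  have gtr : transitive geq by move=> y x z /[swap]; exact: leq_trans.
  rewrite /= sorted_pairwise // pairwise_cat; apply/and3P; split.
  + by apply/allrelP => x y _; rewrite mem_nseq => /andP[_ /eqP ->]; exact: leq0n.
  + rewrite -sorted_pairwise // sorted_map; have := sort_sorted le_total (undup s); exact: sub_sorted.
  + by rewrite -sorted_pairwise //; elim: (n - L)%N => // -[|m].
- rewrite /len /= count_cat count_nseq /= mul0n addn0 count_map -/L -uL.
  by rewrite (eq_in_count (a2 := predT)) ?count_predT // => x /cu /=; rewrite lt0n => ->.
- rewrite (@e_labels_nth x0 r w); last by move=> k; rewrite permE.
  have -> : iota 0 n = iota 0 L ++ iota L (n - L) by rewrite -{1}(subnKC Ln) iotaD.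
  rewrite map_cat flatten_cat.
  have nil_flatten l : {in l, forall k, nth 0%N r k = 0%N} ->
      flatten [seq nseq (nth 0%N r k) (nth x0 w k) | k <- l] = [::].
    elim: l => //= k l IH H; rewrite H ?mem_head // IH // => j jl.
    by apply: H; rewrite inE jl orbT.
  rewrite (nil_flatten (iota L _)); last first.
    move=> k; rewrite mem_iota => /andP[Lk _].
    by rewrite /= nth_cat size_map uL ltnNge Lk /= nth_nseq; case: ifP.
  rewrite cats0; apply: perm_trans (perm_count_undup s).
  rewrite (_ : [seq _ | k <- iota 0 L] = [seq nseq (count_mem x s) x | x <- u]); last first.
    apply: (@eq_from_nth _ [::]); rewrite ?size_map ?size_iota // => k kL.
    rewrite (nth_map 0%N) ?size_iota // nth_iota // add0n (nth_map x0) ?uL //.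
    by rewrite /= !nth_cat size_map uL kL (nth_map x0) ?uL.
  by apply: perm_flatten; apply: perm_map.
Qed.

End Classifiers.

(** The estimates run over all label sequences, whereas the initial data are controlled on
    classifiers only; symmetry of the law bridges the two. *)
Lemma symmetric_cumulant (R : realType) (n N : nat) (nN : (n <= N)%N)
    (F : probability (borel_space R N) R) (s : seq 'I_N) :
  F (kac_sphere R N) = 1%E -> symmetric_law F -> size s = n -> s != [::] ->
  exists r : n.-tuple nat, [/\ classifiers n r, len r = distinct s &
    cumulants (moment F) s = kappa nN F r].
Proof.
move=> F1 HF Es s0; have [r [sg [cr lr rs]]] := classifier_of_labels nN Es s0.
exists r; split => //; rewrite /kappa joint_cumulantE //; last first.
  by rewrite -size_eq0 size_e_labels; case: cr => _ ->; rewrite -Es size_eq0.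
rewrite -(sym_cumulants (moment0 F1) (sym_moment F) rs) -cumulants_map; congr cumulants.
by apply/funext => t; rewrite moment_relabel.
Qed.

(** * Constants *)

Lemma large_power (R : realType) (A a : R) : 0 <= A -> 0 < a ->
  exists N0 : nat, forall N : nat, (N0 <= N)%N -> A <= (N%:R - 1) `^ a.
Proof.
move=> A0 a0; exists (Num.bound (A `^ a^-1)).+1 => N hN.
have -> : A = (A `^ a^-1) `^ a by rewrite -powRrM mulVf ?powRr1 // gt_eqF.
have h : A `^ a^-1 <= N%:R - 1.
  rewrite lerBrDr; apply: le_trans (_ : (Num.bound (A `^ a^-1)).+1%:R <= _); last by rewrite ler_nat.
  by rewrite -natr1 lerD2r ltW // archi_boundP // powR_ge0.
by apply: ge0_ler_powR; rewrite ?nnegrE ?powR_ge0 ?(ltW a0) //; apply: le_trans h; exact: powR_ge0.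
Qed.

(** Undoes the n-th root and passes from powers of [N] in the hypothesis to powers of [N - 1] in the
    norm, which goes the right way since alpha is positive. *)
Lemma initial_cumulant_bound (R : realType) (kappa0 N c alpha B : R) (n l : nat) : 1 < N ->
  0 < alpha -> (0 < n)%N -> (0 < l)%N -> 1 <= B ->
  (`|kappa0| * N `^ (alpha * (l%:R - 1) - c * (n%:R - 1)) / (n.-1)`!%:R) `^ (n%:R^-1) <= B ->
  `|kappa0| <= B ^+ n * (n.-1)`!%:R * (N `^ c) ^+ n.-1 * ((N - 1) `^ alpha)^-1 ^+ l.-1.
Proof.
move=> N1 al0; case: n => // n _; case: l => // l _ B1 /=.
have N0 : 0 < N by apply: lt_trans N1.
have EE (m : nat) : m.+1%:R - 1 = m%:R :> R by rewrite -natr1 addrK.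
rewrite !EE powRD; last by apply/implyP => _; rewrite gt_eqF.
rewrite powRN !powRrM !powR_mulrn ?powR_ge0 //.
set X := (_ / _) => HX.
have f0 : 0 < n`!%:R :> R by rewrite ltr0n fact_gt0.
have P0 : 0 < N `^ c by exact: powR_gt0.
have X0 : 0 <= X.
  by apply: divr_ge0; [rewrite !mulr_ge0 ?invr_ge0 ?exprn_ge0 ?powR_ge0|exact: ltW].
have {HX} : X <= B ^+ n.+1.
  have -> : X = (X `^ n.+1%:R^-1) ^+ n.+1.
    by rewrite -powR_mulrn ?powR_ge0 // -powRrM mulVf ?powRr1 // pnatr_eq0.
  by rewrite lerXn2r // nnegrE ?powR_ge0 // (le_trans _ B1).
rewrite /X ler_pdivrMr // mulrA ler_pdivrMr ?exprn_gt0 // => H.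
have M0 : 0 < (N - 1) `^ alpha by rewrite powR_gt0 // subr_gt0.
rewrite exprVn ler_pdivlMr ?exprn_gt0 //; apply: le_trans H.
rewrite ler_wpM2l // lerXn2r ?nnegrE ?powR_ge0 // ge0_ler_powR ?nnegrE ?ltW //.
  by rewrite subr_gt0.
by rewrite ltrBlDr ltrDl.
Qed.

Theorem theorem2p16 (R : realType) :
  exists C : R -> R,
  forall (c alpha : R) (nstar : nat),
    0 <= c -> 0 < alpha -> alpha < 1 -> (0 < nstar)%N ->
  exists N0 : nat, (2 <= N0)%N /\ (nstar <= N0)%N /\
  forall (N : nat) (F0 U : probability (borel_space R N) R)
    (F : R -> probability (borel_space R N) R) (B : R),
    (N0 <= N)%N ->
    F0 (kac_sphere R N) = 1%E -> radon_law F0 -> symmetric_law F0 ->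
    kac_law F0 F ->
    uniform_sphere_law U ->
    1 <= B ->
    (forall (n : nat) (nN : (n <= N)%N) (r : n.-tuple nat),
      (1 <= n <= nstar)%N -> classifiers n r ->
      (`|kappa nN F0 r|
         * N%:R `^ (alpha * ((len r)%:R - 1) - c * (n%:R - 1))
         / (n.-1)`!%:R) `^ (n%:R^-1) <= B) ->
    forall (n : nat) (nN : (n <= N)%N) (t : R),
      (1 <= n <= nstar)%N -> 0 <= t ->
      cumulant_norm alpha N (fun r => kappa nN (F t) r - kappa nN U r)
        <= n`!%:R * C B ^+ (n ^ 2) * N%:R `^ (c * (n%:R - 1))
           * expR (- (t / 4)).
Proof.
(* The factor [2 ^ 10] is the threshold of the tail estimates; [B] absorbs the initial cumulants. *)
exists (fun B => 2 ^+ 10 * B) => c alpha nstar c0 al0 al1 ns0.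
pose A : R := 256 * (2 ^+ nstar * nstar%:R ^+ 2).
have A0 : 0 <= A by rewrite !mulr_ge0 ?exprn_ge0.
(* The power alpha of [N - 1] is [1 / q] and the power [1 - alpha] is [q * (N - 1)]; both have to
   exceed [A]. *)
have [N1 HN1] := large_power A0 al0.
have [N2 HN2] := @large_power _ A (1 - alpha) A0 (ltac:(by rewrite subr_gt0)).
exists (maxn (maxn N1 N2) (maxn 2 nstar)).
split; first by rewrite !leq_max leqnn !orbT.
split; first by rewrite !leq_max leqnn !orbT.
move=> N F0 U F B; rewrite !geq_max => /andP[/andP[/HN1 hA1 /HN2 hA2] /andP[hN nsN]].
move=> F01 _ HF0 HF HU B1 Hinit.
have NR : 1 < N%:R :> R by rewrite ltr1n.
have NR1 : 0 < N%:R - 1 :> R by rewrite subr_gt0.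
pose P : R := N%:R `^ c; pose D : R := (N%:R - 1) `^ alpha; pose q := D^-1.
have D1 : 1 <= D.
  apply: le_trans (_ : (1 : R) `^ alpha <= _); [by rewrite powR1|]; apply: ge0_ler_powR; rewrite ?nnegrE //; [exact: ltW|exact: ltW|].
  by rewrite lerBrDr -(natrD _ 1 1) ler_nat.
have D0 : 0 < D by exact: lt_le_trans D1.
have q01 : 0 < q <= 1 by rewrite /q invr_gt0 D0 invf_le1.
have P1 : 1 <= P by rewrite -[leLHS](powRr0 (N%:R : R)) ler_powR // ltW.
have C1 : 2 ^+ 10 <= 2 ^+ 10 * B by rewrite ler_peMr // exprn_ge0.
have hqa : 256 * (2 ^+ nstar * nstar%:R ^+ 2) * q <= 1 by rewrite ler_pdivrMr // mul1r.
have hqb : 256 * (2 ^+ nstar * nstar%:R ^+ 2) <= q * (N%:R - 1).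
  apply: le_trans hA2 _; rewrite powRB ?powRr1 ?(ltW NR1) //; first by rewrite mulrC.
  by apply/implyP => _; rewrite gt_eqF.
have F1 (u : R) : 0 <= u -> F u (kac_sphere R N) = 1%E by case: HF => _ H _; exact: H.
have Hbound (s : seq 'I_N) : s != [::] -> (size s <= nstar)%N ->
    `|cumulants (moment (F 0)) s - cumulants (moment U) s|
      <= majorant (2 ^+ 10 * B) P (size s) * q ^+ (distinct s).-1.
  move=> s0 sn; set K := majorant _ _ _.
  have s0' : (0 < size s)%N by rewrite lt0n size_eq0.
  have Ubound := uniform_cumulant_bound hN q01 C1 P1 hqa hqb HU (leqnn _) s0 sn.
  have -> : cumulants (moment (F 0)) s = cumulants (moment F0) s.
    by congr cumulants; apply/funext => u; exact: kac_law_moment0 HF.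
  have [r [cr lr ->]] := symmetric_cumulant (leq_trans sn nsN) F01 HF0 (erefl _) s0.
  have l0 : (0 < len r)%N by rewrite lr distinct_gt0.
  have Hr := Hinit _ (leq_trans sn nsN) r (introT andP (conj s0' sn)) cr.
  have := initial_cumulant_bound NR al0 s0' l0 B1 Hr; rewrite lr -/P -/D -/q => H0.
  apply: le_trans (ler_normB _ _) _; apply: le_trans (lerD H0 Ubound) _.
  rewrite -mulrDl ler_wpM2r //; first by rewrite exprn_ge0 // ltW //; case/andP: q01.
  (* The uniform cumulants use the other half of the majorant. *)
  suff h : B ^+ size s * ((size s).-1)`!%:R * P ^+ (size s).-1 <= 2^-1 * K.
    by move: h; rewrite -/K; move: (B ^+ _ * _ * _) K => x y; lra.
  rewrite /K /majorant mulrA ler_wpM2r ?exprn_ge0 ?(le_trans ler01 P1) //.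
  case: (size s) s0' => // m _.
  have hf : (m`!%:R : R) <= m.+1`!%:R by rewrite ler_nat factS leq_pmull.
  have hC : B ^+ m.+1 * 2 <= (2 ^+ 10 * B) ^+ (m.+1 ^ 2).
    apply: le_trans (_ : (2 ^+ 10 * B) ^+ m.+1 <= _); last first.
      apply: ler_weXn2l; last by rewrite expnS leq_pmulr // expn_gt0.
      by apply: le_trans C1; rewrite -natrX ler1n.
    rewrite exprMn mulrC ler_wpM2r ?exprn_ge0 ?(le_trans ler01 B1) //.
    by rewrite -exprM -[leLHS]expr1 ler_weXn2l // ler1n.
  rewrite -ler_pdivrMl ?invr_gt0 // invrK mulrA [2 * _]mulrC [leRHS]mulrC.
  by rewrite ler_pM // ?mulr_ge0 // exprn_ge0 // (le_trans ler01).
move=> n nN t /andP[n0 nn] t0.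
have relax := cumulant_relaxation hN q01 C1 P1 hqa hqb HU HF Hbound (leqnn _).
have rhs : n`!%:R * (2 ^+ 10 * B) ^+ (n ^ 2) * N%:R `^ (c * (n%:R - 1)) * expR (- (t / 4)) =
    majorant (2 ^+ 10 * B) P n * expR (- (t / 4)).
  congr (_ * _ * _); rewrite powRrM -/P; case: n n0 {nN nn} => // n _.
  by rewrite -natr1 addrK powR_mulrn // (le_trans ler01).
rewrite /cumulant_norm rhs.
(* For [n = 1] there is no classifier besides [1_n], and the norm is the default value 0 of the
   supremum. *)
have [->|/set0P ne] := eqVneq (classifiers' n) set0.
  rewrite image_set0 sup0 mulr_ge0 ?expR_ge0 // ltW // majorant_gt0 //.
  by apply: le_trans C1; rewrite -natrX ler1n.
apply: ge_sup; first by case: ne => r Hr; eexists; exists r => //; reflexivity.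
move=> _ [r [cr _] <-].
have es : size (e_labels nN r) = n by rewrite size_e_labels; case: cr.
have e0 : e_labels nN r != [::] by rewrite -size_eq0 es -lt0n.
rewrite /kappa !joint_cumulantE //; [|exact: HU.1|exact: F1].
have := relax (e_labels nN r) t e0; rewrite es => /(_ nn t0) H.
have l0 := distinct_gt0 e0; rewrite distinct_e_labels in H l0.
have -> : (N%:R - 1) `^ (alpha * ((len r)%:R - 1)) = D ^+ (len r).-1.
  rewrite powRrM -/D; case: (len r) l0 => // l _.
  by rewrite -natr1 addrK powR_mulrn // ltW.
by move: H; rewrite exprVn ler_pdivlMr // exprn_gt0.
Qed.
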